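(* Assume $\operatorname{Im}(\tau)<0$. For every holomorphic bundle $E$ on $T_{\theta,\tau}$ there is a constant $C=C(E)\in\mathbb R$ such that $\operatorname{Ext}^1_{\mathcal C}(E_0,E)=0$ for every standard holomorphic bundle $E_0$ with $\mu(E_0)<C$.
   Context: Fix $\theta\in\mathbb R\setminus\mathbb Q$, $\tau\in\mathbb C\setminus\mathbb R$. $A_\theta$ is the algebra of series $\sum a_{m,n}U_1^mU_2^n$ with rapidly decreasing coefficients and $U_1U_2=e^{2\pi i\theta}U_2U_1$, $\delta(\sum a_{m,n}U_1^mU_2^n)=2\pi i\sum(m\tau+n)a_{m,n}U_1^mU_2^n$. A holomorphic bundle is a pair $(E,\overline\nabla)$ with $E$ a finitely generated projective right $A_\theta$-module and $\overline\nabla:E\to E$ $\mathbb C$-linear with $\overline\nabla(ea)=\overline\nabla(e)a+e\delta(a)$; morphisms are $A_\theta$-linear maps commuting with $\overline\nabla$, giving the exact category $\mathcal C$ (short exact sequences = sequences exact as $A_\theta$-modules), with Yoneda extension groups $\operatorname{Ext}^1_{\mathcal C}$. Standard holomorphic bundles: for coprime $(c,d)$ with $c\theta+d>0$, $z\in\mathbb C$: if $c\neq0$, $E_{d,c}(\theta)=\mathcal S(\mathbb R\times\mathbb Z/c\mathbb Z)$ with $fU_1(x,\alpha)=f(x-\frac1\mu,\alpha-1)$, $fU_2(x,\alpha)=\exp(2\pi i(x-\frac{\alpha d}{c}))f(x,\alpha)$, $\mu=\frac{c}{c\theta+d}$, $\overline\nabla_zf=\partial_xf+2\pi i(\tau\mu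 x+z)f$; if $(c,d)=(0,1)$, $E_{1,0}(\theta)=A_\theta$ with $\overline\nabla_z(a)=\delta(a)+2\pi iza$. The slope is $\mu(E_{d,c}(\theta))=\frac{c}{c\theta+d}$. *)

(* Defs.v *)
(* Complex numbers are R[i] (mathcomp-real-closed),
   viewed as a numFieldType so that limits are available. *)
From HB Require Import structures.
From mathcomp Require Import all_boot all_order all_algebra.
From mathcomp Require Import all_classical all_reals all_analysis.
From mathcomp Require Import complex.
Set Implicit Arguments. Unset Strict Implicit. Unset Printing Implicit Defensive.
Import Order.TTheory GRing.Theory Num.Theory.
Import numFieldNormedType.Exports.
Local Open Scope classical_set_scope.
Local Open Scope ring_scope.

Section NCTorus.
Variable R : realType.

Definition CC : numFieldType := R[i].
Definition cR (x : R) : CC := Complex x 0.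
Definition cabs (x : CC) : R := Num.sqrt (complex.Re x ^+ 2 + complex.Im x ^+ 2).
Definition cRe (x : CC) : R := complex.Re x.
Definition cIm (x : CC) : R := complex.Im x.
Definition twopii : CC := Complex 0 (2 * pi).
Definition ee (t : R) : CC := Complex (cos (2 * pi * t)) (sin (2 * pi * t)).
Definition zR (k : int) : R := k%:~R.
Definition zC (k : int) : CC := k%:~R.

(* Sum over Z^2 of a family, as the limit of the square partial sums
   sum_{|k|,|l| <= N}; for the absolutely summable families occurring below
   this is the usual sum. *)
Definition sumZ2 (f : int -> int -> CC) : CC :=
  limn (fun N : nat =>
    \sum_(i < (N + N).+1) \sum_(j < (N + N).+1)
       f (i%:Z - N%:Z) (j%:Z - N%:Z)).

(* an element sum a_{m,n} U1^m U2^n is represented by its coefficient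
   function a : Z -> Z -> C, which must be rapidly decreasing *)
Definition coeffs := int -> int -> CC.

Definition rapid (a : coeffs) : Prop :=
  forall k : nat, exists M : R, forall m n : int,
    cabs (a m n) * (1 + `|zR m| + `|zR n|) ^+ k <= M.

Definition aone : coeffs := fun m n => if (m == 0) && (n == 0) then 1 else 0.
Definition aadd (a b : coeffs) : coeffs := fun m n => a m n + b m n.

(* product, using U1 U2 = e^{2 pi i theta} U2 U1, i.e.
   U2^l U1^p = e^{-2 pi i theta l p} U1^p U2^l *)
Definition amul (theta : R) (a b : coeffs) : coeffs := fun m n =>
  sumZ2 (fun k l => a k l * b (m - k) (n - l) * ee (- theta * zR l * zR (m - k))).

Definition delta (tau : CC) (a : coeffs) : coeffs := fun m n =>
  twopii * (zC m * tau + zC n) * a m n.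

(* A module is given by its elements: a predicate P on an ambient abelian group V
   (the module is {e : V | P e}), a right action of A_theta and an operator nab. *)
Record MC := {
  mcV : zmodType;
  mcP : set mcV;
  mcact : mcV -> coeffs -> mcV;
  mcnab : mcV -> mcV }.
Arguments mcP : clear implicits.
Arguments mcact : clear implicits.
Arguments mcnab : clear implicits.

Definition is_rmod (theta : R) (X : MC) : Prop :=
  let P := mcP X in let act := mcact X in
  ((P 0) /\
     ((forall e e', P e -> P e' -> P (e + e'))) /\
     ((forall e, P e -> P (- e))) /\
     ((forall e a, P e -> rapid a -> P (act e a))) /\
     ((forall e e' a, P e -> P e' -> rapid a -> act (e + e') a = act e a + act e' a)) /\
     ((forall e a b, P e -> rapid a -> rapid b -> act e (aadd a b) = act e a + act e b)) /\
     ((forall e, P e -> act e aone = e)) /\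
     ((forall e a b, P e -> rapid a -> rapid b ->
         act (act e a) b = act e (amul theta a b)))).

(* nab(e a) = nab(e) a + e delta(a) (C-linearity follows from additivity
   and the Leibniz rule, since delta kills scalars) *)
Definition is_conn (tau : CC) (X : MC) : Prop :=
  let P := mcP X in let act := mcact X in let nab := mcnab X in
  (((forall e, P e -> P (nab e))) /\
     ((forall e e', P e -> P e' -> nab (e + e') = nab e + nab e') /\
      (forall e a, P e -> rapid a ->
         nab (act e a) = act (nab e) a + act e (delta tau a)))).

Definition is_fgproj (theta : R) (X : MC) : Prop :=
  let P := mcP X in let act := mcact X in
  exists (n : nat) (i : mcV X -> 'I_n -> coeffs) (p : ('I_n -> coeffs) -> mcV X),
  (((forall e k, P e -> rapid (i e k))) /\
     ((forall e e', P e -> P e' -> i (e + e') = fun k => aadd (i e k) (i e' k))) /\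
     ((forall e a, P e -> rapid a -> i (act e a) = fun k => amul theta (i e k) a)) /\
     ((forall v, (forall k, rapid (v k)) -> P (p v))) /\
     ((forall v w, (forall k, rapid (v k)) -> (forall k, rapid (w k)) ->
          p (fun k => aadd (v k) (w k)) = p v + p w)) /\
     ((forall v a, (forall k, rapid (v k)) -> rapid a ->
          p (fun k => amul theta (v k) a) = act (p v) a) /\
      (forall e, P e -> p (i e) = e))).

Definition is_holbundle (theta : R) (tau : CC) (X : MC) : Prop :=
  ((is_rmod theta X) /\
     (is_conn tau X) /\
     (is_fgproj theta X)).

Definition is_mor (X Y : MC) (f : mcV X -> mcV Y) : Prop :=
  (((forall e, mcP X e -> mcP Y (f e))) /\
     ((forall e e', mcP X e -> mcP X e' -> f (e + e') = f e + f e')) /\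
     ((forall e a, mcP X e -> rapid a -> f (mcact X e a) = mcact Y (f e) a) /\
      (forall e, mcP X e -> f (mcnab X e) = mcnab Y (f e)))).

(* Ext^1_C(E0, E) = 0: every short exact sequence 0 -> E -> X -> E0 -> 0 in C
   (X a holomorphic bundle, exactness as A_theta-modules) represents the zero
   (split) Yoneda class, i.e. the deflation X -> E0 has a section in C. *)
Definition Ext1_vanishes (theta : R) (tau : CC) (E0 E : MC) : Prop :=
  forall (X : MC), is_holbundle theta tau X ->
  forall (j : mcV E -> mcV X) (q : mcV X -> mcV E0),
    is_mor j -> is_mor q ->
    (forall e e', mcP E e -> mcP E e' -> j e = j e' -> e = e') ->
    (forall y, mcP E0 y -> exists2 x, mcP X x & q x = y) ->
    (forall x, mcP X x -> (q x = 0 <-> exists2 e, mcP E e & j e = x)) ->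
  exists s : mcV E0 -> mcV X, is_mor s /\ (forall y, mcP E0 y -> q (s y) = y).

Definition schwartz (g : R -> CC) : Prop :=
  forall u : R -> R, (u = cRe \o g \/ u = cIm \o g) ->
  (forall (n : nat) (x : R), derivable (derive1n n u) x 1) /\
  (forall n k : nat, exists M : R, forall x : R,
      `|x| ^+ k * `|derive1n n u x| <= M).

Definition cderiv (g : R -> CC) (x : R) : CC :=
  Complex (derive1 (cRe \o g) x) (derive1 (cIm \o g) x).

(* E_{d,c}(theta), c <> 0: S(R x Z/cZ), with Z/cZ represented by c-periodic
   functions of alpha in Z *)
Definition SRZ := R -> int -> CC.

Definition Edc_P (c : int) : set SRZ := fun f =>
  (forall x alpha, f x (alpha + c) = f x alpha) /\
  (forall alpha, schwartz (fun x => f x alpha)).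

Definition Edc_act (theta : R) (c d : int) (f : SRZ) (a : coeffs) : SRZ :=
  fun x alpha =>
    let mu := zR c / (zR c * theta + zR d) in
    sumZ2 (fun m n => a m n * ee (zR n * (x - zR alpha * zR d / zR c))
                            * f (x - zR m / mu) (alpha - m)).

Definition Edc_nab (theta : R) (tau : CC) (c d : int) (z : CC) (f : SRZ) : SRZ :=
  fun x alpha =>
    let mu := zR c / (zR c * theta + zR d) in
    cderiv (fun t => f t alpha) x + twopii * (tau * cR (mu * x) + z) * f x alpha.

Definition Edc_bundle (theta : R) (tau : CC) (c d : int) (z : CC) : MC :=
  {| mcV := (SRZ : zmodType); mcP := Edc_P c; mcact := Edc_act theta c d;
     mcnab := Edc_nab theta tau c d z |}.

Definition E10_bundle (theta : R) (tau : CC) (z : CC) : MC :=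
  {| mcV := (coeffs : zmodType); mcP := rapid; mcact := amul theta;
     mcnab := fun a m n => delta tau a m n + twopii * z * a m n |}.

(* the standard holomorphic bundle E_{d,c}(theta) with connection nab_z
   (used for coprime (c,d) with c theta + d > 0; for c = 0 this forces d = 1) *)
Definition std_bundle (theta : R) (tau : CC) (c d : int) (z : CC) : MC :=
  if c == 0 then E10_bundle theta tau z else Edc_bundle theta tau c d z.

Definition slope (theta : R) (c d : int) : R := zR c / (zR c * theta + zR d).

End NCTorus.

(* Main.v *)
(* For slope mu < 0 the bundle E_{d,c} has a finite frame: Schwartz functions ff_k, gg_k with
   f = sum_k ff_k . <gg_k, f>, where <g, f> is an A_theta-valued pairing. Such a frame comes from
   a partition of unity on the line by windows of small support, through Fourier inversion.

   Lifting the ff_k through the deflation X -> E_{d,c} gives an A_theta-linear section s_0, and the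
   defect nab s_0 - s_0 nab is an A_theta-linear map E_{d,c} -> E. In free coordinates on E, where
   the connection is delta + B, every such map has the form f |-> (<h_l, f>)_l with h_l Schwartz.
   Correcting s_0 by f |-> p (<w_l, f>)_l produces a holomorphic section as soon as
     w_l' - 2 pi i (tau mu x + z) w_l + sum_k B_lk . w_k = h_l.
   Here -2 pi i tau mu has real part r^2 = 2 pi Im(tau) mu > 0, and the scalar operator
   w' + (r^2 x + ...) w has a right inverse of norm O(1/r) in weighted sup norms, with weights
   (1 + eps^2 x^2)^k flat enough for translations by the B_lk to be harmless. For mu below a
   constant depending only on B the Neumann series converges in all these norms. *)

(* The bound on the slope must be fixed before the parameter z and the order of decay k are known.
   Changing z only moves the centre of the weights and alters some phases, so no estimate sees it. A
   large k makes both the resolvent and the translations in B expensive; letting eps shrink with k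
   brings both costs back under bounds free of k. The Neumann series mentions neither k nor eps, so
   a single solution acquires every order of decay. One round of the series costs 4/r for the
   resolvent, 9 for a sum over Z^2, 2 for the translations and n for the size of B; a ratio of at
   most 1/2 means r >= 144 n M, where M bounds B. Only sup norms are estimated. Derivatives come for
   free, since the equation expresses w' through functions of the same kind. The equation for w
   carries the transpose of nab, so its drift has the opposite sign. This is what makes the
   homogeneous solutions decay when both Im(tau) and mu are negative, hence the operator onto rather
   than merely injective. *)
Require Import Defs.
From HB Require Import structures.
From mathcomp Require Import all_boot all_order all_algebra.
From mathcomp Require Import all_classical all_reals all_analysis.
From mathcomp Require Import complex ring lra zify.
Set Implicit Arguments. Unset Strict Implicit. Unset Printing Implicit Defensive.
Import Order.TTheory GRing.Theory Num.Theory.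
Import numFieldNormedType.Exports.
Local Open Scope classical_set_scope.
Local Open Scope ring_scope.

(** * Complex-valued functions *)

Section Complex.
Import ComplexField.Normc.
Variable R : realType.
Implicit Types (z w : CC R) (x t : R).

Lemma CC_eq z w : cRe z = cRe w -> cIm z = cIm w -> z = w.
Proof. by case: z => a b; case: w => a' b' /= -> ->. Qed.

Lemma cReD z w : cRe (z + w) = cRe z + cRe w. Proof. by case: z; case: w. Qed.
Lemma cImD z w : cIm (z + w) = cIm z + cIm w. Proof. by case: z; case: w. Qed.
Lemma cReN z : cRe (- z) = - cRe z. Proof. by case: z. Qed.
Lemma cImN z : cIm (- z) = - cIm z. Proof. by case: z. Qed.
Lemma cReB z w : cRe (z - w) = cRe z - cRe w. Proof. by rewrite cReD cReN. Qed.
Lemma cImB z w : cIm (z - w) = cIm z - cIm w. Proof. by rewrite cImD cImN. Qed.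
Lemma cReM z w : cRe (z * w) = cRe z * cRe w - cIm z * cIm w.
Proof. by case: z; case: w. Qed.
Lemma cImM z w : cIm (z * w) = cRe z * cIm w + cIm z * cRe w.
Proof. by case: z; case: w. Qed.
Lemma cRe0 : cRe (0 : CC R) = 0. Proof. by []. Qed.
Lemma cIm0 : cIm (0 : CC R) = 0. Proof. by []. Qed.
Lemma cRe1 : cRe (1 : CC R) = 1. Proof. by []. Qed.
Lemma cIm1 : cIm (1 : CC R) = 0. Proof. by []. Qed.
Lemma cRe_cR x : cRe (cR x) = x. Proof. by []. Qed.
Lemma cIm_cR x : cIm (cR x) = 0. Proof. by []. Qed.
Definition cE := (cReD, cImD, cReN, cImN, cReM, cImM, cRe0, cIm0, cRe1, cIm1, cRe_cR, cIm_cR).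

Lemma cR_additive : {morph @cR R : x y / x + y}.
Proof. by move=> x y; apply: CC_eq; rewrite !cE ?addr0. Qed.
Lemma cRM x y : cR (x * y) = cR x * cR y.
Proof. by apply: CC_eq; rewrite !cE; ring. Qed.
Lemma cRN x : cR (- x) = - cR x.
Proof. by apply: CC_eq; rewrite !cE; ring. Qed.
Lemma cRB x y : cR (x - y) = cR x - cR y.
Proof. by rewrite cR_additive cRN. Qed.
Lemma cR0 : cR (0 : R) = 0. Proof. by []. Qed.
Lemma cR1 : cR (1 : R) = 1. Proof. by []. Qed.

Lemma zC_cR (k : int) : zC R k = cR (zR R k).
Proof.
rewrite /zC /zR.
have N (n : nat) : (n%:R : CC R) = cR n%:R.
  by elim: n => [//|n IH]; rewrite !(mulrS 1) cR_additive IH.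
case: k => n; first by rewrite -!pmulrn N.
by rewrite NegzE !mulrNz -!pmulrn N cRN.
Qed.

Lemma cabs_normc z : cabs z = normc z. Proof. by case: z. Qed.
Lemma cabsM z w : cabs (z * w) = cabs z * cabs w.
Proof. by rewrite !cabs_normc normcM. Qed.
Lemma cabsD z w : cabs (z + w) <= cabs z + cabs w.
Proof. by rewrite !cabs_normc le_normcD. Qed.
Lemma cabsN z : cabs (- z) = cabs z.
Proof. by rewrite !cabs_normc normcN. Qed.
Lemma cabsB z w : cabs (z - w) = cabs (w - z).
Proof. by rewrite -cabsN opprB. Qed.
Lemma cabs0 : cabs (0 : CC R) = 0. Proof. by rewrite cabs_normc normc0. Qed.
Lemma cabs1 : cabs (1 : CC R) = 1. Proof. by rewrite cabs_normc normc1. Qed.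
Lemma cabs_ge0 z : 0 <= cabs z. Proof. exact: sqrtr_ge0. Qed.
Lemma cabs_eq0 z : cabs z = 0 -> z = 0. Proof. by rewrite cabs_normc => /eq0_normc. Qed.
Lemma cabs_cR x : cabs (cR x) = `|x|.
Proof. by rewrite /cabs /= expr0n /= addr0 sqrtr_sqr. Qed.
Lemma Re_le_cabs z : `|cRe z| <= cabs z.
Proof.
rewrite -sqrtr_sqr ler_sqrt ?addr_ge0 ?sqr_ge0 // lerDl sqr_ge0 //.
Qed.
Lemma Im_le_cabs z : `|cIm z| <= cabs z.
Proof.
rewrite -sqrtr_sqr ler_sqrt ?addr_ge0 ?sqr_ge0 // lerDr sqr_ge0 //.
Qed.
Lemma cabs_le_ReIm z : cabs z <= `|cRe z| + `|cIm z|.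
Proof.
have h : 0 <= `|cRe z| + `|cIm z| by rewrite addr_ge0.
rewrite -(ger0_norm h) -sqrtr_sqr ler_sqrt ?sqr_ge0 //.
rewrite -(real_normK (num_real (complex.Re z))) -(real_normK (num_real (complex.Im z))).
rewrite sqrrD -/(cRe z) -/(cIm z) -addrA lerD2l lerDr mulrn_wge0 // mulr_ge0 //.
Qed.
Lemma cabs_sqr z : cabs z ^+ 2 = cRe z ^+ 2 + cIm z ^+ 2.
Proof. by rewrite sqr_sqrtr // addr_ge0 ?sqr_ge0. Qed.

Lemma cabs_sum (I : Type) (r : seq I) (P : pred I) (F : I -> CC R) :
  cabs (\sum_(i <- r | P i) F i) <= \sum_(i <- r | P i) cabs (F i).
Proof.
elim/big_rec2: _ => [|i y1 y2 _ h]; first by rewrite cabs0.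
by apply: le_trans (cabsD _ _) _; rewrite lerD2l.
Qed.

Lemma cabs_small z : (forall e : R, 0 < e -> cabs z <= e) -> z = 0.
Proof.
move=> h; apply: cabs_eq0; apply/eqP; rewrite eq_le cabs_ge0 andbT.
by apply/ler_addgt0Pl => e e0; rewrite addr0 h.
Qed.

Lemma eeD t u : ee (t + u) = ee t * ee u.
Proof. by apply: CC_eq; rewrite /= mulrDr ?cosD ?sinD; ring. Qed.
Lemma ee0 : ee (0 : R) = 1.
Proof. by apply: CC_eq; rewrite /= mulr0 ?cos0 ?sin0. Qed.
Lemma cabs_ee t : cabs (ee t) = 1.
Proof. by rewrite /cabs /= cos2Dsin2 sqrtr1. Qed.
Lemma eeN t : ee (- t) * ee t = 1.
Proof. by rewrite -eeD addNr ee0. Qed.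
Lemma ee1 : ee (1 : R) = 1.
Proof. by apply: CC_eq; rewrite /= mulr1 ?mulr_natl ?cos2pi ?sin2pi. Qed.
Lemma ee_nat (n : nat) : ee (n%:R : R) = 1.
Proof. by elim: n => [|n IH]; rewrite ?ee0 // -natr1 eeD IH ee1 mul1r. Qed.
Lemma ee_int (k : int) : ee (zR R k) = 1.
Proof.
case: k => n; first exact: ee_nat.
rewrite /zR NegzE mulrNz; have := eeN (n.+1%:R : R).
by rewrite ee_nat mulr1.
Qed.

Lemma zRD (k l : int) : zR R (k + l) = zR R k + zR R l. Proof. exact: intrD. Qed.
Lemma zRN (k : int) : zR R (- k) = - zR R k. Proof. exact: mulrNz. Qed.
Lemma zRB (k l : int) : zR R (k - l) = zR R k - zR R l. Proof. exact: intrB. Qed.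
Lemma zRM (k l : int) : zR R (k * l) = zR R k * zR R l. Proof. exact: intrM. Qed.

(** [cderiv] returns a value even where no derivative exists; this relation carries existence along
    with the value. *)
Definition cder (f : R -> CC R) (x : R) (l : CC R) :=
  is_derive x 1 (fun t => cRe (f t)) (cRe l) /\ is_derive x 1 (fun t => cIm (f t)) (cIm l).

Lemma cderiv_eq f x l : cder f x l -> cderiv f x = l.
Proof.
move=> [h1 h2]; apply: CC_eq => /=.
- by rewrite derive1E; exact: (@derive_val _ _ _ _ _ _ _ h1).
- by rewrite derive1E; exact: (@derive_val _ _ _ _ _ _ _ h2).
Qed.

Lemma cder_ext (f g : R -> CC R) x l : f =1 g -> cder f x l -> cder g x l.
Proof. by move=> /funext ->. Qed.

Lemma cder_uniq f x l l' : cder f x l -> cder f x l' -> l = l'.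
Proof. by move=> /cderiv_eq <- /cderiv_eq <-. Qed.

Lemma cder_cst z x : cder (fun=> z) x 0.
Proof. by split; apply: is_derive_cst. Qed.

Lemma cderD f g x l m : cder f x l -> cder g x m -> cder (fun t => f t + g t) x (l + m).
Proof.
move=> [f1 f2] [g1 g2]; split; rewrite !cE.
- under eq_fun do rewrite cReD; exact: is_deriveD.
- under eq_fun do rewrite cImD; exact: is_deriveD.
Qed.

Lemma cderN f x l : cder f x l -> cder (fun t => - f t) x (- l).
Proof.
move=> [f1 f2]; split; rewrite !cE.
- under eq_fun do rewrite cReN; exact: is_deriveN.
- under eq_fun do rewrite cImN; exact: is_deriveN.
Qed.

Lemma cderB f g x l m : cder f x l -> cder g x m -> cder (fun t => f t - g t) x (l - m).
Proof. by move=> hf hg; apply: cderD => //; apply: cderN. Qed.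

Lemma is_deriveM' (f g : R -> R) x df dg : is_derive x 1 f df -> is_derive x 1 g dg ->
  is_derive x 1 (fun t => f t * g t) (df * g x + f x * dg).
Proof.
move=> hf hg; have := is_deriveM hf hg.
by move=> h; apply: (is_derive_eq h); rewrite /GRing.scale /=; ring.
Qed.

Lemma cderM f g x l m : cder f x l -> cder g x m ->
  cder (fun t => f t * g t) x (l * g x + f x * m).
Proof.
move=> [f1 f2] [g1 g2]; split; rewrite !cE.
- under eq_fun do rewrite cReM.
  have h := is_deriveB (is_deriveM' f1 g1) (is_deriveM' f2 g2).
  by apply: (is_derive_eq h); ring.
- under eq_fun do rewrite cImM.
  have h := is_deriveD (is_deriveM' f1 g2) (is_deriveM' f2 g1).
  by apply: (is_derive_eq h); ring.
Qed.

Lemma cderZ z f x l : cder f x l -> cder (fun t => z * f t) x (z * l).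
Proof. by move=> h; have := cderM (cder_cst z x) h; rewrite mul0r add0r. Qed.

Lemma cder_cR (f : R -> R) x l : is_derive x 1 f l -> cder (fun t => cR (f t)) x (cR l).
Proof. by move=> h; split => //=; apply: is_derive_cst. Qed.

Lemma cder_sum (I : Type) (r : seq I) (P : pred I) (F : I -> R -> CC R) (G : I -> CC R) x :
  (forall i, P i -> cder (F i) x (G i)) ->
  cder (fun t => \sum_(i <- r | P i) F i t) x (\sum_(i <- r | P i) G i).
Proof.
move=> h; elim: r => [|i r IH].
  by under eq_fun do rewrite big_nil; rewrite big_nil; apply: cder_cst.
under eq_fun do rewrite big_cons; rewrite big_cons.
by case: ifP => // Pi; apply: cderD => //; exact: h.
Qed.

Lemma is_derive_comp (f g : R -> R) x df dg :
  is_derive (g x) 1 f df -> is_derive x 1 g dg ->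
  is_derive x 1 (fun t => f (g t)) (dg * df).
Proof. by move=> hf hg; have := is_derive1_comp hf hg; rewrite mulrC. Qed.

Lemma cder_comp f (g : R -> R) x l m : cder f (g x) l -> is_derive x 1 g m ->
  cder (fun t => f (g t)) x (cR m * l).
Proof.
move=> [f1 f2] hg; split.
- have := is_derive_comp f1 hg; rewrite !cE mul0r subr0.
  by [].
- have := is_derive_comp f2 hg; rewrite !cE mul0r addr0.
  by [].
Qed.

Lemma is_derive_affine (a b : R) x : is_derive x 1 (fun t => a * t + b) a.
Proof.
have h := is_deriveD (is_deriveM' (is_derive_cst a x 1) (is_derive_id x 1)) (is_derive_cst b x 1).
by apply: (is_derive_eq h); rewrite /= mul0r add0r addr0 mulr1.
Qed.

Lemma cder_shift f s x l : cder f (x - s) l -> cder (fun t => f (t - s)) x l.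
Proof.
move=> h; have h1 : is_derive x 1 (fun t : R => t - s) 1.
  have := is_derive_affine 1 (- s) x.
  by under eq_fun do rewrite mul1r.
by have := cder_comp (g := fun t => t - s) h h1; rewrite mul1r.
Qed.

Lemma cder_ee (a b : R) x : cder (fun t => ee (a * t + b)) x (twopii R * cR a * ee (a * x + b)).
Proof.
have h := is_derive_affine (2 * pi * a) (2 * pi * b) x.
have E t : 2 * pi * (a * t + b) = 2 * pi * a * t + 2 * pi * b by ring.
split => /=; under eq_fun do rewrite E; rewrite E.
- have h1 := is_derive_comp (is_derive_cos _) h.
  by apply: (is_derive_eq h1); ring.
- have h1 := is_derive_comp (is_derive_sin _) h.
  by apply: (is_derive_eq h1); ring.
Qed.

End Complex.

(** * Limits of complex sequences with explicit rates *)

Section Limits.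
Variable R : realType.

(** Only the limsup is bounded, from above: the sequences concerned are majorants of absolute
    values, so a lower bound carries no information. *)
Definition to0 (t : nat -> R) := forall e : R, 0 < e -> exists N : nat, forall n, (N <= n)%N -> t n <= e.

Definition clim (a : nat -> CC R) (l : CC R) := to0 (fun n => cabs (a n - l)).

Lemma to0_le (s t : nat -> R) : (forall n, s n <= t n) -> to0 t -> to0 s.
Proof. by move=> h ht e e0; have [N hN] := ht e e0; exists N => n /hN; apply: le_trans. Qed.

Lemma to0D (s t : nat -> R) : to0 s -> to0 t -> to0 (fun n => s n + t n).
Proof.
move=> hs ht e e0; have e2 : 0 < e / 2 by lra.
have [N hN] := hs _ e2; have [M hM] := ht _ e2.
exists (maxn N M) => n; rewrite geq_max => /andP[/hN h1 /hM h2]; lra.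
Qed.

Lemma to0Z (c : R) (t : nat -> R) : 0 <= c -> to0 t -> to0 (fun n => c * t n).
Proof.
move=> c0 ht e e0; have h : 0 < e / (1 + c) by rewrite divr_gt0 //; lra.
have [N hN] := ht _ h; exists N => n /hN h1.
apply: (le_trans (ler_wpM2l c0 h1)); rewrite mulrCA; apply: ler_piMr; first exact: ltW.
by rewrite ler_pdivrMr; lra.
Qed.

Lemma to0_harmonic (c : R) : to0 (fun n => c / n.+1%:R).
Proof.
have [c0|/ltW c0] := leP c 0.
  move=> e e0; exists 0%N => n _; apply: (le_trans _ (ltW e0)).
  by rewrite mulr_le0_ge0 // invr_ge0.
apply: to0Z => // e e0.
have := archi_boundP (ltW (divr_gt0 ltr01 e0)).
set N := Num.bound _ => hN; exists N => n Nn.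
rewrite invf_ple ?posrE ?ltr0Sn // (le_trans _ (_ : n%:R <= _)) ?ler_nat //.
by rewrite div1r in hN; rewrite (le_trans (ltW hN)) // ler_nat.
Qed.

Lemma to0_cabs_eq (z : CC R) t : (forall n : nat, cabs z <= t n) -> to0 t -> z = 0.
Proof.
move=> h ht; apply: cabs_small => e e0; have [N hN] := ht _ e0.
by apply: le_trans (h N) (hN _ _).
Qed.

Lemma clim_uniq a l l' : clim a l -> clim a l' -> l = l'.
Proof.
move=> h h'; apply/eqP; rewrite -subr_eq0; apply/eqP.
apply: (to0_cabs_eq _ (to0D h h')) => n.
rewrite (_ : l - l' = (a n - l') - (a n - l)); last by ring.
have := cabsD (a n - l') (- (a n - l)); rewrite cabsN => h1.
by apply: (le_trans h1); rewrite addrC.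
Qed.

Lemma clim_limn a l : clim a l -> limn a = l.
Proof.
move=> h; apply: (@cvg_lim (CC R)); first exact: (@norm_hausdorff (CC R) (CC R)).
apply/(@cvgrPdist_le (CC R) (CC R)) => e.
rewrite ltcE /= => /andP[/eqP e1 e0].
have [N hN] := h (complex.Re e) e0.
exists N => // n /= /hN hn.
rewrite normc_def lecE /= e1 eqxx /=.
by rewrite -/(cabs (l - a n)) cabsB.
Qed.

Lemma to0_ball_cvg (u : nat -> R) (t : nat -> R) :
  (forall m n, (m <= n)%N -> `|u n - u m| <= t m) -> to0 t -> cvgn u.
Proof.
move=> h ht; apply: cauchy_cvg; apply: cauchy_exP => e e0.
have e2 : 0 < e / 2 by lra.
have [N hN] := ht _ e2.
exists (u N); exists N => // n /= Nn.
rewrite -ball_normE /= distrC; have := h _ _ Nn; have := hN _ (leqnn N).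
move=> h1 h2; lra.
Qed.

(** The Cauchy modulus survives in the limit, so convergence comes with its rate; all later tail
    estimates of sums over Z^2 and of geometric series are instances. *)
Lemma clim_cauchy a t : (forall m n, (m <= n)%N -> cabs (a n - a m) <= t m) -> to0 t ->
  exists2 l, clim a l & forall m, cabs (l - a m) <= t m.
Proof.
move=> h ht.
have c1 : cvgn (fun n => cRe (a n)).
  by apply: (to0_ball_cvg _ ht) => m n mn; rewrite -cReB (le_trans (Re_le_cabs _)) ?h.
have c2 : cvgn (fun n => cIm (a n)).
  by apply: (to0_ball_cvg _ ht) => m n mn; rewrite -cImB (le_trans (Im_le_cabs _)) ?h.
set x := limn (fun n => cRe (a n)); set y := limn (fun n => cIm (a n)).
have hl : clim a (Complex x y : CC R).
  move=> e e0; have e2 : 0 < e / 2 by lra.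
  have [N _ hN] := (@cvgrPdist_le _ _ _ _ _ _ _).1 c1 _ e2.
  have [M _ hM] := (@cvgrPdist_le _ _ _ _ _ _ _).1 c2 _ e2.
  exists (maxn N M) => n; rewrite geq_max => /andP[Nn Mn].
  have /= := hN _ Nn; have /= := hM _ Mn.
  rewrite -/x -/y distrC [X in _ -> is_true (X <= _) -> _]distrC => h1 h2.
  apply: (le_trans (cabs_le_ReIm _)); rewrite cReB cImB /=; lra.
exists (Complex x y : CC R) => // m; apply/ler_addgt0Pr => e e0.
have [N hN] := hl _ e0.
set n := maxn m N.
have -> : (Complex x y : CC R) - a m = - (a n - Complex x y) + (a n - a m) by ring.
have := cabsD (- (a n - Complex x y)) (a n - a m); rewrite cabsN.
have := hN n (leq_maxr _ _); have := h m n (leq_maxl _ _).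
set A := cabs _; set B := cabs _; set C := cabs _; lra.
Qed.

Lemma climD a b l m : clim a l -> clim b m -> clim (fun n => a n + b n) (l + m).
Proof.
move=> ha hb; apply: (to0_le _ (to0D ha hb)) => n.
by rewrite opprD addrACA cabsD.
Qed.

Lemma climZ c a l : clim a l -> clim (fun n => c * a n) (c * l).
Proof.
move=> ha; apply: (to0_le _ (to0Z (cabs_ge0 c) ha)) => n.
by rewrite -mulrBr cabsM.
Qed.

Lemma climB a b l m : clim a l -> clim b m -> clim (fun n => a n - b n) (l - m).
Proof.
move=> ha hb; apply: (to0_le _ (to0D ha hb)) => n.
have -> : a n - b n - (l - m) = (a n - l) - (b n - m) by ring.
by apply: (le_trans (cabsD _ _)); rewrite cabsN.
Qed.

Lemma clim_cst l : clim (fun=> l) l.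
Proof. by move=> e e0; exists 0%N => n _; rewrite subrr cabs0 ltW. Qed.

Lemma clim_sum (I : Type) (r : seq I) (a : I -> nat -> CC R) l :
  (forall i, clim (a i) (l i)) ->
  clim (fun n => \sum_(i <- r) a i n) (\sum_(i <- r) l i).
Proof.
move=> h; elim: r => [|i r IH].
  by under eq_fun do rewrite big_nil; rewrite big_nil; apply: clim_cst.
by under eq_fun do rewrite big_cons; rewrite big_cons; apply: climD.
Qed.

Lemma clim_le a l (c : R) : clim a l -> (forall n, cabs (a n) <= c) -> cabs l <= c.
Proof.
move=> h hc; apply/ler_addgt0Pl => e e0; have [N hN] := h _ e0.
have -> : l = - (a N - l) + a N by ring.
by apply: (le_trans (cabsD _ _)); rewrite cabsN lerD ?hN.
Qed.

Lemma clim_near a b l : clim a l -> to0 (fun n => cabs (b n - a n)) -> clim b l.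
Proof.
move=> ha hb; apply: (to0_le _ (to0D hb ha)) => n.
by apply: le_trans (cabsD _ _); rewrite addrA subrK.
Qed.

Lemma clim_eventually a b l (N : nat) : clim a l -> (forall n, (N <= n)%N -> a n = b n) -> clim b l.
Proof.
move=> h E e e0; have [M hM] := h _ e0; exists (maxn N M) => n.
by rewrite geq_max => /andP[/E <- /hM].
Qed.

End Limits.

(** * Sums over Z^2 *)

Section ZSums.
Variable R : realType.

Definition zsum (V : nmodType) (N : nat) (g : int -> V) : V :=
  \sum_(i < (N + N).+1) g (i%:Z - N%:Z).

Lemma eq_zsum (V : nmodType) N (g h : int -> V) : g =1 h -> zsum N g = zsum N h.
Proof. by move=> /funext ->. Qed.

Lemma zsumD (V : nmodType) N (g h : int -> V) : zsum N (fun k => g k + h k) = zsum N g + zsum N h.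
Proof. exact: big_split. Qed.

Lemma zsum_cst0 (V : nmodType) N : zsum N (fun=> 0 : V) = 0.
Proof. exact: big1. Qed.

Lemma zsumZ (V : pzSemiRingType) N (c : V) (g : int -> V) : zsum N (fun k => c * g k) = c * zsum N g.
Proof. by rewrite /zsum mulr_sumr. Qed.

Lemma zsum0 (V : nmodType) (g : int -> V) : zsum 0 g = g 0.
Proof. by rewrite /zsum big_ord_recl big_ord0 addr0 subr0. Qed.

Lemma zsumS (V : nmodType) N (g : int -> V) :
  zsum N.+1 g = zsum N g + (g (- N.+1%:Z) + g N.+1%:Z).
Proof.
rewrite /zsum addSn addnS big_ord_recl big_ord_recr /=.
rewrite addrC -addrA; congr (_ + _).
  by apply: eq_bigr => i _; congr g; rewrite /bump /=; lia.
by rewrite addrC; congr (g _ + g _); rewrite /bump /=; lia.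
Qed.

Lemma zsum_opp (V : nmodType) N (g : int -> V) : zsum N (fun k => g (- k)) = zsum N g.
Proof.
elim: N => [|N IH]; first by rewrite !zsum0.
by rewrite !zsumS IH opprK (addrC (g (Posz _))).
Qed.

Lemma zsum_shift1 N (g : int -> CC R) :
  zsum N (fun k => g (k + 1)) = zsum N g + (g (N.+1%:Z) - g (- N%:Z)).
Proof.
elim: N => [|N IH]; first by rewrite !zsum0 oppr0 add0r; ring.
rewrite !zsumS IH.
have -> : (- N.+1%:Z + 1 = - N%:Z)%R by lia.
have -> : (N.+1%:Z + 1 = N.+2%:Z)%R by lia.
by ring.
Qed.

Lemma cabs_zsum N (g : int -> CC R) : cabs (zsum N g) <= zsum N (fun k => cabs (g k)).
Proof. exact: cabs_sum. Qed.

Lemma le_zsum N (g h : int -> R) : (forall k, g k <= h k) -> zsum N g <= zsum N h.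
Proof. by move=> gh; apply: ler_sum. Qed.

(* Weights of total mass at most 3 over Z. *)
Definition kap (k : int) : R := ((1 + `|zR R k|) ^+ 2)^-1.

Lemma kap_gt0 k : 0 < kap k.
Proof. by rewrite invr_gt0 exprn_gt0 // ltr_wpDr. Qed.
Lemma kap_ge0 k : 0 <= kap k. Proof. exact: ltW (kap_gt0 k). Qed.
Lemma kapN k : kap (- k) = kap k.
Proof. by rewrite /kap zRN normrN. Qed.

Lemma zR_nat (n : nat) : zR R n%:Z = n%:R. Proof. by []. Qed.

Lemma kap_nat (n : nat) : kap n.+1%:Z <= n.+1%:R^-1 - n.+2%:R^-1.
Proof.
rewrite /kap zR_nat ger0_norm ?ler0n //.
have -> : (1 + n.+1%:R : R) = n.+2%:R by rewrite -(natr1 n.+1) addrC.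
have h : (n.+2%:R : R) = n.+1%:R + 1 by rewrite natr1.
have h0 : (0 : R) < n.+1%:R by rewrite ltr0Sn.
have -> : (n.+1%:R^-1 - n.+2%:R^-1 : R) = (n.+1%:R * n.+2%:R)^-1.
  by rewrite h; field; apply/andP; split; apply: lt0r_neq0; lra.
rewrite lef_pV2 ?posrE ?exprn_gt0 ?mulr_gt0 ?ltr0Sn // expr2 ler_wpM2r ?ler0n // h; lra.
Qed.

(** The correction 2/(N+1) makes the induction close: the two new terms are each at most 1/(N+1) -
    1/(N+2), which telescopes. *)
Lemma zsum_kap N : zsum N kap <= 3 - 2 / N.+1%:R.
Proof.
elim: N => [|N IH]; first by rewrite zsum0 /kap /zR normr0 addr0 expr1n invr1 mulr1; lra.
rewrite zsumS kapN; move: IH (kap_nat N); set a := N.+1%:R^-1; set b := N.+2%:R^-1; lra.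
Qed.

Lemma zsum_kap3 N : zsum N kap <= 3.
Proof.
apply: (le_trans (zsum_kap N)); have : (0 : R) <= 2 / N.+1%:R by rewrite divr_ge0.
set b := 2 / N.+1%:R; lra.
Qed.

Lemma zsum_kap_ge0 N : 0 <= zsum N kap.
Proof. by apply: sumr_ge0 => i _; apply: kap_ge0. Qed.

(** The standing summability hypothesis. A product majorant gives convergence of the square sums, a
    bound with constant 9 = 3 * 3, and a tail of order 1/N. *)
Definition dom (M : R) (f : int -> int -> CC R) :=
  forall k l, cabs (f k l) <= M * (kap k * kap l).

Definition sqs N (f : int -> int -> CC R) := zsum N (fun k => zsum N (fun l => f k l)).

Lemma dom_ge0 M f : dom M f -> 0 <= M.
Proof.
move=> /(_ 0 0) h; have := le_trans (cabs_ge0 _) h.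
by rewrite pmulr_lge0 // mulr_gt0 ?kap_gt0.
Qed.

Lemma sqs_le M f N : dom M f -> cabs (sqs N f) <= 9 * M.
Proof.
move=> h; have M0 := dom_ge0 h.
apply: (le_trans (cabs_zsum _ _)).
apply: (@le_trans _ _ (zsum N (fun k => M * zsum N kap * kap k))).
  apply: le_zsum => k; apply: (le_trans (cabs_zsum _ _)).
  apply: (@le_trans _ _ (zsum N (fun l => M * kap k * kap l))).
    by apply: le_zsum => l; rewrite -mulrA h.
  by rewrite zsumZ mulrAC.
rewrite zsumZ -mulrA mulrC; apply: ler_wpM2r => //.
have := zsum_kap3 N; have := zsum_kap_ge0 N; nra.
Qed.

(** Passing to the next square adds two truncated lines in l, costing 6 M K together, and two full
    lines in k, costing 3 M K each, where K is the weight at N+1. *)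
Lemma sqsS_le M f N : dom M f -> cabs (sqs N.+1 f - sqs N f) <= 12 * M * (N.+1%:R^-1 - N.+2%:R^-1).
Proof.
move=> h; have M0 := dom_ge0 h.
rewrite /sqs zsumS.
have -> : zsum N (fun k => zsum N.+1 (fun l => f k l)) =
  zsum N (fun k => zsum N (fun l => f k l)) + zsum N (fun k => f k (- N.+1%:Z) + f k N.+1%:Z).
  by rewrite -zsumD; apply: eq_zsum => k; rewrite zsumS.
set A := zsum N (fun k => zsum N _); set B := zsum N _; set C := zsum N.+1 _ + _.
have -> : A + B + C - A = B + C by ring.
rewrite {}/A {}/B {}/C.
set K := kap N.+1%:Z.
have K0 : 0 <= K by apply: kap_ge0.
have h1 : cabs (zsum N (fun k => f k (- N.+1%:Z) + f k N.+1%:Z)) <= 6 * M * K.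
  apply: (le_trans (cabs_zsum _ _)).
  apply: (@le_trans _ _ (zsum N (fun k => (2 * M * K) * kap k))).
    apply: le_zsum => k; apply: (le_trans (cabsD _ _)).
    have := h k (- N.+1%:Z); have := h k N.+1%:Z; rewrite kapN -/K; lra.
  rewrite zsumZ; have := zsum_kap3 N; have : 0 <= M * K by rewrite mulr_ge0.
  nra.
have h2 k : kap k = K -> cabs (zsum N.+1 (f k)) <= 3 * M * K.
  move=> kk; apply: (le_trans (cabs_zsum _ _)).
  apply: (@le_trans _ _ (zsum N.+1 (fun l => (M * K) * kap l))).
    by apply: le_zsum => l; have := h k l; rewrite kk mulrA.
  rewrite zsumZ; have := zsum_kap3 N.+1; have : 0 <= M * K by rewrite mulr_ge0.
  nra.
apply: (@le_trans _ _ (12 * M * K)); last by rewrite ler_wpM2l ?mulr_ge0 //; exact: kap_nat.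
apply: (le_trans (cabsD _ _)).
have := cabsD (zsum N.+1 (f (- N.+1%:Z))) (zsum N.+1 (f N.+1%:Z)).
have := h2 _ (kapN N.+1%:Z); have := h2 N.+1%:Z erefl; lra.
Qed.

Lemma sqs_cauchy M f m n : dom M f -> (m <= n)%N -> cabs (sqs n f - sqs m f) <= 12 * M / m.+1%:R.
Proof.
move=> h mn; have M0 := dom_ge0 h.
have : cabs (sqs n f - sqs m f) <= 12 * M * (m.+1%:R^-1 - n.+1%:R^-1).
  rewrite -(subnKC mn); elim: (n - m)%N => [|p IH].
    by rewrite addn0 !subrr cabs0 mulr0.
  rewrite addnS.
  have -> : sqs (m + p).+1 f - sqs m f =
    (sqs (m + p).+1 f - sqs (m + p) f) + (sqs (m + p) f - sqs m f) by ring.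
  apply: (le_trans (cabsD _ _)); have := sqsS_le (m + p) h; move: IH.
  set A := cabs _; set B := cabs _; set a := m.+1%:R^-1; set b := (m + p).+1%:R^-1.
  by set c := (m + p).+2%:R^-1; lra.
move=> /le_trans; apply; rewrite ler_wpM2l ?mulr_ge0 // lerBlDr lerDl invr_ge0 ler0n //.
Qed.

Lemma sumZ2_clim M f : dom M f ->
  clim (sqs^~ f) (sumZ2 f) /\ forall m, cabs (sumZ2 f - sqs m f) <= 12 * M / m.+1%:R.
Proof.
move=> h.
have [l hl hl'] := clim_cauchy (fun m n => sqs_cauchy h) (to0_harmonic (12 * M)).
by have -> : sumZ2 f = l by exact: (clim_limn hl).
Qed.

Lemma sumZ2_tail M f m : dom M f -> cabs (sumZ2 f - sqs m f) <= 12 * M / m.+1%:R.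
Proof. by move=> /sumZ2_clim[]. Qed.

Lemma sumZ2_cvg M f : dom M f -> clim (sqs^~ f) (sumZ2 f).
Proof. by move=> /sumZ2_clim[]. Qed.

Lemma sumZ2_le M f : dom M f -> cabs (sumZ2 f) <= 9 * M.
Proof. by move=> h; apply: (clim_le (sumZ2_cvg h)) => n; apply: sqs_le. Qed.

Lemma clim_sumZ2 f l : clim (sqs^~ f) l -> sumZ2 f = l.
Proof. exact: clim_limn. Qed.

Lemma eq_sumZ2 (f g : int -> int -> CC R) : (forall k l, f k l = g k l) -> sumZ2 f = sumZ2 g.
Proof. by move=> h; congr sumZ2; apply/funext => k; apply/funext => l. Qed.

Lemma sqsD N f g : sqs N (fun k l => f k l + g k l) = sqs N f + sqs N g.
Proof. by rewrite /sqs -zsumD; apply: eq_zsum => k; rewrite zsumD. Qed.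

Lemma sqsZ N c f : sqs N (fun k l => c * f k l) = c * sqs N f.
Proof. by rewrite /sqs -zsumZ; apply: eq_zsum => k; rewrite zsumZ. Qed.

Lemma sumZ2D M M' f g : dom M f -> dom M' g ->
  sumZ2 (fun k l => f k l + g k l) = sumZ2 f + sumZ2 g.
Proof.
move=> hf hg; apply: clim_sumZ2; under eq_fun do rewrite sqsD.
by apply: climD; [exact: sumZ2_cvg hf|exact: sumZ2_cvg hg].
Qed.

Lemma sumZ2Z M c f : dom M f -> sumZ2 (fun k l => c * f k l) = c * sumZ2 f.
Proof.
move=> hf; apply: clim_sumZ2; under eq_fun do rewrite sqsZ.
by apply: climZ; exact: sumZ2_cvg hf.
Qed.

Lemma dom_le M f g (c : R) : 0 <= c -> (forall k l, cabs (g k l) <= c * cabs (f k l)) ->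
  dom M f -> dom (c * M) g.
Proof. by move=> c0 h hf k l; rewrite (le_trans (h k l)) // -mulrA ler_wpM2l. Qed.

Lemma domZ M c f : dom M f -> dom (cabs c * M) (fun k l => c * f k l).
Proof. by apply: dom_le; [exact: cabs_ge0|move=> k l; rewrite cabsM]. Qed.

Lemma kap_shift (k : int) : kap (k + 1) <= 4 * kap k /\ kap (k - 1) <= 4 * kap k.
Proof.
have H (x y : R) : `|x| <= `|y| + 1 -> ((1 + `|y|) ^+ 2)^-1 <= 4 * ((1 + `|x|) ^+ 2)^-1.
  move=> h; have x0 := normr_ge0 x; have y0 := normr_ge0 y.
  rewrite -{1}[4]invrK -invfM lef_pV2 ?posrE ?exprn_gt0 ?mulr_gt0 ?invr_gt0 ?exprn_gt0 ?ltr_wpDr //.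
  nra.
by split; apply: H; rewrite ?zRD ?zRB ler_norml; apply/andP; split;
  (have := ler_norm (zR R (k + 1)); have := ler_norm (- zR R (k + 1));
   have := ler_norm (zR R (k - 1)); have := ler_norm (- zR R (k - 1));
   rewrite ?normrN ?zRD ?zRB /zR /=; lra).
Qed.

Lemma kap_tozero c (k0 : int) : to0 (fun N => c * kap (N%:Z)).
Proof.
have [c0|/ltW c0] := leP c 0.
  move=> e e0; exists 0%N => n _; apply: (le_trans _ (ltW e0)).
  by rewrite mulr_le0_ge0 // kap_ge0.
apply: (to0_le _ (to0_harmonic c)) => n; apply: ler_wpM2l => //.
rewrite /kap zR_nat ger0_norm // -natr1 (addrC 1).
have h : (1 : R) <= n%:R + 1 by rewrite lerDr.
rewrite lef_pV2 ?posrE ?exprn_gt0; nra.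
Qed.

(** A unit shift changes the square sum by two boundary lines only, at N+1 and at -N. Their weights
    are at most 4 and 1 times that of N, whence 15 = 3 * (4 + 1). *)
Lemma sumZ2_shift1l M f : dom M f -> sumZ2 (fun k l => f (k + 1) l) = sumZ2 f.
Proof.
move=> h; have M0 := dom_ge0 h.
apply: clim_sumZ2; apply: (clim_near (sumZ2_cvg h)).
have b N k : cabs (zsum N (f k)) <= 3 * M * kap k.
  apply: (le_trans (cabs_zsum _ _)).
  apply: (@le_trans _ _ (zsum N (fun l => (M * kap k) * kap l))).
    by apply: le_zsum => l; have := h k l; rewrite mulrA.
  rewrite zsumZ; have := zsum_kap3 N; have : 0 <= M * kap k by rewrite mulr_ge0 ?kap_ge0.
  nra.
apply: (to0_le _ (kap_tozero (15 * M) 0)) => N.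
rewrite {1}/sqs (zsum_shift1 N (fun k => zsum N (f k))) -/(sqs N f).
rewrite (_ : forall x y : CC R, x + y - x = y); last by move=> x y; ring.
apply: (le_trans (cabsD _ _)); rewrite cabsN.
have := b N N.+1%:Z; have := b N (- N%:Z); rewrite kapN.
have := (kap_shift N%:Z).1; rewrite -[N.+1]addn1 PoszD.
set A := cabs _; set B := cabs _; nra.
Qed.

Lemma sqs_swap N (f : int -> int -> CC R) : sqs N f = sqs N (fun k l => f l k).
Proof. exact: exchange_big. Qed.

Lemma sumZ2E (f : int -> int -> CC R) : sumZ2 f = limn (sqs^~ f).
Proof. by []. Qed.

Lemma sumZ2_swap (f : int -> int -> CC R) : sumZ2 f = sumZ2 (fun k l => f l k).
Proof. by rewrite !sumZ2E; congr (lim (_ @ \oo)); apply/funext => N; rewrite sqs_swap. Qed.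

Lemma dom_swap M f : dom M f -> dom M (fun k l => f l k).
Proof. by move=> h k l; rewrite [kap k * _]mulrC. Qed.

Lemma sumZ2_opp (f : int -> int -> CC R) : sumZ2 (fun k l => f (- k) (- l)) = sumZ2 f.
Proof.
rewrite !sumZ2E; congr (lim (_ @ \oo)); apply/funext => N; rewrite /sqs.
rewrite -[RHS]zsum_opp; apply: eq_zsum => k.
by rewrite -[RHS]zsum_opp.
Qed.

Lemma dom_shift1 M f : dom M f -> dom (4 * M) (fun k l => f (k + 1) l) /\ dom (4 * M) (fun k l => f (k - 1) l).
Proof.
move=> h; have M0 := dom_ge0 h.
by split=> k l; rewrite (le_trans (h _ _)) //; have [h1 h2] := kap_shift k;
  have l0 := kap_ge0 l; rewrite (mulrC 4) -mulrA ler_wpM2l // mulrA ler_wpM2r.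
Qed.

Lemma sumZ2_shiftl M f (p : int) : dom M f ->
  (exists M', dom M' (fun k l => f (k + p) l)) /\ sumZ2 (fun k l => f (k + p) l) = sumZ2 f.
Proof.
move=> h; elim/int_rect: p => [|p [[M' h1] h2]|p [[M' h1] h2]].
- have -> : (fun k l : int => f (k + 0) l) = f by apply/funext => k; rewrite addr0.
  by split => //; exists M.
- have E : (fun k l : int => f (k + p.+1%:Z) l) = (fun k l => (fun k l : int => f (k + p%:Z) l) (k + 1) l).
    by apply/funext => k; apply/funext => l; congr f; rewrite -addrA -(addn1 p) PoszD [p%:Z + 1]addrC.
  rewrite E; split; last by rewrite (sumZ2_shift1l h1).
  by exists (4 * M'); exact: (dom_shift1 h1).1.
- have E : (fun k l : int => f (k - p%:Z) l) = (fun k l => (fun k l : int => f (k - p.+1%:Z) l) (k + 1) l).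
    by apply/funext => k; apply/funext => l; congr f; rewrite -(addn1 p) PoszD; lia.
  have D : dom (4 * M') (fun k l : int => f (k - p.+1%:Z) l).
    have := (dom_shift1 h1).2; congr dom.
    by apply/funext => k; apply/funext => l; congr f; rewrite -(addn1 p) PoszD; lia.
  by split; [exists (4 * M')|rewrite -h2 E (sumZ2_shift1l D)].
Qed.

(** The substitution of a convolution. Symmetric squares are invariant under reflection but not
    under translation, so only the translation needs a limit argument. *)
Lemma sumZ2_reindex M f (m n : int) : dom M f ->
  sumZ2 (fun k l => f (m - k) (n - l)) = sumZ2 f.
Proof.
move=> h.
have [[M1 h1] <-] := sumZ2_shiftl m h.
have [[M2 h2] E2] := sumZ2_shiftl n (dom_swap h1).
rewrite [RHS]sumZ2_swap -E2 [RHS]sumZ2_swap -[RHS]sumZ2_opp.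
by apply: eq_sumZ2 => k l; congr f; rewrite addrC.
Qed.

Lemma sumZ2_single (f : int -> int -> CC R) : (forall k l, (k != 0) || (l != 0) -> f k l = 0) -> sumZ2 f = f 0 0.
Proof.
move=> h; apply: clim_sumZ2.
have E N : sqs N f = f 0 0.
  elim: N => [|N IH]; first by rewrite /sqs !zsum0.
  have E0 k : k != 0 -> zsum N.+1 (f k) = 0.
    by move=> k0; rewrite (@eq_zsum _ _ (f k) (fun=> 0)) ?zsum_cst0 // => l; rewrite h // k0.
  rewrite /sqs zsumS !E0 // !addr0 -IH; apply: eq_zsum => k.
  by rewrite zsumS !h ?addr0 // orbT.
by under eq_fun do rewrite E; apply: clim_cst.
Qed.

End ZSums.

(** * Calculus on the line *)

Section Calculus.
Variable R : realType.
Implicit Types (f g F G : R -> R) (x y a b : R).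

Lemma is_derive_continuous f df : (forall x, is_derive x 1 f (df x)) -> continuous f.
Proof.
move=> h x; apply/differentiable_continuous/derivable1_diffP.
exact: (@ex_derive _ _ _ _ _ _ _ (h x)).
Qed.

Lemma is_derive_within f df a b : (forall x, is_derive x 1 f (df x)) -> {within `[a, b], continuous f}.
Proof. by move=> h; apply: continuous_subspaceT; exact: is_derive_continuous h. Qed.

Lemma ge0_derive_le F f a b : (forall x, is_derive x 1 F (f x)) -> a <= b ->
  (forall x, a <= x <= b -> 0 <= f x) -> F a <= F b.
Proof.
move=> hF ab f0.
have [c cab E] := MVT_segment ab (fun x _ => hF x) (is_derive_within hF).
rewrite -subr_ge0 E mulr_ge0 ?subr_ge0 //; apply: f0.
by move: cab; rewrite in_itv.
Qed.

Lemma derive_le F G f g a b :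
  (forall x, is_derive x 1 F (f x)) -> (forall x, is_derive x 1 G (g x)) -> a <= b ->
  (forall x, a <= x <= b -> `|f x| <= g x) -> `|F b - F a| <= G b - G a.
Proof.
move=> hF hG ab h; rewrite ler_norml; apply/andP; split.
- have H x : is_derive x 1 (fun t => F t + G t) (f x + g x) by exact: is_deriveD.
  have p x : a <= x <= b -> 0 <= f x + g x by move=> /h; rewrite ler_norml => /andP[]; lra.
  have := ge0_derive_le H ab p; lra.
- have H x : is_derive x 1 (fun t => G t - F t) (g x - f x) by exact: is_deriveB.
  have p x : a <= x <= b -> 0 <= g x - f x by move=> /h; rewrite ler_norml => /andP[]; lra.
  have := ge0_derive_le H ab p; lra.
Qed.

Lemma is_derive_scale (c x : R) : is_derive x 1 (fun t => c * t) c.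
Proof.
have := is_derive_affine c 0 x; by under eq_fun do rewrite addr0.
Qed.

(** A form without division, in which s = 0 needs no exception; it suits uniform limits and the flat
    functions at the origin. *)
Lemma der_epsP f x l : is_derive x 1 f l <->
  forall e, 0 < e -> exists2 d : R, 0 < d & forall s, `|s| < d -> `|f (x + s) - f x - l * s| <= e * `|s|.
Proof.
split=> [h e e0|h].
- have hd := @ex_derive _ _ _ _ _ _ _ h; have hv := @derive_val _ _ _ _ _ _ _ h.
  have [l' hl'] := (cvg_ex _).1 hd.
  have E : l' = l by rewrite -hv; apply/esym/cvg_lim => //; exact: Rhausdorff.
  move: hl'; rewrite {}E => /cvgrPdist_le /(_ e e0).
  move=> [d /= d0 H]; exists d => // s sd.
  have [->|s0] := eqVneq s 0; first by rewrite addr0 subrr mulr0 subrr !normr0 mulr0.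
  have := H s; rewrite /ball_ /= sub0r normrN => /(_ sd s0).
  rewrite /GRing.scale /= mulr1 (addrC s) => H1.
  have -> : f (x + s) - f x - l * s = - (s * (l - s^-1 * (f (x + s) - f x))) by field.
  by rewrite normrN normrM mulrC ler_wpM2r.
- have c : (h^-1 *: (f (h *: 1 + x) - f x) @[h --> 0^'] --> l).
    apply/cvgrPdist_le => e e0; have [d d0 H] := h e e0.
    exists d => //= s.
    rewrite /ball_ /= sub0r normrN => /H H1 s0.
    rewrite /GRing.scale /= mulr1 (addrC s).
    have -> : l - s^-1 * (f (x + s) - f x) = - (s^-1 * (f (x + s) - f x - l * s)) by field.
    by rewrite normrN normrM normfV mulrC ler_pdivrMr ?normr_gt0.
  by apply: DeriveDef; [apply/cvg_ex; exists l|apply/cvg_lim => //; exact: Rhausdorff].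
Qed.

Lemma eq_0derive f a b : a <= b -> (forall x, a <= x <= b -> is_derive x 1 f 0) -> f a = f b.
Proof.
move=> ab h.
have w : {within `[a, b], continuous f}.
  apply: derivable_within_continuous => x; rewrite in_itv /= => xab.
  exact: (@ex_derive _ _ _ _ _ _ _ (h x xab)).
have [|c _ E] := MVT_segment (df := fun=> 0) ab _ w.
  by move=> x; rewrite in_itv /= => /andP[ax xb]; apply: h; rewrite !ltW.
by apply/eqP; rewrite eq_sym -subr_eq0 E mul0r.
Qed.

Lemma eq_0deriveT f a b : (forall x, is_derive x 1 f 0) -> f a = f b.
Proof.
move=> h; have [ab|/ltW ab] := leP a b; first exact: eq_0derive.
by apply/esym; apply: eq_0derive.
Qed.

(** The fundamental theorem is used on bounded intervals, with base point -(n+1). Normalising at 0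
    makes the choices for different n agree, and they are then patched together. *)
Lemma ex_primitive f : continuous f ->
  exists2 F, F 0 = 0 & forall x, is_derive x 1 F (f x).
Proof.
move=> cf.
pose H (n : nat) x := (\int[@lebesgue_measure R]_(t in [set` `[- n.+1%:R, x]]) (f t))%R.
have hH n x : `|x| < n.+1%:R -> is_derive x 1 (H n) (f x).
  rewrite ltr_norml => /andP[h1 h2].
  have [] := @continuous_FTC1_closed R f (- n.+1%:R) x n.+1%:R h2 _ h1 (cf x).
    apply: continuous_compact_integrable; first exact: segment_compact.
    exact: continuous_subspaceT.
  by move=> d E; apply: DeriveDef => //; rewrite -E derive1E.
pose N x := Num.bound `|x|.
have hN x n : (N x <= n)%N -> `|x| < n.+1%:R.
  move=> Nn; apply: (@lt_trans _ _ n%:R); last by rewrite ltr_nat.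
  by apply: lt_le_trans (archi_boundP (normr_ge0 x)) _; rewrite ler_nat.
pose F x := H (N x) x - H (N x) 0.
have FE x n : `|x| < n.+1%:R -> F x = H n x - H n 0.
  move=> xn; apply/eqP; rewrite -subr_eq0; apply/eqP.
  pose D t := (H (N x) t - H (N x) 0) - (H n t - H n 0).
  have hD (t : R) : `|t| <= `|x| -> is_derive t 1 D 0.
    move=> tx.
    have h1 := is_deriveB (hH (N x) t (le_lt_trans tx (hN x _ (leqnn _)))) (hH n t (le_lt_trans tx xn)).
    have h2 := is_deriveB h1 (is_derive_cst (H (N x) 0 - H n 0) t 1).
    have -> : D = (H (N x) - H n - cst (H (N x) 0 - H n 0)).
      by apply/funext => s; rewrite /D !fctE /cst; ring.
    by apply: (is_derive_eq h2); rewrite !subrr.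
  have : D 0 = 0 by rewrite /D !subrr.
  rewrite -[_ - _]/(D x) => <-; have [x0|/ltW x0] := leP 0 x.
    apply/esym; apply: eq_0derive => // t /andP[t0 tx]; apply: hD.
    by rewrite !ger0_norm.
  apply: eq_0derive => // t /andP[t0 tx]; apply: hD.
  by rewrite !ler0_norm // lerN2.
exists F; first by rewrite /F subrr.
move=> x; set n := (N x).
have xn := hN x _ (leqnn n).
apply: (@near_eq_is_derive _ _ _ (fun t => H n t - H n 0)).
  near=> t; apply/esym; apply: FE; near: t.
  have : nbhs `|x| [set y | y < n.+1%:R] by apply: lt_nbhsl.
  by apply: (@norm_continuous R R x).
have := is_deriveB (hH n x xn) (is_derive_cst (H n 0) x 1).
by rewrite subr0.
Unshelve. all: by end_near. Qed.

End Calculus.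

Section ComplexCalculus.
Variable R : realType.
Implicit Types (f g F G : R -> CC R) (x y a b : R) (z : CC R).

Lemma cder_epsP f x l : cder f x l <->
  forall e, 0 < e -> exists2 d : R, 0 < d &
    forall s, `|s| < d -> cabs (f (x + s) - f x - l * cR s) <= e * `|s|.
Proof.
split=> [[h1 h2] e e0|h].
- have e2 : 0 < e / 2 by lra.
  have [d1 d10 H1] := (der_epsP _ _ _).1 h1 _ e2.
  have [d2 d20 H2] := (der_epsP _ _ _).1 h2 _ e2.
  exists (Num.min d1 d2); first by rewrite lt_min d10.
  move=> s; rewrite lt_min => /andP[/H1 {}H1 /H2 {}H2].
  apply: (le_trans (cabs_le_ReIm _)); rewrite !cE !mulr0 subr0 add0r.
  have := normr_ge0 s; lra.
- split; apply/der_epsP => e /h[d d0 H]; exists d => // s /H; apply: le_trans.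
  + by have := Re_le_cabs (f (x + s) - f x - l * cR s); rewrite !cE mulr0 subr0.
  + by have := Im_le_cabs (f (x + s) - f x - l * cR s); rewrite !cE mulr0 add0r.
Qed.

Definition ccont f := continuous (fun x => cRe (f x)) /\ continuous (fun x => cIm (f x)).

Lemma ccont_cder F f : (forall x, cder F x (f x)) -> ccont F.
Proof.
move=> h; split.
- by apply: (@is_derive_continuous _ _ (fun x => cRe (f x))) => x; case: (h x).
- by apply: (@is_derive_continuous _ _ (fun x => cIm (f x))) => x; case: (h x).
Qed.

Lemma ccont_cst z : ccont (fun=> z).
Proof. by split; apply: cst_continuous. Qed.

Lemma ccontD f g : ccont f -> ccont g -> ccont (fun x => f x + g x).
Proof.
move=> [f1 f2] [g1 g2]; split.
- by under eq_fun do rewrite cReD; move=> x; apply: cvgD; [exact: f1|exact: g1].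
- by under eq_fun do rewrite cImD; move=> x; apply: cvgD; [exact: f2|exact: g2].
Qed.

Lemma ccontM f g : ccont f -> ccont g -> ccont (fun x => f x * g x).
Proof.
move=> [f1 f2] [g1 g2]; split.
- under eq_fun do rewrite cReM; move=> x; apply: cvgB.
    by apply: cvgM; [exact: f1|exact: g1].
  by apply: cvgM; [exact: f2|exact: g2].
- under eq_fun do rewrite cImM; move=> x; apply: cvgD.
    by apply: cvgM; [exact: f1|exact: g2].
  by apply: cvgM; [exact: f2|exact: g1].
Qed.

Lemma ccontZ z f : ccont f -> ccont (fun x => z * f x).
Proof. by move=> h; apply: ccontM => //; apply: ccont_cst. Qed.

Lemma ccontN f : ccont f -> ccont (fun x => - f x).
Proof. by move=> /(ccontZ (-1)); under eq_fun do rewrite mulN1r. Qed.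

Lemma ccontB f g : ccont f -> ccont g -> ccont (fun x => f x - g x).
Proof. by move=> hf hg; apply: ccontD => //; apply: ccontN. Qed.

Lemma ccont_comp f (u : R -> R) : ccont f -> continuous u -> ccont (fun x => f (u x)).
Proof.
move=> [f1 f2] hu; split => x.
- exact: (@continuous_comp _ _ _ u (fun x => cRe (f x)) x (hu x) (f1 _)).
- exact: (@continuous_comp _ _ _ u (fun x => cIm (f x)) x (hu x) (f2 _)).
Qed.

Lemma continuous_affine a b : continuous (fun x => a * x + b).
Proof. exact: (is_derive_continuous (fun x => is_derive_affine a b x)). Qed.

Lemma ccont_shift f s : ccont f -> ccont (fun x => f (x - s)).
Proof.
move=> h; apply: (ccont_comp (u := fun x => x - s)) => //.
rewrite (_ : (fun x => x - s) = (fun x => 1 * x + - s)); first exact: continuous_affine.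
by apply/funext => x; ring.
Qed.

Lemma ccont_ee a b : ccont (fun x => ee (a * x + b)).
Proof. exact: (ccont_cder (fun x => cder_ee a b x)). Qed.

Lemma ccont_sum (I : Type) (r : seq I) (P : pred I) (F : I -> R -> CC R) :
  (forall i, P i -> ccont (F i)) -> ccont (fun x => \sum_(i <- r | P i) F i x).
Proof.
move=> h; elim: r => [|i r IH]; first by under eq_fun do rewrite big_nil; apply: ccont_cst.
under eq_fun do rewrite big_cons; case Pi : (P i) => //.
by apply: ccontD => //; apply: h.
Qed.

(** The mean value inequality is applied to real and imaginary parts separately; the resulting
    factor 2 propagates into the constants 8 of [Int_le] and 4/r of [resolv_le]. *)
Lemma cder_le F f (G g : R -> R) a b :
  (forall x, cder F x (f x)) -> (forall x, is_derive x 1 G (g x)) -> a <= b ->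
  (forall x, a <= x <= b -> cabs (f x) <= g x) -> cabs (F b - F a) <= 2 * (G b - G a).
Proof.
move=> hF hG ab h; apply: (le_trans (cabs_le_ReIm _)); rewrite cReB cImB.
have h1 := derive_le (fun x => (hF x).1) hG ab (fun x xab => le_trans (Re_le_cabs _) (h x xab)).
have h2 := derive_le (fun x => (hF x).2) hG ab (fun x xab => le_trans (Im_le_cabs _) (h x xab)).
lra.
Qed.

Lemma cder_lip F f M a b : (forall x, cder F x (f x)) ->
  (forall x, cabs (f x) <= M) -> cabs (F b - F a) <= 2 * M * `|b - a|.
Proof.
move=> hF h; wlog ab : a b / a <= b.
  move=> H; have [|/ltW] := leP a b; first exact: H.
  by rewrite cabsB distrC; apply: H.
have := cder_le hF (fun x => is_derive_scale M x) ab (fun x _ => h x).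
by rewrite ger0_norm ?subr_ge0 // -mulrBr mulrA.
Qed.

Lemma eq_0cder F x y : (forall x, cder F x 0) -> F x = F y.
Proof.
move=> h; apply: CC_eq.
- exact: (@eq_0deriveT _ (fun x => cRe (F x)) x y (fun x => (h x).1)).
- exact: (@eq_0deriveT _ (fun x => cIm (F x)) x y (fun x => (h x).2)).
Qed.

Lemma eq_cder F G f x y : (forall x, cder F x (f x)) -> (forall x, cder G x (f x)) ->
  F x - F y = G x - G y.
Proof.
move=> hF hG; have h t : cder (fun s => F s - G s) t 0.
  by have := cderB (hF t) (hG t); rewrite subrr.
have /= := eq_0cder x y h => E.
have -> : F x = (F x - G x) + G x by ring.
by rewrite E; ring.
Qed.

Lemma ex_cprimitive f : ccont f -> exists2 F, F 0 = 0 & forall x, cder F x (f x).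
Proof.
move=> [/ex_primitive[A A0 hA] /ex_primitive[B B0 hB]].
exists (fun x => Complex (A x) (B x) : CC R); first by rewrite A0 B0.
by move=> x; split; [exact: hA|exact: hB].
Qed.

Definition prim f : R -> CC R := xget (fun=> 0) [set F | F 0 = 0 /\ forall x, cder F x (f x)].

Lemma primP f : ccont f -> prim f 0 = 0 /\ forall x, cder (prim f) x (f x).
Proof.
move=> /ex_cprimitive[F F0 hF]; rewrite /prim; case: xgetP => [G _ //|].
by move=> /(_ F); case.
Qed.

Lemma prim0 f : ccont f -> prim f 0 = 0. Proof. by move=> /primP[]. Qed.
Lemma cder_prim f x : ccont f -> cder (prim f) x (f x). Proof. by move=> /primP[]. Qed.

Lemma primE F f x y : (forall x, cder F x (f x)) -> ccont f -> prim f x - prim f y = F x - F y.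
Proof. by move=> hF hf; apply: eq_cder hF => t; apply: cder_prim. Qed.

Lemma primD f g x : ccont f -> ccont g -> prim (fun t => f t + g t) x = prim f x + prim g x.
Proof.
move=> hf hg; have hfg := ccontD hf hg.
have := @primE (fun t => prim f t + prim g t) _ x 0 (fun t => cderD (cder_prim t hf) (cder_prim t hg)) hfg.
by rewrite !prim0 // subr0 addr0 subr0.
Qed.

Lemma primZ z f x : ccont f -> prim (fun t => z * f t) x = z * prim f x.
Proof.
move=> hf; have := @primE (fun t => z * prim f t) _ x 0 (fun t => cderZ z (cder_prim t hf)) (ccontZ z hf).
by rewrite !prim0 ?subr0 ?mulr0 ?subr0 //; apply: ccontZ.
Qed.

(** Nothing is known about F, so the mean value inequality is applied to [G n - G N], whose
    derivative is uniformly small, and the estimate is passed to the limit in n. What remains is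
    differentiability of the single function [G N]. *)
Lemma cder_unif_lim (G g : nat -> R -> CC R) (F h : R -> CC R) (t : nat -> R) :
  (forall n x, cder (G n) x (g n x)) -> (forall x, clim (fun n => G n x) (F x)) ->
  (forall n x, cabs (g n x - h x) <= t n) -> to0 t -> forall x, cder F x (h x).
Proof.
move=> hG hF hh ht x; apply/cder_epsP => e e0.
have e8 : 0 < e / 8 by lra.
have [N hN] := ht _ e8.
have [d d0 H] := (cder_epsP _ _ _).1 (hG N x) _ e8.
exists d => // s /H {H} h1.
have gap n : (N <= n)%N -> cabs ((G n (x + s) - G N (x + s)) - (G n x - G N x)) <= e / 2 * `|s|.
  move=> Nn; have b y : cabs (g n y - g N y) <= e / 4.
    have -> : g n y - g N y = (g n y - h y) + (h y - g N y) by ring.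
    apply: (le_trans (cabsD _ _)); rewrite [X in _ + X]cabsB.
    have := le_trans (hh n y) (hN _ Nn); have := le_trans (hh N y) (hN _ (leqnn _)); lra.
  have := cder_lip x (x + s) (fun y => cderB (hG n y) (hG N y)) b.
  rewrite (_ : x + s - x = s); last by ring.
  by move=> /le_trans; apply; apply: ler_wpM2r => //; lra.
have h2 : cabs ((F (x + s) - G N (x + s)) - (F x - G N x)) <= e / 2 * `|s|.
  have L : clim (fun n => (G (n + N)%N (x + s) - G N (x + s)) - (G (n + N)%N x - G N x))
             ((F (x + s) - G N (x + s)) - (F x - G N x)).
    have sh y : clim (fun n => G (n + N)%N y) (F y).
      by move=> r /(hF y)[M hM]; exists M => n Mn; apply: hM; apply: (leq_trans Mn); apply: leq_addr.
    by apply: climB; apply: climB => //; apply: clim_cst.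
  by apply: (clim_le L) => n; apply: gap; apply: leq_addl.
have h3 : cabs ((g N x - h x) * cR s) <= e / 8 * `|s|.
  by rewrite cabsM cabs_cR ler_wpM2r // (le_trans (hh _ _)) ?hN.
have -> : F (x + s) - F x - h x * cR s = ((F (x + s) - G N (x + s)) - (F x - G N x)) +
   ((G N (x + s) - G N x - g N x * cR s) + (g N x - h x) * cR s) by ring.
apply: (le_trans (cabsD _ _)).
have := cabsD (G N (x + s) - G N x - g N x * cR s) ((g N x - h x) * cR s).
have s0 := normr_ge0 s; have : 0 <= e * `|s| by rewrite mulr_ge0 // ltW.
move: h1 h2 h3; set A := cabs _; set B := cabs _; set C := cabs _; set D := cabs _; lra.
Qed.

End ComplexCalculus.

(** * Schwartz functions *)

Section SchwartzClass.
Variable R : realType.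
Implicit Types (f g F G : R -> CC R) (x : R) (z : CC R).

Definition rapdec f := forall k : nat, exists M, forall x, cabs (f x) * (1 + x ^+ 2) ^+ k <= M.

Lemma w_ge1 x : 1 <= 1 + x ^+ 2. Proof. by rewrite lerDl sqr_ge0. Qed.
Lemma w_gt0 x : 0 < 1 + x ^+ 2. Proof. exact: lt_le_trans ltr01 (w_ge1 x). Qed.
Lemma norm_le_w x : `|x| <= 1 + x ^+ 2.
Proof. by rewrite -(real_normK (num_real x)); have := normr_ge0 x; nra. Qed.

(** A coinduction principle: a class of rapidly decaying functions closed under one differentiation
    is made of Schwartz functions. It replaces iterated Leibniz formulas everywhere below, at the
    price of finding a suitable class. *)
Lemma schwartz_ind (C : set (R -> CC R)) :
  (forall f, C f -> rapdec f /\ exists2 g, C g & forall x, cder f x (g x)) ->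
  forall f, C f -> schwartz f.
Proof.
move=> HC.
have key n f : C f -> exists2 g, C g &
    derive1n n (@cRe R \o f) = @cRe R \o g /\ derive1n n (@cIm R \o f) = @cIm R \o g.
  elim: n => [|n IH] Cf; first by exists f.
  have [g Cg [E1 E2]] := IH Cf; have [_ [h Ch hh]] := HC _ Cg; exists h => //.
  rewrite !derive1nS E1 E2; split; apply/funext => x; rewrite derive1E.
  - exact: (@derive_val _ _ _ _ _ _ _ (hh x).1).
  - exact: (@derive_val _ _ _ _ _ _ _ (hh x).2).
move=> f Cf u hu.
have key2 n : exists2 g, C g & (derive1n n u = @cRe R \o g \/ derive1n n u = @cIm R \o g).
  have [g Cg [E1 E2]] := key n f Cf; exists g => //.
  by case: hu => ->; [left|right].
split=> [n x|n k].
- have [g Cg E] := key2 n; have [_ [h _ hh]] := HC _ Cg.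
  case: E => ->.
  + exact: (@ex_derive _ _ _ _ _ _ _ (hh x).1).
  + exact: (@ex_derive _ _ _ _ _ _ _ (hh x).2).
- have [g Cg E] := key2 n; have [/(_ k)[M hM] _] := HC _ Cg.
  exists M => x; apply: le_trans (hM x); rewrite mulrC; apply: ler_pM => //; rewrite ?exprn_ge0 //.
    by case: E => ->; [exact: Re_le_cabs|exact: Im_le_cabs].
  by apply: lerXn2r; rewrite ?nnegrE ?norm_le_w // ltW ?w_gt0.
Qed.

Lemma schwartz_rapdec f : schwartz f -> rapdec f.
Proof.
move=> hf k.
have H u : (u = @cRe R \o f \/ u = @cIm R \o f) -> exists M, forall x, `|u x| * (1 + x ^+ 2) ^+ k <= M.
  move=> /hf[_ h]; have [M0 h0] := h 0 0; have [M1 h1] := h 0 (k.*2)%N.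
  exists (2 ^+ k * (M0 + M1)) => x; have := h0 x; have := h1 x.
  rewrite !derive1n0 expr0 mul1r => h1' h0'.
  have w : (1 + x ^+ 2) ^+ k <= 2 ^+ k * (1 + `|x| ^+ k.*2).
    rewrite -mul2n exprM (real_normK (num_real x)).
    have [x1|x1] := leP (x ^+ 2) 1.
      apply: (@le_trans _ _ (2 ^+ k * 1)); last first.
        by rewrite ler_wpM2l ?exprn_ge0 // lerDl exprn_ge0 // sqr_ge0.
      by rewrite mulr1; apply: lerXn2r; rewrite ?nnegrE //; [exact: ltW (w_gt0 _)|lra].
    apply: (@le_trans _ _ (2 ^+ k * (x ^+ 2) ^+ k)); last first.
      by rewrite ler_wpM2l ?exprn_ge0 // lerDr.
    rewrite -exprMn; apply: lerXn2r; rewrite ?nnegrE; [exact: ltW (w_gt0 _)|by rewrite mulr_ge0 ?sqr_ge0|by lra].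
  apply: (le_trans (ler_wpM2l (normr_ge0 _) w)); rewrite mulrCA ler_wpM2l ?exprn_ge0 //.
  by rewrite mulrDr mulr1 lerD // mulrC.
have [M1 h1] := H _ (or_introl erefl); have [M2 h2] := H _ (or_intror erefl).
exists (M1 + M2) => x; apply: le_trans (lerD (h1 x) (h2 x)); rewrite -mulrDl ler_wpM2r ?cabs_le_ReIm //.
by rewrite exprn_ge0 // ltW // w_gt0.
Qed.

Lemma schwartz_cder f x : schwartz f -> cder f x (cderiv f x).
Proof.
move=> hf; split => /=.
- have [h _] := hf _ (or_introl erefl); have := h 0 x; rewrite derive1n0 derive1E; exact: derivableP.
- have [h _] := hf _ (or_intror erefl); have := h 0 x; rewrite derive1n0 derive1E; exact: derivableP.
Qed.

Lemma schwartz_cderiv f : schwartz f -> schwartz (cderiv f).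
Proof.
move=> hf u hu.
have [v [hv E]] : exists v, (v = @cRe R \o f \/ v = @cIm R \o f) /\ forall n, derive1n n u = derive1n n.+1 v.
  case: hu => ->.
  - exists (@cRe R \o f); split; first by left.
    by move=> n; rewrite /derive1n iterSr.
  - exists (@cIm R \o f); split; first by right.
    by move=> n; rewrite /derive1n iterSr.
have [h1 h2] := hf _ hv; split=> [n x|n k]; rewrite E; [exact: h1|exact: h2].
Qed.

Lemma rapdecD f g : rapdec f -> rapdec g -> rapdec (fun x => f x + g x).
Proof.
move=> hf hg k; have [M hM] := hf k; have [N hN] := hg k; exists (M + N) => x.
apply: le_trans (lerD (hM x) (hN x)); rewrite -mulrDl ler_wpM2r ?cabsD //.
by rewrite exprn_ge0 // ltW // w_gt0.
Qed.

Lemma rapdecM f (c : R -> CC R) (K : R) (j : nat) : (forall x, cabs (c x) <= K * (1 + x ^+ 2) ^+ j) -> 0 <= K ->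
  rapdec f -> rapdec (fun x => c x * f x).
Proof.
move=> hc K0 hf k; have [M hM] := hf (j + k)%N; exists (K * M) => x.
apply: le_trans (ler_wpM2l K0 (hM x)).
rewrite cabsM exprD -mulrA.
set F := cabs (f x); set W := _ ^+ k.
have -> : K * (F * ((1 + x ^+ 2) ^+ j * W)) = K * (1 + x ^+ 2) ^+ j * (F * W) by ring.
by apply: ler_wpM2r => //; rewrite mulr_ge0 ?cabs_ge0 // exprn_ge0 // ltW // w_gt0.
Qed.

Lemma schwartzD f g : schwartz f -> schwartz g -> schwartz (fun x => f x + g x).
Proof.
move=> hf hg; apply: (schwartz_ind (C := [set h | exists f1 f2,
  [/\ schwartz f1, schwartz f2 & h = fun x => f1 x + f2 x]])); last by exists f, g.
move=> _ [f1 [f2 [h1 h2 ->]]]; split.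
  by apply: rapdecD; apply: schwartz_rapdec.
exists (fun x => cderiv f1 x + cderiv f2 x).
  by exists (cderiv f1), (cderiv f2); split => //; apply: schwartz_cderiv.
by move=> x; apply: cderD; apply: schwartz_cder.
Qed.

Lemma schwartzZ z f : schwartz f -> schwartz (fun x => z * f x).
Proof.
move=> hf; apply: (schwartz_ind (C := [set h | exists2 f1,
  schwartz f1 & h = fun x => z * f1 x])); last by exists f.
move=> _ [f1 h1 ->]; split.
  apply: (@rapdecM f1 (fun=> z) (cabs z) 0) => [x||]; last exact: schwartz_rapdec.
    by rewrite expr0 mulr1.
  exact: cabs_ge0.
exists (fun x => z * cderiv f1 x); first by exists (cderiv f1) => //; apply: schwartz_cderiv.
by move=> x; apply: cderZ; apply: schwartz_cder.
Qed.

Lemma schwartzN f : schwartz f -> schwartz (fun x => - f x).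
Proof. by move=> /(@schwartzZ (-1)); under eq_fun do rewrite mulN1r. Qed.

Lemma schwartz0 : schwartz (fun x : R => 0 : CC R).
Proof.
apply: (schwartz_ind (C := [set h | h = fun x => 0])) => //.
move=> _ ->; split; first by move=> k; exists 0 => x; rewrite cabs0 mul0r.
by exists (fun x => 0) => // x; apply: cder_cst.
Qed.

Lemma cder_id x : cder (fun t => cR t) x 1.
Proof. exact: (@cder_cR _ (fun t => t) x 1 (is_derive_id x 1)). Qed.

Lemma schwartzX f : schwartz f -> schwartz (fun x => cR x * f x).
Proof.
move=> hf; apply: (schwartz_ind (C := [set h | exists f1 f2,
  [/\ schwartz f1, schwartz f2 & h = fun x => cR x * f1 x + f2 x]])); last first.
  exists f, (fun=> 0); split => //; first exact: schwartz0.
  by apply/funext => x; rewrite addr0.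
move=> _ [f1 [f2 [h1 h2 ->]]]; split.
  apply: rapdecD; last exact: schwartz_rapdec.
  apply: (@rapdecM f1 (@cR R) 1 1) => [x||] //; last exact: schwartz_rapdec.
  by rewrite cabs_cR mul1r expr1 norm_le_w.
exists (fun x => cR x * cderiv f1 x + (f1 x + cderiv f2 x)).
  exists (cderiv f1), (fun x => f1 x + cderiv f2 x); split => //; first exact: schwartz_cderiv.
  by apply: schwartzD => //; apply: schwartz_cderiv.
move=> x; have := cderD (cderM (cder_id x) (schwartz_cder x h1)) (schwartz_cder x h2).
by rewrite mul1r -addrA addrCA.
Qed.

Lemma schwartz_ccont f : schwartz f -> ccont f.
Proof. by move=> hf; apply: (ccont_cder (fun x => schwartz_cder x hf)). Qed.

End SchwartzClass.

(** * Integration and Fourier series *)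

Section Integral.
Variable R : realType.
Implicit Types (f g F G : R -> CC R) (x y a b M s : R) (z : CC R).

(** The majorant 1/(1+x^2) has the primitive atan, so integrability reduces to comparing derivatives
    and no measure theory enters. *)
Definition dec M f := ccont f /\ forall x, cabs (f x) * (1 + x ^+ 2) <= M.

Lemma dec_le M f x : dec M f -> cabs (f x) <= M * (1 + x ^+ 2)^-1.
Proof. by case=> _ h; rewrite ler_pdivlMr ?w_gt0. Qed.

Lemma dec_ge0 M f : dec M f -> 0 <= M.
Proof. by case=> _ h; apply: le_trans (h 0); rewrite mulr_ge0 ?cabs_ge0 // ltW // w_gt0. Qed.

Lemma decD M N f g : dec M f -> dec N g -> dec (M + N) (fun x => f x + g x).
Proof.
move=> [cf hf] [cg hg]; split; first exact: ccontD.
by move=> x; apply: le_trans (lerD (hf x) (hg x)); rewrite -mulrDl ler_wpM2r ?cabsD // ltW // w_gt0.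
Qed.

Lemma decM M N f g : ccont f -> (forall x, cabs (f x) <= N) -> dec M g -> dec (N * M) (fun x => f x * g x).
Proof.
move=> cf hf [cg hg]; split; first exact: ccontM.
move=> x; rewrite cabsM -mulrA; apply: ler_pM => //; first exact: cabs_ge0.
by rewrite mulr_ge0 ?cabs_ge0 // ltW // w_gt0.
Qed.

Lemma decZ M z f : dec M f -> dec (cabs z * M) (fun x => z * f x).
Proof. by apply: decM; [exact: ccont_cst|]. Qed.

Lemma is_derive_Matan M x : is_derive x 1 (fun t => M * atan t) (M * (1 + x ^+ 2)^-1).
Proof.
have := is_deriveM' (is_derive_cst M x 1) (is_derive1_atan x).
by move=> h; apply: (is_derive_eq h); rewrite mul0r add0r.
Qed.

Lemma dec_prim_le M f a b : dec M f -> a <= b ->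
  cabs (prim f b - prim f a) <= 2 * M * (atan b - atan a).
Proof.
move=> h ab; have := cder_le (fun x => cder_prim x h.1) (is_derive_Matan M) ab (fun x _ => dec_le x h).
by rewrite -mulrBr mulrA.
Qed.

Lemma to0_atan (c s : R) : to0 (fun n => c * (pi / 2 - atan (n%:R - s))).
Proof.
have [c0|/ltW c0] := leP c 0.
  move=> e e0; exists 0%N => n _; apply: (le_trans _ (ltW e0)).
  by rewrite mulr_le0_ge0 // subr_ge0 ltW // atan_ltpi2.
apply: to0Z => // e e0.
have [A [_ hA]] := (@cvgrPdist_le _ _ _ _ _ _ _).1 (@cvgy_atan R) e e0.
exists (Num.bound `|A + 1 + s|) => n hn; apply: le_trans (ler_norm _) _; apply: hA.
have := archi_boundP (normr_ge0 (A + 1 + s)); have := ler_norm (A + 1 + s).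
have : ((Num.bound `|A + 1 + s|)%:R : R) <= n%:R by rewrite ler_nat.
lra.
Qed.

(* The improper integral over the line; it converges when [dec M f]. *)
Definition Int f : CC R := limn (fun n : nat => prim f n%:R - prim f (- n%:R)).

Lemma Int_clim M f : dec M f -> clim (fun n : nat => prim f n%:R - prim f (- n%:R)) (Int f).
Proof.
move=> h; have M0 := dec_ge0 h.
have [l hl _] : exists2 l, clim (fun n : nat => prim f n%:R - prim f (- n%:R)) l &
   forall m : nat, cabs (l - (prim f m%:R - prim f (- m%:R))) <= 4 * M * (pi / 2 - atan (m%:R - 0)).
  apply: clim_cauchy; last exact: to0_atan.
  move=> m n mn; have mnR : (m%:R : R) <= n%:R by rewrite ler_nat.
  have h1 := dec_prim_le h mnR.
  have h2 : cabs (prim f (- m%:R) - prim f (- n%:R)) <= 2 * M * (atan n%:R - atan m%:R).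
    have := @dec_prim_le _ _ (- n%:R) (- m%:R) h; rewrite lerN2 => /(_ mnR).
    by rewrite !atanN opprK [- _ + _]addrC.
  have -> : prim f n%:R - prim f (- n%:R) - (prim f m%:R - prim f (- m%:R)) =
     (prim f n%:R - prim f m%:R) + (prim f (- m%:R) - prim f (- n%:R)) by ring.
  apply: (le_trans (cabsD _ _)); rewrite subr0.
  have := atan_ltpi2 (n%:R : R); move: h1 h2; set A := cabs _; set B := cabs _.
  by nra.
by have -> : Int f = l by apply: clim_limn.
Qed.

(** The 8 is 2 * 4: the 2 of [cder_le] and the crude bound 4 for pi, the total increase of atan. *)
Lemma Int_le M f : dec M f -> cabs (Int f) <= 8 * M.
Proof.
move=> h; have M0 := dec_ge0 h; apply: (clim_le (Int_clim h)) => n.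
have nn : - n%:R <= (n%:R : R) by have : (0:R) <= n%:R by []; lra.
apply: (le_trans (dec_prim_le h nn)); rewrite atanN opprK.
have := atan_ltpi2 (n%:R : R); have := @pihalf_lt2 R => h1 h2.
have h3 : atan (n%:R : R) + atan n%:R <= 4 by lra.
apply: (@le_trans _ _ (2 * M * 4)); first by rewrite ler_wpM2l // mulr_ge0.
lra.
Qed.

Lemma eq_Int f g : f =1 g -> Int f = Int g.
Proof. by move=> /funext ->. Qed.

Lemma IntD M N f g : dec M f -> dec N g -> Int (fun x => f x + g x) = Int f + Int g.
Proof.
move=> hf hg; apply: clim_limn.
have := climD (Int_clim hf) (Int_clim hg); congr clim.
by apply/funext => n; rewrite !primD; [ring|exact: hf.1|exact: hg.1|exact: hf.1|exact: hg.1].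
Qed.

Lemma IntZ M z f : dec M f -> Int (fun x => z * f x) = z * Int f.
Proof.
move=> hf; apply: clim_limn; have := climZ z (Int_clim hf); congr clim.
by apply/funext => n; rewrite !primZ ?mulrBr //; exact: hf.1.
Qed.

Lemma Int0 : Int (fun=> 0) = 0.
Proof.
have h : dec 0 (fun _ : R => 0 : CC R).
  by split; [exact: ccont_cst|move=> x; rewrite cabs0 mul0r].
by have := IntZ 0 h; under eq_fun do rewrite mul0r; rewrite mul0r.
Qed.

(** Shifting moves both endpoints of the truncated integral by s, and the increments of atan there
    tend to 0. *)
Lemma Int_shift M f s : dec M f -> dec M (fun x => f (x - s)) -> Int (fun x => f (x - s)) = Int f.
Proof.
move=> h hs; have M0 := dec_ge0 h.
apply: clim_limn; apply: (clim_near (Int_clim h)).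
have E x y : prim (fun t => f (t - s)) x - prim (fun t => f (t - s)) y = prim f (x - s) - prim f (y - s).
  apply: (@primE _ (fun t => prim f (t - s)) _ x y _ hs.1) => t.
  by apply: cder_shift; apply: cder_prim; exact: h.1.
have near a : cabs (prim f (a - s) - prim f a) <= 2 * M * `|atan (a - s) - atan a|.
  have [as_|/ltW as_] := leP a (a - s).
    by have := dec_prim_le h as_; rewrite ger0_norm // subr_ge0 le_atan.
  rewrite cabsB; have := dec_prim_le h as_; rewrite distrC ger0_norm // subr_ge0 le_atan //.
have bd a : `|atan (a - s) - atan a| <= pi / 2 - atan (a - `|s|).
  have := atan_ltpi2 a; have := atan_ltpi2 (a - s).
  have s1 := ler_norm s; have s2 := normr_ge0 s.
  have : atan (a - `|s|) <= atan (a - s) by apply: le_atan; lra.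
  have : atan (a - `|s|) <= atan a by apply: le_atan; lra.
  move=> *; rewrite ler_norml; apply/andP; split; lra.
have bdN a : `|atan (- a - s) - atan (- a)| <= pi / 2 - atan (a - `|s|).
  have -> : - a - s = - (a + s) by ring.
  rewrite !atanN -opprD normrN.
  have := atan_ltpi2 a; have := atan_ltpi2 (a + s).
  have s1 := ler_norm (- s); have s2 := normr_ge0 s; rewrite normrN in s1.
  have : atan (a - `|s|) <= atan (a + s) by apply: le_atan; lra.
  have : atan (a - `|s|) <= atan a by apply: le_atan; lra.
  move=> *; rewrite ler_norml; apply/andP; split; lra.
apply: (to0_le _ (to0_atan (4 * M) `|s|)) => n; rewrite E.
have -> : prim f (n%:R - s) - prim f (- n%:R - s) - (prim f n%:R - prim f (- n%:R)) =
  (prim f (n%:R - s) - prim f n%:R) - (prim f (- n%:R - s) - prim f (- n%:R)) by ring.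
apply: (le_trans (cabsD _ _)); rewrite cabsN.
apply: (le_trans (lerD (near _) (near _))).
have m2 : 0 <= 2 * M by rewrite mulr_ge0.
apply: (le_trans (lerD (ler_wpM2l m2 (bd _)) (ler_wpM2l m2 (bdN _)))).
by rewrite -mulrDl le_eqVlt; apply/orP; left; apply/eqP; ring.
Qed.

Lemma Int_derive M N F f : dec M f -> (forall x, cder F x (f x)) ->
  (forall x, cabs (F x) * (1 + x ^+ 2) <= N) -> Int f = 0.
Proof.
move=> h hF hN; apply: clim_limn.
have N0 : 0 <= N by apply: le_trans (hN 0); rewrite mulr_ge0 ?cabs_ge0 // ltW // w_gt0.
apply: (to0_le _ (to0_harmonic (4 * N))) => n; rewrite subr0 (primE _ _ hF h.1).
have b x : x = n%:R \/ x = - n%:R -> cabs (F x) <= 2 * N / n.+1%:R.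
  move=> hx; rewrite ler_pdivlMr ?ltr0Sn //.
  apply: (@le_trans _ _ (cabs (F x) * (2 * (1 + x ^+ 2)))).
    rewrite ler_wpM2l ?cabs_ge0 // -natr1.
    have -> : x ^+ 2 = n%:R ^+ 2 by case: hx => ->; rewrite ?sqrrN.
    by have : (0:R) <= n%:R by []; nra.
  by have := hN x; nra.
apply: (le_trans (cabsD _ _)); rewrite cabsN.
apply: (le_trans (lerD (b _ (or_introl erefl)) (b _ (or_intror erefl)))).
by rewrite -mulrDl -mulrDl -natrD.
Qed.

Lemma Int_support M f a b : dec M f -> a <= b -> (forall x, x <= a -> f x = 0) ->
  (forall x, b <= x -> f x = 0) -> Int f = prim f b - prim f a.
Proof.
move=> h ab ha hb; apply: clim_limn.
pose A : nat := Num.bound (`|a| + `|b|).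
apply: (clim_eventually (clim_cst _) (N := A)) => n An.
have : (A%:R : R) <= n%:R by rewrite ler_nat.
have A1 := archi_boundP (addr_ge0 (normr_ge0 a) (normr_ge0 b)); rewrite -/A in A1.
have := ler_norm b; have := ler_norm (- a); rewrite normrN.
have := normr_ge0 a; have := normr_ge0 b => b0 a0 a1 b1 An'.
have cst u v : u <= v -> (forall x, u <= x <= v -> f x = 0) -> prim f u = prim f v.
  move=> uv z; apply/eqP; rewrite eq_sym -subr_eq0; apply/eqP/cabs_small => e e0.
  have H := cder_le (fun x => cder_prim x h.1) (fun x => is_derive_scale 0 x) uv.
  apply: le_trans (H _) _; last by rewrite !mul0r subrr mulr0 ltW.
  by move=> x /z ->; rewrite cabs0.
rewrite (cst b n%:R); [|lra|by move=> x /andP[/hb]].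
by rewrite -(cst (- n%:R) a) //; [lra|move=> x /andP[_ /ha]].
Qed.

Lemma schwartz_dec f : schwartz f -> exists M, dec M f.
Proof.
move=> h; have [M hM] := schwartz_rapdec h 1; exists M; split; first exact: schwartz_ccont.
by move=> x; have := hM x; rewrite expr1.
Qed.

Lemma dec_bound M f x : dec M f -> cabs (f x) <= M.
Proof.
move=> [_ h]; apply: le_trans (h x); rewrite ler_peMr ?cabs_ge0 ?w_ge1 //.
Qed.

End Integral.

(** * Pointwise Fourier inversion on a period *)

Section Fourier.
Variable R : realType.
Implicit Types (f g F G : R -> CC R) (x y u : R) (z : CC R).

Definition pint u f : CC R := prim f (u + 1) - prim f u.

Lemma pintD u f g : ccont f -> ccont g -> pint u (fun x => f x + g x) = pint u f + pint u g.
Proof. by move=> hf hg; rewrite /pint !primD //; ring. Qed.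

Lemma pintZ u z f : ccont f -> pint u (fun x => z * f x) = z * pint u f.
Proof. by move=> hf; rewrite /pint !primZ //; ring. Qed.

Lemma pintB u f g : ccont f -> ccont g -> pint u (fun x => f x - g x) = pint u f - pint u g.
Proof.
move=> hf hg; rewrite -[X in _ = _ + X]mulN1r -(pintZ _ _ hg) -pintD //; last exact: ccontZ.
by congr pint; apply/funext => x; rewrite mulN1r.
Qed.

Lemma eq_pint u f g : ccont f -> ccont g -> (forall x, u <= x <= u + 1 -> f x = g x) ->
  pint u f = pint u g.
Proof.
move=> hf hg E; have u1 : u <= u + 1 by rewrite lerDl.
apply/eqP; rewrite -subr_eq0 -pintB //; apply/eqP/cabs_small => e e0.
have hfg := ccontB hf hg.
have H := cder_le (fun x => cder_prim x hfg) (fun x => is_derive_scale 0 x) u1.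
apply: le_trans (H _) _; last by rewrite !mul0r subrr mulr0 ltW.
by move=> x /E ->; rewrite subrr cabs0.
Qed.

Lemma Re_pint u f g : ccont f -> ccont g -> (forall x, cRe (f x) = cRe (g x)) ->
  cRe (pint u f) = cRe (pint u g).
Proof.
move=> hf hg E; apply/eqP; rewrite -subr_eq0 -cReB -pintB //; apply/eqP.
have hfg := ccontB hf hg.
rewrite /pint cReB; apply/eqP; rewrite subr_eq0; apply/eqP.
apply: (@eq_0deriveT _ (fun t => cRe (prim (fun x => f x - g x) t))) => x.
by have [+ _] := cder_prim x hfg; rewrite cReB E subrr.
Qed.

Lemma Re_pint_ge0 u f : ccont f -> (forall x, 0 <= cRe (f x)) -> 0 <= cRe (pint u f).
Proof.
move=> hf h; rewrite /pint cReB subr_ge0.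
apply: (ge0_derive_le (F := fun t => cRe (prim f t)) (f := fun t => cRe (f t))).
- by move=> x; case: (cder_prim x hf).
- by rewrite lerDl.
- by move=> x _; apply: h.
Qed.

Lemma ccont_eeZ (a : R) : ccont (fun x => ee (a * x)).
Proof. by have := @ccont_ee R a 0; under eq_fun do rewrite addr0. Qed.

Lemma pint_ee u (k : int) : pint u (fun x => ee (zR R k * x)) = if k == 0 then 1 else 0.
Proof.
have hc := ccont_eeZ (zR R k).
have [->|k0] := eqVneq k 0.
  have h x : cder (fun t => cR t) x (ee (zR R 0 * x)).
    by rewrite /zR mul0r ee0; apply: cder_id.
  rewrite /pint (primE _ _ h) ?cR_additive ?cR1; [ring|].
  by apply: ccont_eeZ.
have z0 : twopii R * cR (zR R k) != 0.
  rewrite mulf_eq0 negb_or; apply/andP; split.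
    apply/eqP => /(congr1 (@cIm R)) /= /eqP; rewrite mulf_eq0 pnatr_eq0 /=.
    by rewrite gt_eqF // pi_gt0.
  apply/eqP => /(congr1 (@cRe R)) /= /eqP; rewrite /zR intr_eq0; exact/negP.
have h x : cder (fun t => (twopii R * cR (zR R k))^-1 * ee (zR R k * t)) x (ee (zR R k * x)).
  have := cderZ (twopii R * cR (zR R k))^-1 (cder_ee (zR R k) 0 x).
  rewrite mulrA mulVf // mul1r addr0; apply: cder_ext => t; by rewrite addr0.
by rewrite /pint (primE _ _ h) // mulrDr mulr1 eeD ee_int mulr1 subrr.
Qed.

Definition cj z : CC R := Complex (cRe z) (- cIm z).

Lemma ccont_cj f : ccont f -> ccont (fun x => cj (f x)).
Proof.
move=> [h1 h2]; split => //= x; apply: cvgN; exact: h2.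
Qed.

(** The expansion of |r - c w|^2 for |w| = 1. Under the real part the cross term can be written as a
    complex-linear expression in r, which integrates termwise. *)
Lemma sub_cj_norm (r c w : CC R) : cRe w ^+ 2 + cIm w ^+ 2 = 1 ->
  cRe ((r - c * w) * cj (r - c * w)) =
  cRe (r * cj r + (cR (- 2) * cj c * (cj w * r) + cR (cRe c ^+ 2 + cIm c ^+ 2))).
Proof.
case: r => r1 r2; case: c => c1 c2; case: w => w1 w2 /= h.
have -> : c1 ^+ 2 + c2 ^+ 2 = (c1 ^+ 2 + c2 ^+ 2) * (w1 ^+ 2 + w2 ^+ 2) by rewrite h mulr1.
by rewrite /=; ring.
Qed.

Section Bessel.
Variables (G : R -> CC R) (u : R) (fr : nat -> int).
Hypothesis cG : ccont G.
Hypothesis fr_inj : injective fr.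

Let e (n : nat) x : CC R := ee (- zR R (fr n) * x).
Let c n : CC R := pint u (fun x => e n x * G x).

(** The remainder of G after removing N Fourier modes. By orthogonality it has the same later
    coefficients as G ([residual_coeff]), so subtracting the next mode lowers the energy by exactly
    its squared coefficient. *)
Fixpoint residual (N : nat) : R -> CC R :=
  if N is N'.+1 then fun x => residual N' x - c N' * ee (zR R (fr N') * x) else G.

Lemma ccont_residual N : ccont (residual N).
Proof. by elim: N => //= N IH; apply: ccontB => //; apply: ccontZ; apply: ccont_eeZ. Qed.

Lemma residual_coeff N n : (N <= n)%N -> pint u (fun x => e n x * residual N x) = c n.
Proof.
elim: N => //= N IH Nn.
have -> : (fun x => e n x * (residual N x - c N * ee (zR R (fr N) * x))) =
    (fun x => e n x * residual N x - c N * ee (zR R (fr N - fr n) * x)).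
  apply/funext => x; rewrite mulrBr mulrCA /e -eeD; congr (_ - _ * ee _).
  by rewrite zRB; ring.
have cr := ccont_residual N.
rewrite pintB; first last.
- by apply: ccontZ; apply: ccont_eeZ.
- by apply: ccontM => //; apply: ccont_eeZ.
rewrite IH ?(ltnW Nn) // pintZ ?pint_ee; last exact: ccont_eeZ.
rewrite subr_eq0; case: eqP => [/fr_inj E|]; first by rewrite E ltnn in Nn.
by rewrite mulr0 subr0.
Qed.

Let A N := cRe (pint u (fun x => residual N x * cj (residual N x))).

Lemma energyS N : A N.+1 = A N - cabs (c N) ^+ 2.
Proof.
have cr := ccont_residual N; have cr' := ccont_residual N.+1.
have c1 : ccont (fun x => residual N x * cj (residual N x)).
  by apply: ccontM => //; apply: ccont_cj.
have c2 : ccont (fun x => e N x * residual N x).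
  by apply: ccontM => //; apply: ccont_eeZ.
have c3 : ccont (fun x => (cR (- 2) * cj (c N)) * (e N x * residual N x)) by apply: ccontZ.
have E x : cRe (residual N.+1 x * cj (residual N.+1 x)) =
   cRe (residual N x * cj (residual N x) + ((cR (- 2) * cj (c N)) * (e N x * residual N x) +
     cR (cabs (c N) ^+ 2))).
  have -> : e N x = cj (ee (zR R (fr N) * x)).
    by rewrite /e mulNr; apply: CC_eq; rewrite /= mulrN ?cosN ?sinN.
  by rewrite /= cabs_sqr sub_cj_norm // -cabs_sqr cabs_ee expr1n.
rewrite /A; rewrite (Re_pint u _ _ E); first last.
- by apply: ccontD => //; apply: ccontD => //; apply: ccont_cst.
- by apply: ccontM => //; apply: ccont_cj.
rewrite pintD //; last by apply: ccontD => //; apply: ccont_cst.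
rewrite pintD //; last exact: ccont_cst.
rewrite pintZ // residual_coeff //.
have -> : pint u (fun=> cR (cabs (c N) ^+ 2)) = cR (cabs (c N) ^+ 2).
  have := pintZ u (cR (cabs (c N) ^+ 2)) (ccont_eeZ (zR R 0)).
  rewrite pint_ee eqxx mulr1 => E0; rewrite -[RHS]E0; congr pint; apply/funext => x.
  by rewrite /zR mul0r ee0 mulr1.
rewrite 2!cReD -/(A N); congr (_ + _).
rewrite cabs_sqr; move: (c N) => z; rewrite /cj !cE /=; ring.
Qed.

(** The energies of the residuals decrease and are nonnegative, hence converge; their decrements are
    the squared coefficients. No approximation by smooth functions is involved. *)
Lemma riemann_lebesgue : to0 (fun n => cabs (c n)).
Proof.
have A0 N : 0 <= A N.
  apply: Re_pint_ge0; first by apply: ccontM; [|apply: ccont_cj]; apply: ccont_residual.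
  by move=> x; rewrite !cE /cj /= mulrN opprK addr_ge0 // -expr2 sqr_ge0.
have ni : nonincreasing_seq A.
  by apply/nonincreasing_seqP => n; rewrite energyS gerBl sqr_ge0.
have hlb : has_lbound (range A) by exists 0 => _ [n _ <-].
have hc := nonincreasing_is_cvgn ni hlb.
move=> d d0; have d2 : 0 < d ^+ 2 / 2 by rewrite divr_gt0 // exprn_gt0.
have [N _ hN] := (@cvgrPdist_le _ _ _ _ _ _ _).1 hc _ d2.
exists N => n Nn.
have h1 : `|limn A - A n| <= d ^+ 2 / 2 := hN _ Nn.
have h2 : `|limn A - A n.+1| <= d ^+ 2 / 2 := hN n.+1 (leqW Nn).
suff H : cabs (c n) ^+ 2 <= d ^+ 2.
  by move: H; rewrite ler_pXn2r // nnegrE ?cabs_ge0 // ltW.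
move: h2; rewrite energyS; move: h1; move: (limn A) (A n) => L a; rewrite !ler_norml => /andP[h1 h2] /andP[h3 h4].
lra.
Qed.

End Bessel.

Section Quotient.
Variables (f : R -> R) (df : R -> R).
Hypothesis hf : forall x, is_derive x 1 f (df x).

(** Up to a phase and a constant, the quotient of f(x) - f(0) by e^{2 pi i x} - 1, with its limit
    filled in at 0. *)
Definition sinquot x := if x == 0 then df 0 / pi else (f x - f 0) / sin (pi * x).

Lemma sin_pi_neq0 x : `|x| < 1 -> x != 0 -> sin (pi * x) != 0.
Proof.
have p0 := @pi_gt0 R.
move=> x1 x0; wlog xp : x x1 x0 / 0 < x.
  move=> H; have [xn|xp|E] := ltgtP x 0; [|exact: H|by rewrite E eqxx in x0].
  by rewrite -oppr_eq0 -sinN -mulrN; apply: H; rewrite ?normrN ?oppr_eq0 ?oppr_gt0.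
rewrite gt_eqF // sin_gt0_pi //; move: x1; rewrite gtr0_norm // => x1.
by rewrite mulr_gt0 //= -[ltRHS]mulr1 ltr_pM2l.
Qed.

Lemma sinquot_cont x : `|x| < 1 -> {for x, continuous sinquot}.
Proof.
move=> x1; have [->|x0] := eqVneq x 0.
- apply/continuous_withinNx; rewrite {2}/sinquot eqxx.
  have d1 : h^-1 * (f h - f 0) @[h --> 0^'] --> df 0.
    have h := hf 0; have hd := @ex_derive _ _ _ _ _ _ _ h; have hv := @derive_val _ _ _ _ _ _ _ h.
    have [l hl] := (cvg_ex _).1 hd.
    have E : l = df 0 by rewrite -hv; apply/esym/cvg_lim => //; exact: Rhausdorff.
    have Ef : (fun h : R => h^-1 *: ((f \o shift 0) (h *: (1 : R)) - f 0)) = (fun h => h^-1 * (f h - f 0)).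
      by apply/funext => t; rewrite /GRing.scale /= mulr1 addr0.
    by rewrite -E -Ef; exact: hl.
  have d2 : (fun h : R => h^-1 * sin (pi * h)) @ 0^' --> (pi : R).
    have h : is_derive (0 : R) 1 (fun t : R => sin (pi * t)) (pi * cos (pi * 0)).
      exact: (is_derive_comp (is_derive_sin _) (is_derive_scale pi 0)).
    have hd := @ex_derive _ _ _ _ _ _ _ h; have hv := @derive_val _ _ _ _ _ _ _ h.
    have [l hl] := (cvg_ex _).1 hd.
    have E : l = pi.
      rewrite -[RHS]mulr1 -[X in _ = _ * X]cos0 -[X in cos X](mulr0 pi) -hv.
      by apply/esym/cvg_lim => //; exact: Rhausdorff.
    have Ef : (fun h : R => h^-1 *: (((fun t => sin (pi * t)) \o shift 0) (h *: (1 : R)) - sin (pi * 0))) =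
        (fun h => h^-1 * sin (pi * h)).
      by apply/funext => t; rewrite /GRing.scale /= mulr1 addr0 mulr0 sin0 subr0.
    by rewrite Ef E in hl.
  have pi0 : pi != 0 :> R by rewrite gt_eqF // pi_gt0.
  apply: (cvg_trans _ (cvgM d1 (cvgV pi0 d2))); apply: near_eq_cvg.
  near=> t.
  have t0 : t != 0 by near: t; exact: nbhs_dnbhs_neq.
  by rewrite /= /sinquot (negbTE t0) invfM invrK mulrACA mulVf ?mul1r //.
- have s0 := sin_pi_neq0 x1 x0.
  have c : {for x, continuous (fun t => (f t - f 0) / sin (pi * t))}.
    apply: cvgM.
      apply: cvgB; last exact: cvg_cst.
      exact: (is_derive_continuous hf).
    apply: cvgV => //.
    exact: (is_derive_continuous (fun x => is_derive_comp (is_derive_sin _) (is_derive_scale pi x))).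
  rewrite /prop_for /continuous_at /sinquot (negbTE x0).
  apply: cvg_trans c; apply: near_eq_cvg; near=> t.
  have -> // : t == 0 = false.
  apply/negbTE; near: t; exists `|x| => [|t] /=; first by rewrite normr_gt0.
  by apply: contraTneq => ->; rewrite subr0 ltxx.
Unshelve. all: by end_near. Qed.

End Quotient.

Lemma ee_sub1 x : ee x - 1 = Complex 0 2 * cR (sin (pi * x)) * ee (x / 2) :> CC R.
Proof.
have E : 2 * pi * (x / 2) = pi * x by field.
have E2 : 2 * pi * x = pi * x + pi * x by ring.
apply: CC_eq; rewrite !cE /= E E2 ?cosD ?sinD; last by ring.
by have := cos2Dsin2 (pi * x); lra.
Qed.

(** Write k = k(0) + (e^{2 pi i x} - 1) G on the period, with G continuous. The factor in front of G
    turns its Fourier coefficients into differences, so the symmetric partial sum is k(0) plus two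
    single coefficients of G, which vanish in the limit by [riemann_lebesgue]. The values of k at
    the two ends of the period need not agree. *)
Lemma fourier_inversion0 (k k' : R -> CC R) u : (forall x, cder k x (k' x)) -> - 1 < u -> u < 0 ->
  clim (fun N => zsum N (fun n => pint u (fun x => ee (- zR R n * x) * k x))) (k 0).
Proof.
move=> hk um1 u0.
(* Clamping to the period makes G continuous on the whole line: sin (pi x) has further zeros at the
   nonzero integers, which the clamped argument never reaches. *)
pose cl (x : R) : R := Num.max u (Num.min x (u + 1)).
have clu x : u <= cl x <= u + 1.
  by rewrite /cl le_max lexx ge_max lerDl ler01 ge_min lexx orbT.
have cl_id x : u <= x <= u + 1 -> cl x = x.
  by move=> /andP[h1 h2]; rewrite /cl min_l // max_r.
have cl_cont : continuous cl.
  move=> x; apply: (@continuous_max _ _ (fun=> u) (fun x => Num.min x (u + 1))); first exact: cvg_cst.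
  by apply: (@continuous_min _ _ id (fun=> u + 1)); [exact: cvg_id|exact: cvg_cst].
have cl1 x : `|cl x| < 1.
  by have /andP[h1 h2] := clu x; rewrite ltr_norml; apply/andP; split; lra.
pose q x : CC R := Complex (sinquot (fun t => cRe (k t)) (fun t => cRe (k' t)) (cl x))
                      (sinquot (fun t => cIm (k t)) (fun t => cIm (k' t)) (cl x)).
have cq : ccont q.
  split=> x /=.
  - apply: (@continuous_comp _ _ _ cl); first exact: cl_cont.
    by apply: sinquot_cont => // t; case: (hk t).
  - apply: (@continuous_comp _ _ _ cl); first exact: cl_cont.
    by apply: sinquot_cont => // t; case: (hk t).
pose G x : CC R := Complex 0 (- 2^-1) * (ee (- 2^-1 * x) * q x).
have cG : ccont G by apply: ccontZ; apply: ccontM => //; apply: ccont_eeZ.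
have ck := ccont_cder hk.
have kG x : u <= x <= u + 1 -> k x = k 0 + (ee x - 1) * G x.
  move=> hx; rewrite ee_sub1 /G.
  have -> : Complex 0 2 * cR (sin (pi * x)) * ee (x / 2) * (Complex 0 (- 2^-1) * (ee (- 2^-1 * x) * q x)) =
     (Complex 0 2 * Complex 0 (- 2^-1)) * (ee (- 2^-1 * x) * ee (x / 2)) * (cR (sin (pi * x)) * q x) by ring.
  have -> : (Complex 0 2 * Complex 0 (- 2^-1)) = 1 :> CC R.
    by apply: CC_eq; rewrite !cE /=; field.
  rewrite -eeD (_ : - 2^-1 * x + x / 2 = 0); last by field.
  rewrite ee0 !mul1r /q cl_id // /sinquot.
  have [->|x0] := eqVneq x 0; first by rewrite mulr0 sin0 mul0r addr0.
  have s0 : sin (pi * x) != 0.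
    by apply: sin_pi_neq0 => //; rewrite -(cl_id _ hx).
  by apply: CC_eq; rewrite !cE /= !mul0r ?subr0 ?addr0 mulrC mulfVK // addrC subrK.
pose g (n : int) := pint u (fun x => ee (- zR R n * x) * G x).
have E (n : int) : pint u (fun x => ee (- zR R n * x) * k x) =
    (if n == 0 then k 0 else 0) + (g (n - 1) - g n).
  have c1 (m : int) : ccont (fun x => ee (- zR R m * x) * G x).
    by apply: ccontM => //; apply: ccont_eeZ.
  have c2 : ccont (fun x => k 0 * ee (- zR R n * x)) by apply: ccontZ; apply: ccont_eeZ.
  have c3 : ccont (fun x => ee (- zR R (n - 1) * x) * G x - ee (- zR R n * x) * G x).
    by apply: ccontB.
  rewrite (@eq_pint u _ (fun x => k 0 * ee (- zR R n * x) +
    (ee (- zR R (n - 1) * x) * G x - ee (- zR R n * x) * G x))); first last.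
  - move=> x /kG ->; rewrite zRB (_ : - (zR R n - zR R 1) * x = - zR R n * x + x).
      by rewrite eeD; ring.
    by rewrite {2}/zR; ring.
  - exact: ccontD.
  - by apply: ccontM => //; apply: ccont_eeZ.
  rewrite pintD // pintB // pintZ; last exact: ccont_eeZ.
  have -> : pint u (fun x => ee (- zR R n * x)) = if n == 0 then 1 else 0.
    by rewrite -zRN pint_ee oppr_eq0.
  by rewrite -/(g n) -/(g (n - 1)); case: eqP => _; rewrite ?mulr1 ?mulr0.
(* Telescoping leaves one coefficient of G at each end, at frequencies -(N+1) and N. *)
have S N : zsum N (fun n => pint u (fun x => ee (- zR R n * x) * k x)) = k 0 + (g (- N.+1%:Z) - g N%:Z).
  elim: N => [|N IH]; first by rewrite zsum0 E eqxx.
  rewrite zsumS IH !E /=.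
  rewrite (_ : - N.+1%:Z - 1 = - N.+2%:Z); last by lia.
  rewrite (_ : N.+1%:Z - 1 = N%:Z); last by lia.
  by ring.
have i1 : injective (fun n : nat => - n.+1%:Z) by move=> a b /oppr_inj [].
have i2 : injective (fun n : nat => n%:Z) by move=> a b [].
apply: (to0_le _ (to0D (riemann_lebesgue u cG i1) (riemann_lebesgue u cG i2))) => n.
rewrite S (_ : forall a b : CC R, a + b - a = b); last by move=> a b; ring.
by apply: (le_trans (cabsD _ _)); rewrite cabsN.
Qed.

End Fourier.

(** * Bump functions *)

Section Bump.
Variable R : realType.
Implicit Types (x y s t : R) (P Q : {poly R}).

Lemma rapdec_compact (f : R -> CC R) (A K : R) : (forall x, A < `|x| -> f x = 0) ->
  (forall x, cabs (f x) <= K) -> rapdec f.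
Proof.
move=> h hK k; have K0 : 0 <= K by apply: le_trans (cabs_ge0 _) (hK 0).
exists (K * (1 + A ^+ 2) ^+ k) => x; have [xA|xA] := ltP A `|x|.
  by rewrite h // cabs0 mul0r mulr_ge0 // exprn_ge0 // ltW // w_gt0.
apply: ler_pM; rewrite ?cabs_ge0 ?exprn_ge0 // ?(ltW (w_gt0 _)) //.
apply: lerXn2r; rewrite ?nnegrE ?(ltW (w_gt0 _)) // lerD2l -(real_normK (num_real x)).
by apply: lerXn2r; rewrite ?nnegrE // (le_trans (normr_ge0 x)).
Qed.

Lemma schwartz_antiderivative (f g : R -> CC R) : rapdec f -> (forall x, cder f x (g x)) ->
  schwartz g -> schwartz f.
Proof.
move=> hf hg sg; apply: (schwartz_ind (C := [set h | h = f \/ schwartz h])); last by left.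
move=> h [->|hh]; first by split => //; exists g => //; right.
split; first exact: schwartz_rapdec.
by exists (cderiv h); [right; exact: schwartz_cderiv|move=> x; exact: schwartz_cder].
Qed.

Lemma schwartz_affine (f : R -> CC R) s t : s != 0 -> schwartz f -> schwartz (fun x => f (s * x + t)).
Proof.
move=> s0 hf; apply: (schwartz_ind (C := [set h | exists2 g,
   schwartz g & h = fun x => g (s * x + t)])); last by exists f.
move=> _ [g hg ->]; split.
  move=> k; have [M hM] := schwartz_rapdec hg k.
  pose c := 1 + 2 * s^-1 ^+ 2 * (1 + t ^+ 2).
  have c0 : 0 <= c by rewrite addr_ge0 // mulr_ge0 ?(ltW (w_gt0 t)) // mulr_ge0 // sqr_ge0.
  exists (c ^+ k * M) => x; apply: le_trans (ler_wpM2l (exprn_ge0 _ c0) (hM (s * x + t))).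
  rewrite mulrCA ler_wpM2l ?cabs_ge0 // -exprMn.
  apply: lerXn2r; rewrite ?nnegrE; [exact: ltW (w_gt0 _)|by rewrite mulr_ge0 // ltW // w_gt0|].
  have E : x = s^-1 * (s * x + t) - s^-1 * t by field.
  move: (s * x + t) E => y ->; rewrite /c; set u := s^-1.
  have E : (1 + 2 * u ^+ 2 * (1 + t ^+ 2)) * (1 + y ^+ 2) - (1 + (u * y - u * t) ^+ 2) =
    y ^+ 2 + u ^+ 2 * (2 + 2 * (t * y) ^+ 2 + y ^+ 2 + 2 * (y * t) + t ^+ 2) by ring.
  rewrite -subr_ge0 E addr_ge0 ?sqr_ge0 // mulr_ge0 ?sqr_ge0 //.
  have := sqr_ge0 (t * y); have := sqr_ge0 (y + t); nra.
exists (fun x => cR s * cderiv g (s * x + t)).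
  exists (fun x => cR s * cderiv g x) => //.
  by apply: schwartzZ; apply: schwartz_cderiv.
move=> x; apply: (cder_comp (g := fun x => s * x + t)); last exact: is_derive_affine.
exact: schwartz_cder.
Qed.

(** Since e^y = (e^{y/k})^k and e^{y/k} >= y/k. *)
Lemma powexp_le (k : nat) y : 0 <= y -> y ^+ k * expR (- y) <= k%:R ^+ k.
Proof.
move=> y0; rewrite expRN ler_pdivrMr ?expR_gt0 //.
case: k => [|k]; first by rewrite !expr0 mul1r -expR0 ler_expR.
have k0 : (0 : R) < k.+1%:R by rewrite ltr0Sn.
have -> : expR y = expR (y / k.+1%:R) ^+ k.+1.
  by rewrite -expRM_natl; congr expR; field; exact: lt0r_neq0.
rewrite -exprMn; apply: lerXn2r; rewrite ?nnegrE ?mulr_ge0 ?expR_ge0 ?ler0n //.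
rewrite mulrC -ler_pdivrMr //; apply: le_trans (expR_ge1Dx _).
by rewrite lerDr.
Qed.

(* With polynomial prefactors P(1/x), the flat functions e^{-1/x} form a class stable under
   differentiation. *)
Definition flat P x : R := if 0 < x then P.[x^-1] * expR (- x^-1) else 0.

Lemma flat_bound P : exists M, forall x, `|flat P x| <= M.
Proof.
exists (\sum_(i < size P) `|P`_i| * i%:R ^+ i) => x; rewrite /flat; case: ifP => x0; last first.
  by rewrite normr0; apply: sumr_ge0 => i _; rewrite mulr_ge0.
rewrite normrM (ger0_norm (expR_ge0 _)) horner_coef.
apply: (@le_trans _ _ (\sum_(i < size P) `|P`_i| * ((x^-1) ^+ i * expR (- x^-1)))).
  apply: (le_trans (ler_wpM2r (expR_ge0 _) (ler_norm_sum _ _ _))).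
  rewrite mulr_suml; apply: ler_sum => i _; rewrite normrM mulrA.
  by rewrite [`|x^-1 ^+ i|]ger0_norm // exprn_ge0 // invr_ge0 ltW.
by apply: ler_sum => i _; rewrite ler_wpM2l // powexp_le // invr_ge0 ltW.
Qed.

(** In the variable t = 1/x the derivative in x is -t^2 d/dt, and d/dt sends P e^{-t} to (P' - P)
    e^{-t}. *)
Definition flatD P : {poly R} := 'X^2 * (P - P^`()).

Lemma flat_X P x : 0 < x -> flat ('X * P) x = x^-1 * flat P x.
Proof. by move=> x0; rewrite /flat x0 hornerM hornerX mulrA. Qed.

Lemma is_derive_flat P x : is_derive x 1 (flat P) (flat (flatD P) x).
Proof.
have [x0|x0|->] := ltgtP x 0.
- have -> : flat (flatD P) x = 0 by rewrite /flat (lt_gtF x0).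
  apply: (@near_eq_is_derive _ _ _ (cst (0 : R))).
  near=> t; rewrite /flat (@lt_gtF _ _ t) //; near: t.
  exact: lt_nbhsl.
- apply: (@near_eq_is_derive _ _ _ (fun t => P.[t^-1] * expR (- t^-1))).
    near=> t; rewrite /flat (_ : 0 < t) //; near: t.
    exact: lt_nbhsr.
  have hV : is_derive x 1 (fun t : R => t^-1) (- x ^- 2).
    have := is_deriveV (lt0r_neq0 x0) (is_derive_id x 1).
    by move=> h; apply: (is_derive_eq h); rewrite /GRing.scale /= mulr1.
  have hP := is_derive_comp (is_derive_poly P x^-1) hV.
  have hN : is_derive x 1 (fun t : R => - t^-1) (- - x ^- 2) := is_deriveN hV.
  have hE := is_derive_comp (g := fun t : R => - t^-1) (is_derive_expR (- x^-1)) hN.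
  apply: (is_derive_eq (is_deriveM' hP hE)).
  rewrite /flat x0 /flatD hornerM hornerXn hornerD hornerN exprVn; ring.
- apply/der_epsP => e e0.
  have -> : flat (flatD P) 0 = 0 by rewrite /flat ltxx.
  (* Boundedness of x^{-2} P(1/x) e^{-1/x} says that [flat P] is O(s^2) at the origin, hence has
     derivative 0 there. *)
  have [M hM] := flat_bound ('X * ('X * P)).
  have M0 : 0 <= M by apply: le_trans (hM 0).
  exists (e / (M + 1)); first by rewrite divr_gt0 // ltr_wpDl.
  move=> s sd; rewrite add0r mul0r subr0 {2}/flat ltxx subr0.
  have [s0|s0] := ltP 0 s; last by rewrite /flat ltNge s0 /= normr0 mulr_ge0 // ltW.
  have := hM s; rewrite !flat_X // !normrM normfV; set F := `|flat P s|.
  have n0 : 0 < `|s| by rewrite normr_gt0 gt_eqF.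
  move=> H; have H2 : F <= M * `|s| * `|s|.
    by rewrite -2!(ler_pdivrMr _ _ n0); move: H; rewrite mulrA mulrC mulrA.
  apply: (le_trans H2); rewrite ler_wpM2r //.
  move: sd; rewrite ltr_pdivlMr ?ltr_wpDl // => /ltW; apply: le_trans.
  by rewrite mulrC ler_wpM2l // lerDl.
Unshelve. all: by end_near. Qed.

Definition flat_bump P Q x := flat P x * flat Q (1 - x).

Lemma is_derive_flat_bump P Q x :
  is_derive x 1 (flat_bump P Q) (flat_bump (flatD P) Q x - flat_bump P (flatD Q) x).
Proof.
have h1 : is_derive x 1 (fun t : R => 1 - t) (- 1).
  have := is_derive_affine (- 1) 1 x; congr is_derive.
  by apply/funext => t; ring.
have := is_deriveM' (is_derive_flat P x) (is_derive_comp (g := fun t : R => 1 - t) (is_derive_flat Q (1 - x)) h1).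
by move=> h; apply: (is_derive_eq h); rewrite /flat_bump; ring.
Qed.

Lemma flat_bump_out P Q x : x <= 0 \/ 1 <= x -> flat_bump P Q x = 0.
Proof.
rewrite /flat_bump /flat; case=> h.
  by rewrite ltNge h /= mul0r.
rewrite [X in _ * X](_ : _ = 0) ?mulr0 //.
by case: ifP => // h'; exfalso; lra.
Qed.

(** The class closed under differentiation consists of finite real combinations of such products,
    encoded as lists; the Leibniz rule replaces each entry by two. *)
Lemma schwartz_flat_bump P Q : schwartz (fun x => cR (flat_bump P Q x)).
Proof.
pose C := [set h : R -> CC R | exists r : seq ({poly R} * {poly R} * R),
   h = fun x => cR (\sum_(i <- r) i.2 * flat_bump i.1.1 i.1.2 x)].
apply: (schwartz_ind (C := C)); last first.
  by exists [:: ((P, Q), 1)]; apply/funext => x; rewrite big_seq1 mul1r.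
move=> _ [r ->]; split.
  have [K hK] : exists K, forall x, cabs (cR (\sum_(i <- r) i.2 * flat_bump i.1.1 i.1.2 x)) <= K.
    elim: r => [|[[P1 Q1] c] r [K hK]].
      by exists 0 => x; rewrite big_nil cabs0.
    have [M1 h1] := flat_bound P1; have [M2 h2] := flat_bound Q1.
    exists (`|c| * (M1 * M2) + K) => x; rewrite big_cons cR_additive.
    apply: (le_trans (cabsD _ _)); apply: lerD => //.
    by rewrite cabs_cR !normrM ler_wpM2l // ler_pM.
  apply: (rapdec_compact (A := 1)) hK => x x1.
  rewrite big1_seq // => -[[P1 Q1] c] _ /=; rewrite flat_bump_out ?mulr0 //.
  by move: x1; rewrite lter_normr => /orP[] h; [right|left]; lra.
exists (fun x => cR (\sum_(i <- flatten [seq [:: ((flatD i.1.1, i.1.2), i.2); ((i.1.1, flatD i.1.2), - i.2)] | i <- r])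
    i.2 * flat_bump i.1.1 i.1.2 x)); first by eexists.
move=> x; apply: cder_cR; elim: r => [|[[P1 Q1] c] r IH] /=.
  by rewrite big_nil; under eq_fun do rewrite big_nil; apply: is_derive_cst.
under eq_fun do rewrite big_cons.
rewrite !big_cons /= addrA; apply: is_deriveD => //.
apply: (is_derive_eq (is_deriveM' (is_derive_cst c x 1) (is_derive_flat_bump P1 Q1 x))).
rewrite /cst; ring.
Qed.

(** The normalised primitive of a bump. A step does not decay, but the difference of two affine
    copies of it is a window with compact support; this is the only form in which smoothness is
    used. *)
Lemma ex_step : exists sg : R -> R, [/\ forall x, x <= 0 -> sg x = 0,
  forall x, 1 <= x -> sg x = 1 &
  forall s t t', 0 < s -> schwartz (fun x => cR (sg (s * x + t) - sg (s * x + t')))].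
Proof.
pose b := flat_bump 1 1.
have cb : continuous b by apply: (is_derive_continuous (fun x => is_derive_flat_bump 1 1 x)).
have [B B0 hB] := ex_primitive cb.
have b0 x : 0 <= b x.
  by rewrite /b /flat_bump /flat !hornerC; do 2!case: ifP => _; rewrite ?mul0r ?mulr0 // !mul1r mulr_ge0 // expR_ge0.
have Bmono x y : x <= y -> B x <= B y by move=> xy; apply: (ge0_derive_le hB).
have bout x : x <= 0 \/ 1 <= x -> b x = 0 by exact: flat_bump_out.
have Bl x : x <= 0 -> B x = 0.
  move=> x0; rewrite -B0; apply: eq_0derive => // t /andP[_ t0].
  by rewrite -(bout t) //; left.
have Br x : 1 <= x -> B x = B 1.
  move=> x0; apply/esym; apply: eq_0derive => // t /andP[t0 _].
  by rewrite -(bout t) //; right.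
(* If the total mass vanished, the monotone B would be constant on [0,1], contradicting its positive
   derivative at 1/2. *)
have Z0 : 0 < B 1.
  rewrite lt_neqAle -{2}B0 Bmono // andbT eq_sym; apply/eqP => B1.
  have h : is_derive (2^-1 : R) 1 B 0.
    apply: (@near_eq_is_derive _ _ _ (cst (0 : R))).
    near=> t; apply/eqP; rewrite eq_sym eq_le.
    have -> : 0 <= B t by rewrite -B0; apply: Bmono; near: t; apply: lt_le_nbhsr; lra.
    rewrite andbT -B1; apply: Bmono; near: t; apply: lt_le_nbhsl; lra.
  have E := @derive_val _ _ _ _ _ _ _ h; have := @derive_val _ _ _ _ _ _ _ (hB 2^-1).
  rewrite E => /esym; rewrite /b /flat_bump /flat.
  have -> : 1 - 2^-1 = 2^-1 :> R by field.
  rewrite invr_gt0 ltr0n hornerC mul1r => /eqP; rewrite mulf_eq0 orbb expR_eq0 //.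
pose sg x := B x / B 1.
have sg01 x : 0 <= sg x <= 1.
  have h1 : B (Num.min x 0) <= B x by rewrite Bmono // ge_min lexx.
  have h2 : B x <= B (Num.max x 1) by rewrite Bmono // le_max lexx.
  rewrite (Bl (Num.min x 0)) ?ge_min ?lexx ?orbT // in h1.
  rewrite (Br (Num.max x 1)) ?le_max ?lexx ?orbT // in h2.
  apply/andP; split; first by rewrite /sg divr_ge0 // ltW.
  by rewrite /sg ler_pdivrMr // mul1r.
have sgl x : x <= 0 -> sg x = 0 by move=> /Bl h; rewrite /sg h mul0r.
have sgr x : 1 <= x -> sg x = 1 by move=> /Br h; rewrite /sg h divff // gt_eqF.
exists sg; split => // s t t' s0.
have sb u : schwartz (fun x => cR (s / B 1) * cR (b (s * x + u))).
  apply: schwartzZ; apply: (schwartz_affine (f := fun x => cR (b x))); first exact: lt0r_neq0.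
  exact: schwartz_flat_bump.
apply: (@schwartz_antiderivative _ (fun x => cR (s / B 1) * cR (b (s * x + t)) + - (cR (s / B 1) * cR (b (s * x + t'))))); last first.
- by apply: schwartzD => //; apply: schwartzN.
- move=> x; rewrite -!cRM -cRB; apply: cder_cR; apply: is_deriveB.
  + have := is_deriveM' (is_derive_comp (hB _) (is_derive_affine s t x)) (is_derive_cst (B 1)^-1 x 1).
    by move=> h; apply: (is_derive_eq h); rewrite /cst; ring.
  + have := is_deriveM' (is_derive_comp (hB _) (is_derive_affine s t' x)) (is_derive_cst (B 1)^-1 x 1).
    by move=> h; apply: (is_derive_eq h); rewrite /cst; ring.
- apply: (rapdec_compact (A := (1 + `|t| + `|t'|) / s) (K := 1)) => x.
    rewrite ltr_pdivrMr // => h; have := ler_norm t; have := ler_norm (- t).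
    have := ler_norm t'; have := ler_norm (- t'); rewrite !normrN => a1 a2 a3 a4.
    have b1 := normr_ge0 t; have b2 := normr_ge0 t'.
    have [x0|x0] := leP 0 x.
      rewrite (ger0_norm x0) in h.
      by rewrite !sgr ?subrr //; lra.
    rewrite (ltr0_norm x0) in h.
    by rewrite !sgl ?subrr //; lra.
  rewrite cabs_cR ler_norml; have /andP[h1 h2] := sg01 (s * x + t).
  have /andP[h3 h4] := sg01 (s * x + t'); apply/andP; split; lra.
Unshelve. all: by end_near. Qed.

End Bump.

(** * The A_theta-valued pairing *)

Section Pairing.
Variables (R : realType) (theta : R) (c d : int).
Hypothesis c0 : c != 0.
Hypothesis nu0 : 0 < zR R c * theta + zR R d.
Implicit Types (f g F G : SRZ R) (x y s : R) (al : int).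

Let mu : R := zR R c / (zR R c * theta + zR R d).

Lemma zRc0 : zR R c != 0. Proof. by rewrite intr_eq0. Qed.

Lemma slope_neq0 : mu != 0.
Proof. by rewrite mulf_neq0 ?zRc0 // invr_neq0 // gt_eqF. Qed.

Lemma slopeV : mu^-1 = theta + zR R d / zR R c.
Proof.
rewrite /mu; field; rewrite zRc0 /=.
by move: nu0; rewrite lt_neqAle eq_sym => /andP[].
Qed.

Definition phase x al : R := x - zR R al * zR R d / zR R c.

(* The action of U1^p U2^q on E_{d,c}. *)
Definition wtau (p q : int) f : SRZ R := fun x al =>
  ee (zR R q * phase x al) * f (x - zR R p / mu) (al - p).

Lemma Edc_actE f a x al : Edc_act theta c d f a x al = sumZ2 (fun m n => a m n * wtau m n f x al).
Proof. by apply: eq_sumZ2 => m n; rewrite /wtau mulrA. Qed.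

Definition c_periodic f := forall x al, f x (al + c) = f x al.
Definition contS f := forall al, ccont (fun x => f x al).
Definition bnd (K : R) f := forall x al, cabs (f x al) <= K.
Definition decS M f := forall al, dec M (fun x => f x al).

Lemma decS_bnd M f : decS M f -> bnd M f.
Proof. by move=> h x al; exact: (dec_bound x (h al)). Qed.
Lemma decS_cont M f : decS M f -> contS f.
Proof. by move=> h al; case: (h al). Qed.

(** The shift by p/mu lowers the phase by p (theta + d/c), and replacing al by al - p restores p
    d/c. The remaining p theta is the commutation relation of U1 and U2. *)
Lemma phase_shift x al p : phase (x - zR R p / mu) (al - p) = phase x al - zR R p * theta.
Proof.
rewrite /phase slopeV zRB mulrDr mulrBl mulrBl opprD opprB -!addrA; congr (_ + _).
by rewrite mulrA; ring.
Qed.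

Lemma wtau_periodic p q f : c_periodic f -> c_periodic (wtau p q f).
Proof.
move=> h x al; rewrite /wtau addrAC h; congr (_ * _).
have -> : zR R q * phase x (al + c) = zR R q * phase x al + zR R (- (q * d)).
  by rewrite zRN zRM /phase zRD; field; exact: zRc0.
by rewrite eeD ee_int mulr1.
Qed.

Lemma wtau_comp p q m n f x al : wtau p q (wtau m n f) x al = ee (- theta * zR R n * zR R p) * wtau (m + p) (n + q) f x al.
Proof.
rewrite /wtau phase_shift.
have -> : x - zR R p / mu - zR R m / mu = x - zR R (m + p) / mu by rewrite zRD; ring.
have -> : al - p - m = al - (m + p) by ring.
rewrite !mulrA -!eeD; congr (ee _ * _); rewrite zRD; ring.
Qed.

Lemma wtau00 f x al : wtau 0 0 f x al = f x al.
Proof. by rewrite /wtau /zR !mul0r ee0 mul1r !subr0. Qed.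

Lemma wtauD p q f g x al : wtau p q (f + g) x al = wtau p q f x al + wtau p q g x al.
Proof. by rewrite /wtau /= mulrDr. Qed.

Lemma wtau_bnd K p q f : bnd K f -> bnd K (wtau p q f).
Proof. by move=> h x al; rewrite /wtau cabsM cabs_ee mul1r. Qed.

Lemma ccont_phase q al : ccont (fun x => ee (zR R q * phase x al)).
Proof.
have := @ccont_ee R (zR R q) (- (zR R q * (zR R al * zR R d / zR R c))); congr ccont.
by apply/funext => x; rewrite /phase; congr ee; ring.
Qed.

Lemma wtau_cont p q f : contS f -> contS (wtau p q f).
Proof.
move=> h al; apply: ccontM; first exact: ccont_phase.
exact: (ccont_shift (zR R p / mu) (h (al - p))).
Qed.

(** Peetre's inequality 1 + x^2 <= 2 (1 + s^2)(1 + (x - s)^2), the difference of the two sides being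
    written as a sum of squares. *)
Lemma wtau_dec M p q f : decS M f -> exists M', decS M' (wtau p q f).
Proof.
move=> h; set s := zR R p / mu; exists (2 * (1 + s ^+ 2) * M) => al.
split; first exact: wtau_cont (decS_cont h) al.
move=> x; rewrite /wtau cabsM cabs_ee mul1r -/s.
have [_ /(_ (x - s)) H] := h (al - p).
have s1 : 0 <= 2 * (1 + s ^+ 2) by rewrite mulr_ge0 // ltW // w_gt0.
apply: le_trans (ler_wpM2l s1 H); rewrite mulrCA ler_wpM2l ?cabs_ge0 //.
rewrite -subr_ge0 (_ : _ - _ = 1 + (x - s * 2) ^+ 2 + 2 * (s * (x - s)) ^+ 2); last by ring.
by rewrite !addr_ge0 ?sqr_ge0 // mulr_ge0 ?sqr_ge0.
Qed.

Lemma ccont_wtau p q f al : contS f -> ccont (fun x => wtau p q f x al).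
Proof. by move=> h; exact: wtau_cont h al. Qed.

(** Bilinear, without conjugation: this is why invariance in [J_wtau] flips the sign of the second
    exponent, and why [chi] carries [- n]. *)
Definition J G F : CC R := \sum_(i < `|c|%N) Int (fun x => G x i%:Z * F x i%:Z).

Lemma J_sym G F : J G F = J F G.
Proof. by apply: eq_bigr => i _; apply: eq_Int => x; rewrite mulrC. Qed.

Lemma decS_mul M K G F : decS M G -> contS F -> bnd K F -> forall al, dec (K * M) (fun x => G x al * F x al).
Proof.
move=> hG cF hF al; have := decM (cF al) (fun x => hF x al) (hG al).
by congr dec; apply/funext => x; rewrite mulrC.
Qed.

Lemma J_le M K G F : decS M G -> contS F -> bnd K F -> cabs (J G F) <= `|c|%N%:R * (8 * (K * M)).
Proof.
move=> hG cF hF; apply: (le_trans (cabs_sum _ _ _)).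
apply: (@le_trans _ _ (\sum_(i < `|c|%N) 8 * (K * M))).
  by apply: ler_sum => i _; apply: Int_le; apply: decS_mul.
by rewrite sumr_const card_ord [leRHS]mulr_natl.
Qed.

Lemma J_D M K K' G F F' : decS M G -> contS F -> bnd K F -> contS F' -> bnd K' F' ->
  J G (fun x al => F x al + F' x al) = J G F + J G F'.
Proof.
move=> hG cF hF cF' hF'; rewrite /J -big_split /=; apply: eq_bigr => i _.
have h1 := decS_mul hG cF hF i%:Z; have h2 := decS_mul hG cF' hF' i%:Z.
by rewrite -(IntD h1 h2); apply: eq_Int => x; rewrite mulrDr.
Qed.

Lemma J_Z M K G F z : decS M G -> contS F -> bnd K F ->
  J G (fun x al => z * F x al) = z * J G F.
Proof.
move=> hG cF hF; rewrite /J mulr_sumr; apply: eq_bigr => i _.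
by rewrite -(IntZ z (decS_mul hG cF hF i%:Z)); apply: eq_Int => x; rewrite mulrCA.
Qed.

Lemma eq_J G G' F F' : (forall x al, G x al = G' x al) -> (forall x al, F x al = F' x al) ->
  J G F = J G' F'.
Proof. by move=> h h'; apply: eq_bigr => i _; apply: eq_Int => x; rewrite h h'. Qed.

Lemma res_sum_shift (h : int -> CC R) (p : int) : (forall al, h (al + c) = h al) ->
  \sum_(i < `|c|%N) h (i%:Z + p) = \sum_(i < `|c|%N) h i%:Z.
Proof.
have step (k : int -> CC R) : (forall al, k (al + c) = k al) ->
    \sum_(i < `|c|%N) k (i%:Z + 1) = \sum_(i < `|c|%N) k i%:Z.
  move=> hk; have E : k `|c|%N%:Z = k 0.
    have [c1|c1] := leP 0 c; first by rewrite gez0_abs // -[c]add0r hk.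
    by rewrite ltz0_abs // -(hk (- c)) addNr.
  move: E; case: (`|c|%N) => [|n] E; first by rewrite !big_ord0.
  rewrite big_ord_recr big_ord_recl /= addrC; congr (_ + _); first by rewrite -E; congr k; lia.
  by apply: eq_bigr => i _; congr k; rewrite /bump /=; lia.
move=> hh; elim/int_rect: p => [|n IH|n IH].
- by apply: eq_bigr => i _; rewrite addr0.
- rewrite -IH -(step (fun al => h (al + n%:Z))); last by move=> al; rewrite addrAC hh.
  by apply: eq_bigr => i _; congr h; lia.
- rewrite -IH -(step (fun al => h (al - n.+1%:Z))); last by move=> al; rewrite addrAC hh.
  by apply: eq_bigr => i _; congr h; lia.
Qed.

(** The two characters cancel pointwise; what is left is translation invariance on the line and on
    the residues mod c. *)
Lemma J_wtau M K G F p q : c_periodic G -> c_periodic F -> decS M G -> contS F -> bnd K F ->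
  J (wtau p q G) (wtau p (- q) F) = J G F.
Proof.
move=> pG pF hG cF hF; set s := zR R p / mu.
have E al : Int (fun x => wtau p q G x al * wtau p (- q) F x al) =
    Int (fun x => G x (al - p) * F x (al - p)).
  have h1 := decS_mul hG cF hF (al - p).
  have [M' hM'] := wtau_dec p q hG.
  have h2 := decS_mul hM' (wtau_cont p (- q) cF) (wtau_bnd p (- q) hF) al.
  have E1 : (fun x => wtau p q G x al * wtau p (- q) F x al) =
     (fun x => (fun x => G x (al - p) * F x (al - p)) (x - s)).
    apply/funext => x; rewrite /wtau zRN mulNr mulrACA [ee _ * ee _]mulrC eeN mul1r.
    by [].
  (* [Int_shift] asks for one decay constant valid before and after the shift, so the two available
     ones are added. *)
  have h2' : dec (`|K * M| + `|K * M'|) (fun x => (fun x => G x (al - p) * F x (al - p)) (x - s)).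
    rewrite -E1; case: h2 => a b; split => // x; apply: (le_trans (b x)).
    by apply: le_trans (ler_norm _) _; rewrite lerDr.
  have h1' : dec (`|K * M| + `|K * M'|) (fun x => G x (al - p) * F x (al - p)).
    case: h1 => a b; split => // x; apply: (le_trans (b x)).
    by apply: le_trans (ler_norm _) _; rewrite lerDl.
  by rewrite E1 (Int_shift h1' h2').
rewrite /J; under eq_bigr do rewrite E.
by apply: (@res_sum_shift (fun al => Int (fun x => G x al * F x al)) (- p)) => al; apply: eq_Int => x; rewrite pG pF.
Qed.

(** Invariance is applied to the right-hand side: on F it produces an operator composed with its
    inverse up to a phase, which is the stated scalar. *)
Lemma J_wtau_adj M M' G F m n : c_periodic G -> c_periodic F -> decS M G -> decS M' F ->
  J (wtau m (- n) G) F = ee (- theta * zR R n * zR R m) * J G (wtau (- m) (- n) F).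
Proof.
move=> pG pF hG hF.
have hF' := wtau_bnd (- m) (- n) (decS_bnd hF).
have cF' := wtau_cont (- m) (- n) (decS_cont hF).
rewrite -(J_wtau m (- n) pG (wtau_periodic (- m) (- n) pF) hG cF' hF') opprK.
have [M2 hM2] := wtau_dec m (- n) hG.
rewrite -(J_Z _ hM2 (wtau_cont m n cF') (wtau_bnd m n hF')).
apply: eq_J => // x al; rewrite wtau_comp mulrA -eeD !addNr wtau00.
by rewrite (_ : _ + _ = 0) ?ee0 ?mul1r // zRN; ring.
Qed.

(** The exponent 4 suffices because (1 + |m| + |n|)^4 dominates (1 + |m|)^2 (1 + |n|)^2. *)
Lemma rapid_dom (a : coeffs R) : rapid a -> exists2 A, 0 <= A & forall m n, cabs (a m n) <= A * (kap R m * kap R n).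
Proof.
move=> /(_ 4)[A hA]; exists A.
  by apply: le_trans (hA 0 0); rewrite mulr_ge0 ?cabs_ge0 // exprn_ge0 // !addr_ge0.
move=> m n; rewrite /kap -invfM ler_pdivlMr; last by rewrite mulr_gt0 // exprn_gt0 // ltr_wpDr.
apply: le_trans (hA m n); rewrite ler_wpM2l ?cabs_ge0 //.
have := normr_ge0 (zR R m); have := normr_ge0 (zR R n).
set u := `|zR R m|; set v := `|zR R n| => v0 u0; rewrite (exprD _ 2 2).
by apply: ler_pM; rewrite ?exprn_ge0 ?addr_ge0 //; apply: lerXn2r; rewrite ?nnegrE ?addr_ge0 //; lra.
Qed.

Lemma dom_act A K (a : coeffs R) f : (forall m n, cabs (a m n) <= A * (kap R m * kap R n)) -> bnd K f ->
  forall x al, dom (A * K) (fun m n => a m n * wtau m n f x al).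
Proof.
move=> hA hf x al m n; rewrite cabsM mulrAC; apply: ler_pM => //; rewrite ?cabs_ge0 //.
exact: wtau_bnd.
Qed.

Lemma act_bnd A K (a : coeffs R) f : (forall m n, cabs (a m n) <= A * (kap R m * kap R n)) -> bnd K f ->
  bnd (9 * (A * K)) (Edc_act theta c d f a).
Proof. by move=> hA hf x al; rewrite Edc_actE; apply: sumZ2_le; apply: dom_act. Qed.

Lemma sqs_cont N (F : int -> int -> SRZ R) : (forall m n, contS (F m n)) ->
  contS (fun x al => sqs N (fun m n => F m n x al)).
Proof. by move=> h al; apply: ccont_sum => i _; apply: ccont_sum => j _; apply: h. Qed.

Lemma J_sum (I : Type) (r : seq I) M (G : SRZ R) (F : I -> SRZ R) (K : I -> R) : decS M G ->
  (forall i, contS (F i)) -> (forall i, bnd (K i) (F i)) ->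
  J G (fun x al => \sum_(i <- r) F i x al) = \sum_(i <- r) J G (F i).
Proof.
move=> hG cF hF; elim: r => [|i r IH].
  rewrite big_nil /J big1 // => i _; rewrite -[RHS](Int0 R); apply: eq_Int => x.
  by rewrite big_nil mulr0.
rewrite big_cons -IH -(J_D hG (cF i) (hF i) (K' := \sum_(i <- r) K i)).
- by apply: eq_J => // x al; rewrite big_cons.
- by move=> al; apply: ccont_sum => j _; exact: cF.
- move=> x al; apply: (le_trans (cabs_sum _ _ _)); apply: ler_sum => j _; exact: hF.
Qed.

Lemma J_sqs N M G (F : int -> int -> SRZ R) (K : int -> int -> R) : decS M G ->
  (forall m n, contS (F m n)) -> (forall m n, bnd (K m n) (F m n)) ->
  J G (fun x al => sqs N (fun m n => F m n x al)) = sqs N (fun m n => J G (F m n)).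
Proof.
move=> hG cF hF; rewrite /sqs /zsum.
rewrite (@J_sum _ _ M G (fun (i : 'I_(N + N).+1) x al =>
   \sum_(j < (N + N).+1) F (i%:Z - N%:Z) (j%:Z - N%:Z) x al)
   (fun i => \sum_(j < (N + N).+1) K (i%:Z - N%:Z) (j%:Z - N%:Z))) //.
- apply: eq_bigr => i _; rewrite (@J_sum _ _ M G (fun (j : 'I_(N + N).+1) => F (i%:Z - N%:Z) (j%:Z - N%:Z))
    (fun j => K (i%:Z - N%:Z) (j%:Z - N%:Z))) //.
- by move=> i al; apply: ccont_sum => j _; apply: cF.
- by move=> i x al; apply: (le_trans (cabs_sum _ _ _)); apply: ler_sum => j _; exact: hF.
Qed.

(** The series for the action converges uniformly in x and al, and the decay of G alone makes J
    continuous for uniform convergence of its second argument. *)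
Lemma J_act M K G f (a : coeffs R) : decS M G -> contS f -> bnd K f -> rapid a ->
  contS (Edc_act theta c d f a) ->
  J G (Edc_act theta c d f a) = sumZ2 (fun p q => a p q * J G (wtau p q f)).
Proof.
move=> hG cf hf ha ca; apply/esym; apply: clim_sumZ2.
have [A A0 hA] := rapid_dom ha.
have M0 : 0 <= M by exact: dec_ge0 (hG 0).
have cF p q : contS (fun x al => a p q * wtau p q f x al).
  by move=> al; apply: ccontZ; apply: ccont_wtau.
have hF p q : bnd (cabs (a p q) * K) (fun x al => a p q * wtau p q f x al).
  by move=> x al; rewrite cabsM ler_wpM2l ?cabs_ge0 //; apply: wtau_bnd.
have E N : sqs N (fun p q => a p q * J G (wtau p q f)) =
    J G (fun x al => sqs N (fun p q => a p q * wtau p q f x al)).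
  rewrite (J_sqs N hG cF hF).
  apply: eq_zsum => p; apply: eq_zsum => q.
  by rewrite (J_Z _ hG (wtau_cont p q cf) (wtau_bnd p q hf)).
pose C := `|c|%N%:R * (8 * (12 * (A * K) * M)).
apply: (to0_le _ (to0_harmonic C)) => N; rewrite E cabsB.
have cS := sqs_cont N cF.
have bS : bnd (9 * (A * K)) (fun x al => sqs N (fun p q => a p q * wtau p q f x al)).
  by move=> x al; apply: sqs_le; apply: dom_act.
have -> : J G (Edc_act theta c d f a) - J G (fun x al => sqs N (fun p q => a p q * wtau p q f x al)) =
   J G (fun x al => Edc_act theta c d f a x al + -1 * sqs N (fun p q => a p q * wtau p q f x al)).
  have cS' : contS (fun x al => -1 * sqs N (fun p q => a p q * wtau p q f x al)).
    by move=> al; apply: ccontZ; exact: cS.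
  have bS' : bnd (9 * (A * K)) (fun x al => -1 * sqs N (fun p q => a p q * wtau p q f x al)).
    by move=> x al; rewrite mulN1r cabsN; exact: bS.
  by rewrite (J_D hG ca (act_bnd hA hf) cS' bS') (J_Z _ hG cS bS) mulN1r.
have cD : contS (fun x al => Edc_act theta c d f a x al + -1 * sqs N (fun p q => a p q * wtau p q f x al)).
  by move=> al; apply: ccontD; [exact: ca|apply: ccontZ; exact: cS].
have bD : bnd (12 * (A * K) / N.+1%:R)
    (fun x al => Edc_act theta c d f a x al + -1 * sqs N (fun p q => a p q * wtau p q f x al)).
  by move=> x al; rewrite mulN1r Edc_actE; apply: sumZ2_tail; apply: dom_act.
apply: (le_trans (J_le hG cD bD)).
by rewrite /C !mulrA le_eqVlt; apply/orP; left; apply/eqP; ring.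
Qed.

End Pairing.

(** * Linearity, decay and Leibniz rule of the pairing *)

Section Coefficients.
Variables (R : realType) (theta : R) (c d : int).
Hypothesis c0 : c != 0.
Hypothesis nu0 : 0 < zR R c * theta + zR R d.
Implicit Types (f g F G : SRZ R) (x y s : R) (al : int).

Let mu : R := zR R c / (zR R c * theta + zR R d).
Local Notation S := (@Edc_P R c).
Local Notation tau_ := (wtau theta c d).

Lemma periodic_modz f x al : c_periodic c f -> f x (al %% c)%Z = f x al.
Proof.
move=> pf; rewrite [in RHS](divz_eq al c) addrC; move: (al %/ c)%Z => k.
elim/int_rect: k => [|n IH|n IH]; first by rewrite mul0r addr0.
- by rewrite -addn1 PoszD mulrDl mul1r addrA pf.
- by rewrite IH -[RHS]pf; congr (f x _); rewrite -addn1 PoszD; ring.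
Qed.

(** Only |c| residues occur, so bounds for each al become one bound; the sum of the absolute values
    serves as an upper bound for the finitely many constants. *)
Lemma periodic_bound (P : R -> (R -> CC R) -> Prop) f : c_periodic c f ->
  (forall M N (h : R -> CC R), M <= N -> P M h -> P N h) ->
  (forall al, exists M, P M (fun x => f x al)) -> exists M, forall al, P M (fun x => f x al).
Proof.
move=> pf mono h.
pose M (n : nat) := xget 0 [set M | P M (fun x => f x n%:Z)].
have hM n : P (M n) (fun x => f x n%:Z).
  by rewrite /M; case: xgetP => [? _ //|]; have [N hN] := h n%:Z; move=> /(_ N).
exists (\sum_(i < `|c|%N) `|M i|) => al.
have E : (fun x => f x al) = (fun x => f x (`|(al %% c)%Z|%N)%:Z).
  by apply/funext => x; rewrite gez0_abs ?modz_ge0 // periodic_modz.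
rewrite E; apply: mono (hM _).
have lt : (`|(al %% c)%Z| < `|c|)%N.
  by have := ltz_mod al c0; rewrite -{1}(gez0_abs (modz_ge0 al c0)) abszE ltz_nat.
rewrite (bigD1 (Ordinal lt)) //=; apply: le_trans (ler_norm _) _.
by rewrite lerDl sumr_ge0.
Qed.

Lemma Edc_per f : S f -> c_periodic c f. Proof. by case. Qed.
Lemma Edc_schwartz f al : S f -> schwartz (fun x => f x al). Proof. by case. Qed.

Lemma Edc_dec f : S f -> exists M, decS M f.
Proof.
move=> [pf sf]; apply: (periodic_bound (P := fun M h => dec M h) pf).
  by move=> M N h MN [ch hh]; split => // x; apply: le_trans (hh x) MN.
by move=> al; apply: schwartz_dec.
Qed.

Lemma Edc_cont f : S f -> contS f.
Proof. by move=> /Edc_dec[M]; apply: decS_cont. Qed.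

Definition mulX f : SRZ R := fun x al => cR x * f x al.
Definition derX f : SRZ R := fun x al => cderiv (fun t => f t al) x.

Lemma Edc_mulX f : S f -> S (mulX f).
Proof.
move=> [pf sf]; split; first by move=> x al; rewrite /mulX pf.
by move=> al; apply: schwartzX.
Qed.

Lemma Edc_derX f : S f -> S (derX f).
Proof.
move=> [pf sf]; split; last by move=> al; apply: schwartz_cderiv.
by move=> x al; rewrite /derX; congr cderiv; apply/funext => t.
Qed.

Lemma Edc_D f g : S f -> S g -> S (f + g).
Proof.
move=> [pf sf] [pg sg]; split; first by move=> x al; rewrite -[LHS]/(f x (al + c) + g x (al + c)) pf pg.
by move=> al; apply: schwartzD.
Qed.

Lemma Edc_Z z f : S f -> S (fun x al => z * f x al).
Proof.
move=> [pf sf]; split; first by move=> x al /=; rewrite pf.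
by move=> al; apply: schwartzZ.
Qed.

Lemma Edc_0 : S 0.
Proof. by split => // al; apply: schwartz0. Qed.

Lemma Edc_sum (I : Type) (r : seq I) (P : pred I) (F : I -> SRZ R) :
  (forall i, P i -> S (F i)) -> S (\sum_(i <- r | P i) F i).
Proof. by move=> h; apply: big_ind => //; [exact: Edc_0|exact: Edc_D]. Qed.

Lemma SRZ_sumE (I : Type) (r : seq I) (P : pred I) (F : I -> SRZ R) x al :
  (\sum_(i <- r | P i) F i) x al = \sum_(i <- r | P i) F i x al.
Proof. by apply: (big_morph (fun f : SRZ R => f x al)). Qed.

(* The A_theta-valued pairing of a window g with f; [f |-> chi g f] is A_theta-linear. *)
Definition chi g f : coeffs R := fun m n => J c (tau_ m (- n) g) f.

Lemma chiDl g g' f : S g -> S g' -> S f -> forall m n, chi (g + g') f m n = chi g f m n + chi g' f m n.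
Proof.
move=> hg hg' hf m n; have [M hM] := Edc_dec hf.
have [K hK] := Edc_dec hg; have [K' hK'] := Edc_dec hg'.
have c1 := wtau_cont theta c d m (- n) (decS_cont hK).
have c2 := wtau_cont theta c d m (- n) (decS_cont hK').
have b1 := wtau_bnd theta c d m (- n) (decS_bnd hK).
have b2 := wtau_bnd theta c d m (- n) (decS_bnd hK').
rewrite /chi J_sym [in RHS]J_sym [X in _ = _ + X]J_sym -(J_D c hM c1 b1 c2 b2).
by apply: eq_J => // x al; rewrite wtauD.
Qed.

Lemma chiZl z g f : S g -> S f -> forall m n, chi (fun x al => z * g x al) f m n = z * chi g f m n.
Proof.
move=> hg hf m n; have [M hM] := Edc_dec hf.
have [K hK] := Edc_dec hg.
have c1 := wtau_cont theta c d m (- n) (decS_cont hK).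
have b1 := wtau_bnd theta c d m (- n) (decS_bnd hK).
rewrite /chi J_sym [in RHS]J_sym -(J_Z c _ hM c1 b1).
by apply: eq_J => // x al; rewrite /wtau mulrCA.
Qed.

Lemma chiDr g f f' : S g -> S f -> S f' -> forall m n, chi g (f + f') m n = chi g f m n + chi g f' m n.
Proof.
move=> hg hf hf' m n; have [K hK] := Edc_dec hg.
have [M hM] := Edc_dec hf; have [M' hM'] := Edc_dec hf'.
have [K' hK'] := wtau_dec theta c d m (- n) hK.
exact: (J_D c hK' (decS_cont hM) (decS_bnd hM) (decS_cont hM') (decS_bnd hM')).
Qed.

Lemma chiZr z g f : S g -> S f -> forall m n, chi g (fun x al => z * f x al) m n = z * chi g f m n.
Proof.
move=> hg hf m n; have [K hK] := Edc_dec hg; have [M hM] := Edc_dec hf.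
have [K' hK'] := wtau_dec theta c d m (- n) hK.
exact: (J_Z c _ hK' (decS_cont hM) (decS_bnd hM)).
Qed.

(** Split x as m/mu + (x - m/mu): the second part is the coordinate of the translated window. A
    factor m is thus traded for a multiplication by x on one argument. *)
Lemma chi_mulX g f m n : S g -> S f ->
  cR (zR R m / mu) * chi g f m n = chi g (mulX f) m n - chi (mulX g) f m n.
Proof.
move=> hg hf; have [M hM] := Edc_dec hf; have [K hK] := Edc_dec hg.
have [KX hKX] := Edc_dec (Edc_mulX hg).
have c1 := wtau_cont theta c d m (- n) (decS_cont hK).
have b1 := wtau_bnd theta c d m (- n) (decS_bnd hK).
have c2 := wtau_cont theta c d m (- n) (decS_cont hKX).
have b2 := wtau_bnd theta c d m (- n) (decS_bnd hKX).
have c3 : contS (fun x al => cR (zR R m / mu) * tau_ m (- n) g x al).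
  by move=> al; apply: ccontZ; apply: c1.
have b3 : bnd (cabs (cR (zR R m / mu)) * K) (fun x al => cR (zR R m / mu) * tau_ m (- n) g x al).
  by move=> x al; rewrite cabsM ler_wpM2l ?cabs_ge0.
apply/eqP; rewrite eq_sym subr_eq; apply/eqP.
rewrite /chi ![J _ _ f]J_sym -(J_Z c _ hM c1 b1) -(J_D c hM c3 b3 c2 b2).
rewrite J_sym [RHS]J_sym.
apply: eq_bigr => i _; apply: eq_Int => x.
rewrite /mulX /wtau -/mu.
have -> : cR x = cR (zR R m / mu) + cR (x - zR R m / mu) by rewrite -cR_additive addrC subrK.
ring.
Qed.

Lemma cder_wtau p q g g' x al : (forall x al, cder (fun t => g t al) x (g' x al)) ->
  cder (fun t => tau_ p q g t al) x (twopii R * zC R q * tau_ p q g x al + tau_ p q g' x al).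
Proof.
move=> hg; rewrite /wtau.
have h1 := cder_shift (hg (x - zR R p / mu) (al - p)).
have h2 := cder_ee (zR R q) (- (zR R q * (zR R al * zR R d / zR R c))) x.
have E t : zR R q * t + - (zR R q * (zR R al * zR R d / zR R c)) = zR R q * phase c d t al.
  by rewrite /phase; ring.
have {}h2 : cder (fun t => ee (zR R q * phase c d t al)) x (twopii R * zC R q * ee (zR R q * phase c d x al)).
  by rewrite zC_cR -E; apply: cder_ext h2 => t; rewrite E.
by have := cderM h2 h1; rewrite -mulrA.
Qed.

Lemma cder_derX g x al : S g -> cder (fun t => g t al) x (derX g x al).
Proof. by case=> _ sg; apply: schwartz_cder. Qed.

(** Integration by parts; the derivative of the character in the window, of frequency -n, produces
    the factor n. *)
Lemma chi_derX g f m n : S g -> S f ->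
  twopii R * zC R n * chi g f m n = chi (derX g) f m n + chi g (derX f) m n.
Proof.
move=> hg hf; have [M hM] := Edc_dec hf; have [K hK] := Edc_dec hg.
have [KX hKX] := Edc_dec (Edc_derX hg); have [MX hMX] := Edc_dec (Edc_derX hf).
rewrite /chi /J mulr_sumr -big_split /=; apply: eq_bigr => i _.
have D1 al := decS_mul hM (wtau_cont theta c d m (- n) (decS_cont hK)) (wtau_bnd theta c d m (- n) (decS_bnd hK)) al.
have D2 al := decS_mul hM (wtau_cont theta c d m (- n) (decS_cont hKX)) (wtau_bnd theta c d m (- n) (decS_bnd hKX)) al.
have D3 al := decS_mul hMX (wtau_cont theta c d m (- n) (decS_cont hK)) (wtau_bnd theta c d m (- n) (decS_bnd hK)) al.
have E1 G F al : Int (fun x => G x al * F x al) = Int (fun x => F x al * G x al).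
  by apply: eq_Int => x; rewrite mulrC.
rewrite !(E1 (tau_ _ _ _)) -(IntD (D2 i%:Z) (D3 i%:Z)) -(IntZ _ (D1 i%:Z)).
apply/eqP; rewrite -subr_eq0 -[X in _ + X]mulN1r; apply/eqP.
have D4 := decD (D2 i%:Z) (D3 i%:Z).
have D5 := decZ (twopii R * zC R n) (D1 i%:Z).
rewrite -(IntZ _ D4) -(IntD D5 (decZ (- 1) D4)).
have D6 := decD D5 (decZ (- 1) D4).
have D7 := decZ (- 1) D6.
have : Int (fun x => - 1 * (twopii R * zC R n * (f x i%:Z * tau_ m (- n) g x i%:Z) +
     -1 * (f x i%:Z * tau_ m (- n) (derX g) x i%:Z + derX f x i%:Z * tau_ m (- n) g x i%:Z))) = 0.
  apply: (@Int_derive _ _ (K * M) (fun x => f x i%:Z * tau_ m (- n) g x i%:Z) _ D7).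
    move=> x; have := cderM (schwartz_cder x (Edc_schwartz (al := i%:Z) hf)) (cder_wtau m (- n) x i%:Z (fun x al => cder_derX x al hg)).
    rewrite -/(derX f x i%:Z) /zC mulrNz => h; move: h; congr cder; ring.
  by case: (D1 i%:Z).
by rewrite (IntZ _ D6) mulN1r => /eqP; rewrite oppr_eq0 => /eqP.
Qed.

Lemma chi_bound g f : S g -> S f -> exists M, forall m n, cabs (chi g f m n) <= M.
Proof.
move=> hg hf; have [M hM] := Edc_dec hf; have [K hK] := Edc_dec hg.
exists (`|c|%N%:R * (8 * (K * M))) => m n; rewrite /chi J_sym.
by apply: J_le => //; [exact: wtau_cont (decS_cont hK)|exact: wtau_bnd (decS_bnd hK)].
Qed.

(** Each further power of the weight is paid for by one [mulX] or [derX] on one of the arguments, so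
    the induction on the power ranges over all pairs of Schwartz functions. *)
Lemma chi_rapid g f : S g -> S f -> rapid (chi g f).
Proof.
move=> + + k; elim: k g f => [|k IH] g f hg hf.
  by have [M hM] := chi_bound hg hf; exists M => m n; rewrite expr0 mulr1.
have [M0 h0] := IH _ _ hg hf.
have [M1 h1] := IH _ _ hg (Edc_mulX hf).
have [M2 h2] := IH _ _ (Edc_mulX hg) hf.
have [M3 h3] := IH _ _ (Edc_derX hg) hf.
have [M4 h4] := IH _ _ hg (Edc_derX hf).
exists (M0 + `|mu| * (M1 + M2) + (2 * pi)^-1 * (M3 + M4)) => m n.
have mu0 : mu != 0 := slope_neq0 c0 nu0.
have pi0 : 0 < 2 * pi :> R by rewrite mulr_gt0 ?pi_gt0.
have e1 : cabs (chi g f m n) * `|zR R m| = `|mu| * cabs (cR (zR R m / mu) * chi g f m n).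
  rewrite cabsM cabs_cR; move: mu0; move: (mu) => m0 m00; rewrite normrM normfV.
  by field; rewrite normr_eq0.
have e2 : cabs (chi g f m n) * `|zR R n| = (2 * pi)^-1 * cabs (twopii R * zC R n * chi g f m n).
  rewrite !cabsM zC_cR cabs_cR.
  have -> : cabs (twopii R) = 2 * pi.
    by rewrite /cabs /= expr0n add0r sqrtr_sqr ger0_norm // ltW.
  by move: (lt0r_neq0 pi0); move: (2 * pi) => P P0; field.
have W0 : 0 <= (1 + `|zR R m| + `|zR R n|) ^+ k by rewrite exprn_ge0 // !addr_ge0.
have -> : cabs (chi g f m n) * (1 + `|zR R m| + `|zR R n|) ^+ k.+1 =
    cabs (chi g f m n) * (1 + `|zR R m| + `|zR R n|) ^+ k +
    cabs (chi g f m n) * `|zR R m| * (1 + `|zR R m| + `|zR R n|) ^+ k +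
    cabs (chi g f m n) * `|zR R n| * (1 + `|zR R m| + `|zR R n|) ^+ k by rewrite exprS; ring.
rewrite e1 e2 chi_mulX // chi_derX //.
have t1 := cabsD (chi g (mulX f) m n) (- chi (mulX g) f m n); rewrite cabsN in t1.
have t2 := cabsD (chi (derX g) f m n) (chi g (derX f) m n).
apply: lerD; first apply: lerD; first exact: h0.
- rewrite -mulrA ler_wpM2l //; apply: le_trans (lerD (h1 m n) (h2 m n)).
  by rewrite -mulrDl ler_wpM2r.
- rewrite -mulrA ler_wpM2l ?invr_ge0 ?(ltW pi0) //; apply: le_trans (lerD (h3 m n) (h4 m n)).
  by rewrite -mulrDl ler_wpM2r.
Qed.

Lemma dom_rapidM (a b : coeffs R) (K : R) : rapid a -> (forall m n, cabs (b m n) <= K) ->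
  exists M, dom M (fun m n => a m n * b m n).
Proof.
move=> /rapid_dom[A A0 hA] hb; exists (A * K) => m n.
by rewrite cabsM mulrAC; apply: ler_pM; rewrite ?cabs_ge0.
Qed.

(** After expanding the action, [J_wtau] moves each U1^p U2^q from f to the window. The phase in the
    factorisation of the window operator through (p, -q) is exactly the cocycle of [amul]. *)
Lemma chi_act g f (a : coeffs R) : S g -> S f -> rapid a -> S (Edc_act theta c d f a) ->
  chi g (Edc_act theta c d f a) = amul theta (chi g f) a.
Proof.
move=> hg hf ha hfa; apply/funext => m; apply/funext => n.
have [M hM] := Edc_dec hf; have [K hK] := Edc_dec hg.
have [K' hK'] := wtau_dec theta c d m (- n) hK.
rewrite /chi (J_act hK' (decS_cont hM) (decS_bnd hM) ha (Edc_cont hfa)) /amul.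
have [A A0 hA] := rapid_dom ha.
have kap1 j : kap R j <= 1.
  by rewrite /kap invf_le1 ?exprn_gt0 ?ltr_wpDr // exprn_ege1 // lerDl.
have hB k l : cabs (a (m - k) (n - l) * ee (- theta * zR R l * zR R (m - k))) <= A.
  rewrite cabsM cabs_ee mulr1; apply: le_trans (hA _ _) _.
  rewrite -[leRHS]mulr1 ler_wpM2l // -[leRHS]mulr1; apply: ler_pM; rewrite ?kap_ge0 //.
have [D hD] : exists D, dom D (fun k l => chi g f k l * a (m - k) (n - l) * ee (- theta * zR R l * zR R (m - k))).
  have [M2 h2] := dom_rapidM (chi_rapid hg hf) hB.
  by exists M2 => k l; rewrite -mulrA; apply: h2.
rewrite -(sumZ2_reindex m n hD); apply: eq_sumZ2 => p q.
rewrite !subKr [RHS]mulrAC [RHS]mulrC; congr (a p q * _).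
have ft : forall x al, tau_ m (- n) g x al = ee (- theta * zR R (n - q) * zR R p) * tau_ p (- q) (tau_ (m - p) (- (n - q)) g) x al.
  move=> x al; rewrite (wtau_comp c0 nu0) mulrA -eeD.
  rewrite (_ : _ + _ = 0); last by rewrite zRN; ring.
  by rewrite ee0 mul1r subrK (_ : - (n - q) - q = - n) //; ring.
have [K2 hK2] := wtau_dec theta c d (m - p) (- (n - q)) hK.
have [K3 hK3] := wtau_dec theta c d p q hM.
have cg := wtau_cont theta c d p (- q) (decS_cont hK2).
have bg := wtau_bnd theta c d p (- q) (decS_bnd hK2).
rewrite (eq_J c ft (fun x al => erefl)) J_sym (J_Z c _ hK3 cg bg) J_sym mulrC; congr (_ * _).
have pg := wtau_periodic theta d c0 (m - p) (- (n - q)) (Edc_per hg).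
have := @J_wtau R theta c d c0 nu0 _ _ _ _ p (- q) pg (Edc_per hf) hK2 (decS_cont hM) (decS_bnd hM).
by rewrite opprK.
Qed.

(* [b |-> lcoef b] turns left multiplication of [chi g] by b into the right action on g:
   see [chi_left]. *)
Definition lcoef (b : coeffs R) : coeffs R := fun m n => b (- m) n * ee (- theta * zR R m * zR R n).

Lemma rapid_lcoef b : rapid b -> rapid (lcoef b).
Proof.
move=> h k; have [M hM] := h k; exists M => m n.
by rewrite /lcoef cabsM cabs_ee mulr1; have := hM (- m) n; rewrite zRN normrN.
Qed.

Lemma sumZ2_oppl (f : int -> int -> CC R) : sumZ2 (fun k l => f (- k) l) = sumZ2 f.
Proof.
rewrite !sumZ2E; congr (lim (_ @ \oo)); apply/funext => N; rewrite /sqs.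
by rewrite -[RHS]zsum_opp.
Qed.

(** Moving the window operator to f by [J_wtau_adj] frees the action on g, which can then be
    expanded in p and q. The twist and the reflected first index of [lcoef] are what makes the
    phases agree with [amul] after p is replaced by -p. *)
Lemma chi_left g f (b : coeffs R) : S g -> S f -> rapid b -> S (Edc_act theta c d g (lcoef b)) ->
  amul theta b (chi g f) = chi (Edc_act theta c d g (lcoef b)) f.
Proof.
move=> hg hf hb hbg; apply/funext => m; apply/funext => n.
have [M hM] := Edc_dec hf; have [K hK] := Edc_dec hg; have [L hL] := Edc_dec hbg.
have [M' hM'] := wtau_dec theta c d (- m) (- n) hM.
rewrite [in RHS]/chi (J_wtau_adj c0 nu0 m n (Edc_per hbg) (Edc_per hf) hL hM) J_sym.
rewrite (J_act hM' (decS_cont hK) (decS_bnd hK) (rapid_lcoef hb) (Edc_cont hbg)).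
have [D hD] : exists D, dom D (fun p q => lcoef b p q * J c (tau_ (- m) (- n) f) (tau_ p q g)).
  apply: (@dom_rapidM _ _ (`|c|%N%:R * (8 * (K * M'))) (rapid_lcoef hb)) => p q.
  by apply: J_le => //; [exact: wtau_cont (decS_cont hK)|exact: wtau_bnd (decS_bnd hK)].
rewrite -(sumZ2Z _ hD) /amul -sumZ2_oppl; apply: eq_sumZ2 => p q.
rewrite mulrCA J_sym.
have [K2 hK2] := wtau_dec theta c d p q hK.
rewrite -(J_wtau_adj c0 nu0 m n (wtau_periodic theta d c0 p q (Edc_per hg)) (Edc_per hf) hK2 hM).
have ft x al : tau_ m (- n) (tau_ p q g) x al = ee (- theta * zR R q * zR R m) * tau_ (m + p) (- (n - q)) g x al.
  by rewrite (wtau_comp c0 nu0) opprB [p + m]addrC.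
have cg := wtau_cont theta c d (m + p) (- (n - q)) (decS_cont hK).
have bg := wtau_bnd theta c d (m + p) (- (n - q)) (decS_bnd hK).
rewrite (eq_J c ft (fun x al => erefl)) J_sym (J_Z c _ hM cg bg) J_sym /lcoef opprK.
rewrite -!mulrA; congr (b (- p) q * _); rewrite [LHS]mulrC [RHS]mulrA -eeD; congr (_ * _).
by congr ee; rewrite zRD; ring.
Qed.

(** The Leibniz rule of the pairing: it defines the transposed connection on windows. The derivative
    keeps its sign and the drift changes its own, which gives the operator of the equation for w. *)
Lemma chi_delta tau z g f : S g -> S f -> forall m n,
  delta tau (chi g f) m n - chi g (Edc_nab theta tau c d z f) m n =
  chi (fun x al => derX g x al - twopii R * (tau * cR (mu * x) + z) * g x al) f m n.
Proof.
move=> hg hf m n.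
have mu0 : mu != 0 := slope_neq0 c0 nu0.
have hXf := Edc_mulX hf; have hXg := Edc_mulX hg.
have hDf := Edc_derX hf; have hDg := Edc_derX hg.
set k := twopii R * tau * cR mu.
have E1 : Edc_nab theta tau c d z f = derX f + ((fun x al => k * mulX f x al) + (fun x al => twopii R * z * f x al)).
  apply/funext => x; apply/funext => al; rewrite -[RHS]/(derX f x al + (k * mulX f x al + twopii R * z * f x al)).
  by rewrite /Edc_nab -/mu /k /mulX /derX cRM; ring.
have E2 : (fun x al => derX g x al - twopii R * (tau * cR (mu * x) + z) * g x al) =
   derX g + ((fun x al => - k * mulX g x al) + (fun x al => - (twopii R * z) * g x al)).
  apply/funext => x; apply/funext => al.
  rewrite -[RHS]/(derX g x al + (- k * mulX g x al + - (twopii R * z) * g x al)).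
  by rewrite /k /mulX cRM; ring.
have s1 := Edc_Z k hXf; have s2 := Edc_Z (twopii R * z) hf.
have s3 := Edc_Z (- k) hXg; have s4 := Edc_Z (- (twopii R * z)) hg.
rewrite E1 E2 chiDr //; last exact: Edc_D.
rewrite chiDr // !chiZr // chiDl //; last exact: Edc_D.
rewrite chiDl // !chiZl // /delta.
have F1 := chi_mulX m n hg hf; have F2 := chi_derX m n hg hf.
have -> : twopii R * (zC R m * tau + zC R n) * chi g f m n =
   k * (cR (zR R m / mu) * chi g f m n) + twopii R * zC R n * chi g f m n.
  rewrite /k zC_cR.
  have : zR R m = mu * (zR R m / mu) by rewrite mulrC mulfVK.
  by move: (zR R m / mu) => u ->; rewrite cRM; ring.
rewrite F1 F2; ring.
Qed.

End Coefficients.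

(** * Frames of E_{d,c} *)

Section Frame.
Variables (R : realType) (theta : R) (c d : int).
Hypothesis cn : c < 0.
Hypothesis cop : coprimez c d.
Hypothesis nu0 : 0 < zR R c * theta + zR R d.

Let mu : R := zR R c / (zR R c * theta + zR R d).
Local Notation S := (@Edc_P R c).

Lemma c_neq0 : c != 0. Proof. by rewrite lt_eqF. Qed.

Lemma zRc_le : zR R c <= -1.
Proof. by rewrite -[-1]/(zR R (-1)) ler_int; lia. Qed.

Lemma slope_lt0 : mu < 0.
Proof. by rewrite /mu pmulr_llt0 ?invr_gt0 //; have := zRc_le; lra. Qed.

Lemma zsum_telescope (A : int -> R) N :
  zsum N (fun m => A m - A (m - 1)) = A N%:Z - A (- N.+1%:Z).
Proof.
elim: N => [|N IH]; first by rewrite zsum0 sub0r.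
rewrite zsumS IH.
have -> : N.+1%:Z - 1 = N%:Z by lia.
have -> : - N.+1%:Z - 1 = - N.+2%:Z by lia.
by ring.
Qed.

Lemma zsum_stable (V : nmodType) (A : int -> V) M N : (M <= N)%N ->
  (forall m, (M < `|m|)%N -> A m = 0) -> zsum N A = zsum M A.
Proof.
move=> MN h; rewrite -(subnKC MN); elim: (N - M)%N => [|p IH]; first by rewrite addn0.
by rewrite addnS zsumS IH !h ?addr0 //; lia.
Qed.

(** The support of k fits into one period, so integrals over the line are Fourier coefficients. The
    evaluation point x0 + s may lie off the support, in which case the series sums to 0; this is
    used to separate residues. *)
Lemma fourier_inversion (k k' : R -> CC R) M (x0 s h : R) :
  (forall x, cder k x (k' x)) -> dec M k -> 0 < h -> - 1 + 3 * h < s -> s <= 0 -> 6 * h <= 1 ->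
  (forall x, 3 * h <= `|x - x0| -> k x = 0) ->
  clim (fun N => zsum N (fun n => Int (fun x => ee (- zR R n * (x - (x0 + s))) * k x))) (k (x0 + s)).
Proof.
move=> hk dk h0 sm s0 h6 ksupp.
pose y := x0 + s.
(* In coordinates centred at x0 + s the support ends at -s + 3h. The period is made to end there
   too; the bounds on s keep 0 strictly inside it, and 6h <= 1 keeps the whole support in it. *)
pose u := - s + 3 * h - 1.
have hkap x : cder (fun t => k (t - (- y))) x (k' (x - (- y))) by apply: cder_shift.
have um1 : -1 < u by rewrite /u; lra.
have u0 : u < 0 by rewrite /u; lra.
have := fourier_inversion0 hkap um1 u0.
rewrite (_ : 0 - - y = y); last by rewrite sub0r opprK.
rewrite -/y; congr clim.
apply/funext => N; apply: eq_zsum => n.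
pose F t := ee (- zR R n * t) * k (t - (- y)).
have wy : exists M', dec M' (fun t => k (t - (- y))).
  exists (2 * (1 + y ^+ 2) * M); split; first by apply: ccont_shift; case: dk.
  move=> x; have [_ /(_ (x - - y)) H] := dk.
  have s1 : 0 <= 2 * (1 + y ^+ 2) by rewrite mulr_ge0 // ltW // w_gt0.
  apply: le_trans (ler_wpM2l s1 H); rewrite mulrCA ler_wpM2l ?cabs_ge0 //.
  rewrite -subr_ge0 (_ : _ - _ = 1 + (x - - y * 2) ^+ 2 + 2 * (y * (x - - y)) ^+ 2); last by ring.
  by rewrite !addr_ge0 ?sqr_ge0 // mulr_ge0 ?sqr_ge0.
have [M' dM'] := wy.
have dF : dec (1 * M') F.
  by apply: decM => //; [exact: ccont_eeZ|move=> x; rewrite cabs_ee].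
have dG : dec (1 * M) (fun x => ee (- zR R n * (x - y)) * k x).
  apply: decM => //; last by move=> x; rewrite cabs_ee.
  exact: (ccont_shift y (ccont_eeZ (- zR R n))).
have E1 : Int F = pint u F.
  apply: (Int_support dF); first by rewrite lerDl.
  - move=> x xu; rewrite /F ksupp ?mulr0 // ler_normr; apply/orP; right.
    rewrite /u in xu; rewrite /y; lra.
  - move=> x xu; rewrite /F ksupp ?mulr0 // ler_normr; apply/orP; left.
    rewrite /u in xu; rewrite /y; lra.
rewrite -[LHS]E1.
pose D := `|1 * M| + `|1 * M'|.
have dF' : dec D F.
  by case: dF => a b; split => // x; apply: (le_trans (b x)); apply: (le_trans (ler_norm _)); rewrite lerDr.
have EF : (fun x => ee (- zR R n * (x - y)) * k x) = (fun x => F (x - y)).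
  by apply/funext => x; rewrite /F opprK subrK.
have dF2 : dec D (fun x => F (x - y)).
  rewrite -EF; case: dG => a b; split => // x; apply: (le_trans (b x)); apply: (le_trans (ler_norm _)).
  by rewrite lerDl.
by rewrite EF (Int_shift dF' dF2).
Qed.

Section Windows.
Variables (sg : R -> R) (K : nat) (h : R).
Hypothesis sgl : forall x, x <= 0 -> sg x = 0.
Hypothesis sgr : forall x, 1 <= x -> sg x = 1.
Hypothesis sgS : forall s t t', 0 < s -> schwartz (fun x => cR (sg (s * x + t) - sg (s * x + t'))).
Hypothesis h0 : 0 < h.
Hypothesis hc : 6 * h <= - (zR R c)^-1.
Hypothesis hK : K%:R * h = - mu^-1.

(** Translates of [rho] by multiples of h telescope to 1. The wider [win] equals 1 on the support of
    [rho], so multiplying by it loses nothing: one factor analyses, the other synthesises. *)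
Let rho (x : R) : R := sg (h^-1 * x) - sg (h^-1 * x - 1).
Let win (x : R) : R := sg (h^-1 * x + 1) - sg (h^-1 * x - 2).

Definition synth (i : nat) : SRZ R := fun x _ => cR (win (x - i%:R * h)).
Definition anal (i : nat) : SRZ R := fun x _ => cR (rho (x - i%:R * h)).

Lemma schwartz_win (t t' : R) (i : nat) :
  schwartz (fun x => cR (sg (h^-1 * (x - i%:R * h) + t) - sg (h^-1 * (x - i%:R * h) + t'))).
Proof.
have hV : 0 < h^-1 by rewrite invr_gt0.
have := @sgS _ (t - i%:R) (t' - i%:R) hV; congr schwartz.
apply/funext => x; rewrite (_ : h^-1 * (x - i%:R * h) = h^-1 * x - i%:R); last by field; exact: lt0r_neq0.
by congr (cR (sg _ - sg _)); ring.
Qed.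

Lemma Edc_synth i : S (synth i).
Proof. by split => // al; exact: (@schwartz_win 1 (- 2) i). Qed.

Lemma Edc_anal i : S (anal i).
Proof.
split => // al; have := @schwartz_win 0 (- 1) i; congr schwartz.
by apply/funext => x; rewrite /anal /rho addr0.
Qed.

Lemma rho_supp x : rho x != 0 -> 0 < x < 2 * h.
Proof.
have E1 : (0 < x) = (0 < h^-1 * x) by rewrite pmulr_rgt0 ?invr_gt0.
have E2 : (x < 2 * h) = (h^-1 * x < 2) by rewrite [h^-1 * x]mulrC ltr_pdivrMr.
rewrite E1 E2 => r0; apply: contraNT r0; rewrite negb_and -!leNgt => /orP[] a; rewrite /rho.
  by rewrite !sgl ?subrr //; lra.
by rewrite !sgr ?subrr //; lra.
Qed.

Lemma win_supp x : win x != 0 -> - h <= x <= 3 * h.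
Proof.
have E1 : (- h <= x) = (- 1 <= h^-1 * x) by rewrite mulrC ler_pdivlMr // mulN1r.
have E2 : (x <= 3 * h) = (h^-1 * x <= 3) by rewrite [h^-1 * x]mulrC ler_pdivrMr.
rewrite E1 E2 => r0; apply: contraNT r0; rewrite negb_and -!ltNge => /orP[] a; rewrite /win.
  by rewrite !sgl ?subrr //; lra.
by rewrite !sgr ?subrr //; lra.
Qed.

Lemma win_rho x : win x * rho x = rho x.
Proof.
have [->|/rho_supp] := eqVneq (rho x) 0; first by rewrite mulr0.
move=> /andP[a b].
have {}a : 0 < h^-1 * x by rewrite mulr_gt0 ?invr_gt0.
have {}b : h^-1 * x < 2 by rewrite mulrC ltr_pdivrMr.
have -> : win x = 1 by rewrite /win sgr ?sgl ?subr0 //; lra.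
by rewrite mul1r.
Qed.

Lemma residue_dvd (al al0 : int) : (((al - al0) * d) %% c)%Z = 0 -> (c %| al - al0)%Z.
Proof. by move=> /dvdz_mod0P; rewrite Gauss_dvdzl. Qed.

(** The sum over n is a Fourier series on |c| copies of the line, and evaluates copy al at x0 +
    s(al) with s(al) in (-1, 0] a multiple of 1/c. As d is invertible mod c, only al congruent to
    al0 has s = 0. Every other point lies at least 1/|c| >= 6h to the left of x0, outside the
    support of the window, so the aliases vanish. *)
Lemma synth_chi_term (f : SRZ R) (i : nat) (m : int) (x0 : R) (al0 : int) : S f ->
  win (x0 - zR R m / mu - i%:R * h) != 0 ->
  clim (fun N => zsum N (fun n => chi theta c d (anal i) f m n * ee (zR R n * phase c d x0 al0)))
    (cR (rho (x0 - zR R m / mu - i%:R * h)) * f x0 al0).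
Proof.
move=> hf /win_supp /andP[w1 w2].
have c0 := c_neq0; have zc := zRc_le.
have zcV : (zR R c)^-1 < 0 by rewrite invr_lt0; lra.
have zcV1 : -1 <= (zR R c)^-1.
  by have := ler_wnM2l (ltW zcV) zc; rewrite mulVf ?zRc0 // mulrN1; lra.
pose k (al : int) (x : R) : CC R := cR (rho (x - zR R m / mu - i%:R * h)) * f x al.
(* The remainder lies in [0, |c|) and c is negative, hence the values in (-1, 0]. *)
pose s (al : int) : R := zR R (((al - al0) * d) %% c)%Z / zR R c.
have sal al : - 1 - (zR R c)^-1 <= s al /\ s al <= 0.
  have r0 := modz_ge0 ((al - al0) * d) c0; have r1 := ltz_mod ((al - al0) * d) c0.
  have r0' : (0 : R) <= zR R (((al - al0) * d) %% c)%Z by rewrite ler0z.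
  have r1' : zR R (((al - al0) * d) %% c)%Z <= - zR R c - 1.
    rewrite -zRN -[1]/(zR R 1) -zRB ler_int; move: r1; rewrite ltr0_norm //; lia.
  rewrite /s; split; last by rewrite mulr_ge0_le0 // ltW.
  have := ler_wnM2r (ltW zcV) r1'; rewrite mulrBl mulNr mulfV ?zRc0 // mul1r; lra.
have kal al : clim (fun N => zsum N (fun n => Int (fun x => ee (- zR R n * (x - (x0 + s al))) * k al x))) (k al (x0 + s al)).
  have sk : schwartz (fun x => f x al) by case: hf.
  have [_ sa] := Edc_anal i; have {}sa := sa 0.
  have hk x : cder (k al) x (cderiv (fun x => anal i x 0) (x - zR R m / mu) * f x al + cR (rho (x - zR R m / mu - i%:R * h)) * cderiv (fun x => f x al) x).
    apply: (@cderM _ (fun x => anal i (x - zR R m / mu) 0) (fun x => f x al)); last exact: schwartz_cder.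
    by apply: (cder_shift (f := fun x => anal i x 0)); apply: schwartz_cder.
  have [M dM] := schwartz_dec sk; have [M1 dM1] := schwartz_dec sa.
  have dk : dec (M1 * M) (k al).
    apply: (@decM _ _ _ (fun x => anal i (x - zR R m / mu) 0)) => //.
      by apply: (ccont_shift (f := fun x => anal i x 0)); case: dM1.
    by move=> x; apply: (dec_bound (f := fun x => anal i x 0)).
  have [sl sr] := sal al.
  have s1 : - 1 + 3 * h < s al.
    by move: sl hc h0; move: ((zR R c)^-1) (s al) => e b; lra.
  have h1 : 6 * h <= 1 by move: hc zcV1; move: ((zR R c)^-1) => e; lra.
  apply: (fourier_inversion hk dk h0) => //.
  move=> x; rewrite /k => xx; have [->|/rho_supp/andP[a b]] := eqVneq (rho (x - zR R m / mu - i%:R * h)) 0.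
    by rewrite mul0r.
  exfalso; move: xx; have [xa|xa] := leP x0 x.
    by rewrite ger0_norm ?subr_ge0 //; lra.
  by rewrite ltr0_norm ?subr_lt0 //; lra.
have lim0 : clim (fun N => \sum_(al < `|c|%N) zsum N (fun n => Int (fun x => ee (- zR R n * (x - (x0 + s al%:Z))) * k al%:Z x)))
   (\sum_(al < `|c|%N) k al%:Z (x0 + s al%:Z)).
  by apply: clim_sum => al; apply: kal.
have -> : cR (rho (x0 - zR R m / mu - i%:R * h)) * f x0 al0 = \sum_(al < `|c|%N) k al%:Z (x0 + s al%:Z).
  have lt : (`|(al0 %% c)%Z| < `|c|)%N.
    by have := ltz_mod al0 c0; rewrite -{1}(gez0_abs (modz_ge0 al0 c0)) abszE ltz_nat.
  rewrite (bigD1 (Ordinal lt)) //= [X in _ = _ + X]big1 ?addr0; last first.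
    move=> al ne; rewrite /k.
    have r : (((al%:Z - al0) * d) %% c)%Z != 0.
      apply: contra ne => /eqP/residue_dvd; rewrite -eqz_mod_dvd => /eqP E.
      apply/eqP/val_inj => /=; rewrite -E -modz_abs modz_small //.
      by rewrite /= abszE ltz_nat.
    have r1 : (1 : R) <= zR R ((al%:Z - al0) * d %% c)%Z.
      have := modz_ge0 ((al%:Z - al0) * d) c0; rewrite -[1]/(zR R 1) ler_int => r2.
      by move: r r2; move: (modz _ _) => t; lia.
    have s1 : s al%:Z <= (zR R c)^-1.
      by rewrite /s; have := ler_wnM2r (ltW zcV) r1; rewrite mul1r.
    rewrite (_ : rho _ = 0) ?mul0r //; apply/eqP; apply: contraT => /rho_supp /andP[a b].
    exfalso; move: s1 hc a w2 h0; move: (zR R m / mu) (i%:R * h) (s al%:Z) ((zR R c)^-1) => p q r' e.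
    lra.
  rewrite gez0_abs ?modz_ge0 // /k.
  have -> : s (al0 %% c)%Z = 0.
    rewrite /s (_ : (((al0 %% c)%Z - al0) * d %% c)%Z = 0) ?/zR ?mul0r //.
    apply/dvdz_mod0P; apply: dvdz_mulr; rewrite -eqz_mod_dvd; by rewrite modz_mod.
  by rewrite addr0 (periodic_modz _ _ (Edc_per hf)).
move: lim0; congr clim; apply/funext => N; rewrite /zsum exchange_big /=.
apply: eq_bigr => n _; rewrite /chi /J mulr_suml; apply: eq_bigr => al _.
set nn := (n%:Z - N%:Z).
have [sp sa] := Edc_anal i.
have [M1 dM1] := Edc_dec c0 (Edc_anal i); have [M dM] := Edc_dec c0 hf.
have D := decS_mul dM (wtau_cont theta c d m (- nn) (decS_cont dM1)) (wtau_bnd theta c d m (- nn) (decS_bnd dM1)) al%:Z.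
rewrite mulrC -(_ : Int (fun x => f x al%:Z * wtau theta c d m (- nn) (anal i) x al%:Z) = Int (fun x => wtau theta c d m (- nn) (anal i) x al%:Z * f x al%:Z)); last first.
  by apply: eq_Int => x; rewrite mulrC.
rewrite -(IntZ _ D); apply: eq_Int => x; rewrite /k /wtau -/mu /anal zRN.
(* The phases differ from the Fourier exponent by nn times the integer quotient, an integer on which
   [ee] is 1. *)
have E : zR R nn * phase c d x0 al0 + - zR R nn * phase c d x al%:Z =
   - zR R nn * (x - (x0 + s al%:Z)) + zR R (nn * ((al%:Z - al0) * d %/ c)%Z).
  have /(congr1 (zR R)) := divz_eq ((al%:Z - al0) * d) c.
  rewrite zRD !zRM zRB -/(zR R (modz _ _)) => E.
  rewrite /s /phase; set q := zR R (_ %/ _)%Z in E *; set r := zR R (_ %% _)%Z in E *.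
  have -> : r = (zR R al%:Z - zR R al0) * zR R d - q * zR R c by rewrite E; ring.
  by field; exact: zRc0.
have -> : ee (- zR R nn * (x - (x0 + s al%:Z))) = ee (zR R nn * phase c d x0 al0) * ee (- zR R nn * phase c d x al%:Z).
  by rewrite -eeD E eeD ee_int mulr1.
ring.
Qed.

(** In units of h, a translation by 1/mu is K steps. The sum over i telescopes within one such
    translation and the sum over m across them, leaving the step at a far right point minus the step
    at a far left one. *)
Lemma rho_partition (x0 : R) : exists M0 : nat, forall M, (M0 <= M)%N ->
  \sum_(i < K) zsum M (fun m => rho (x0 - zR R m / mu - i%:R * h)) = 1.
Proof.
have hn0 := lt0r_neq0 h0.
have muV : mu^-1 = - (K%:R * h) by rewrite hK opprK.
have K0 : (0 < K)%N.
  rewrite lt0n; apply/eqP => K0; move: hK; rewrite K0 mul0r => /esym/eqP.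
  by rewrite oppr_eq0 invr_eq0; apply/negP; rewrite lt_eqF ?slope_lt0.
have K1 : (1 : R) <= K%:R by rewrite ler1n.
pose y := h^-1 * x0.
have E m (i : nat) : h^-1 * (x0 - zR R m / mu - i%:R * h) = y + zR R m * K%:R - i%:R.
  by rewrite muV /y; field.
exists (Num.bound (`|y| + 1)) => M hM.
have yM : `|y| + 1 < M%:R.
  apply: lt_le_trans (archi_boundP (addr_ge0 (normr_ge0 y) ler01)) _.
  by rewrite ler_nat.
rewrite /zsum exchange_big /= -/(zsum M (fun m => \sum_(i < K) rho (x0 - zR R m / mu - i%:R * h))).
have tel0 m n : \sum_(i < n) rho (x0 - zR R m / mu - i%:R * h) =
    sg (y + zR R m * K%:R) - sg (y + zR R m * K%:R - n%:R).
  elim: n => [|n IH]; first by rewrite big_ord0 subr0 subrr.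
  rewrite big_ord_recr /= IH /rho E.
  have -> : y + zR R m * K%:R - n.+1%:R = y + zR R m * K%:R - n%:R - 1 by rewrite -natr1; ring.
  by ring.
have tel m : \sum_(i < K) rho (x0 - zR R m / mu - i%:R * h) = sg (y + zR R m * K%:R) - sg (y + zR R (m - 1) * K%:R).
  by rewrite tel0 zRB {3}/zR; congr (_ - sg _); ring.
rewrite (eq_zsum M tel) (zsum_telescope (fun m => sg (y + zR R m * K%:R))).
have MK : (M%:R : R) <= M%:R * K%:R by rewrite ler_peMr.
have MK1 : (M.+1%:R : R) <= M.+1%:R * K%:R by rewrite ler_peMr.
have := ler_norm y; have := ler_norm (- y); rewrite normrN => y1 y2.
rewrite sgr ?sgl ?subr0 // ?zRN ?zR_nat.
  by rewrite -natr1 in MK1 *; lra.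
lra.
Qed.

(** The compact support of [win] makes the sum over m finite at a given x0, so only the sum over n
    is a genuine limit; it is [synth_chi_term], and the windows then add up to 1. *)
Lemma window_frame (f : SRZ R) : S f ->
  \sum_(i < K) Edc_act theta c d (synth i) (chi theta c d (anal i) f) = f.
Proof.
move=> hf; apply/funext => x0; apply/funext => al0.
have hn0 := lt0r_neq0 h0.
have [M0 hM0] := rho_partition x0.
pose B : R := (`|x0| + K%:R * h + 3 * h) * `|mu|.
pose M1 := maxn M0 (Num.bound B).
have win0 (i : 'I_K) m : (M1 < `|m|)%N -> win (x0 - zR R m / mu - i%:R * h) = 0.
  move=> mM; apply/eqP; apply: contraT => /win_supp /andP[a b].
  have mu0 := slope_lt0.
  have iK : (i%:R : R) <= K%:R by rewrite ler_nat ltnW.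
  have ih : i%:R * h <= K%:R * h by rewrite ler_wpM2r // ltW.
  have ih0 : 0 <= i%:R * h by rewrite mulr_ge0 // ltW.
  have : `|zR R m / mu| <= `|x0| + K%:R * h + 3 * h.
    have := ler_norm x0; have := ler_norm (- x0); rewrite normrN => x1 x2.
    by rewrite ler_norml; apply/andP; split; lra.
  rewrite normrM normfV ler_pdivrMr ?normr_gt0 ?lt_eqF // -/B => mB.
  have B0 : 0 <= B by apply: le_trans mB.
  have := archi_boundP B0.
  have : ((Num.bound B)%:R : R) <= M1%:R by rewrite ler_nat leq_maxr.
  have : (M1%:R : R) < `|zR R m|.
    by rewrite /zR -intr_norm -abszE -pmulrn ltr_nat.
  lra.
have lim (i : 'I_K) : sumZ2 (fun m n => chi theta c d (anal i) f m n * wtau theta c d m n (synth i) x0 al0) =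
    cR (zsum M1 (fun m => rho (x0 - zR R m / mu - i%:R * h))) * f x0 al0.
  apply: clim_sumZ2.
  pose A (m : int) (N : nat) : CC R := cR (win (x0 - zR R m / mu - i%:R * h)) *
     zsum N (fun n => chi theta c d (anal i) f m n * ee (zR R n * phase c d x0 al0)).
  have hA m : clim (A m) (cR (rho (x0 - zR R m / mu - i%:R * h)) * f x0 al0).
    (* Where [win] vanishes so does [rho], and the Fourier series, whose inversion is known only
       near the window, is multiplied by 0. *)
    have [w0|w0] := eqVneq (win (x0 - zR R m / mu - i%:R * h)) 0.
      rewrite -win_rho w0 mul0r cR0 mul0r /A w0.
      by under eq_fun do rewrite mul0r; apply: clim_cst.
    rewrite -win_rho cRM -mulrA; apply: climZ; exact: synth_chi_term.
  have -> : cR (zsum M1 (fun m => rho (x0 - zR R m / mu - i%:R * h))) * f x0 al0 =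
      zsum M1 (fun m => cR (rho (x0 - zR R m / mu - i%:R * h)) * f x0 al0).
    rewrite /zsum (big_morph (@cR R) (@cR_additive R) (@cR0 R)) mulr_suml.
    by apply: eq_bigr.
  apply: (@clim_eventually _ (fun N => zsum M1 (fun m => A m N)) _ _ M1).
    by apply: clim_sum => j; apply: hA.
  move=> N NM; rewrite -(@zsum_stable _ (fun m => A m N) _ _ NM); last first.
    by move=> m mM; rewrite /A win0 // mul0r.
  apply: eq_zsum => m; rewrite /A -zsumZ; apply: eq_zsum => n.
  by rewrite /wtau /synth -/mu; ring.
rewrite SRZ_sumE.
rewrite (eq_bigr (fun i : 'I_K => cR (zsum M1 (fun m => rho (x0 - zR R m / mu - i%:R * h))) * f x0 al0)); last first.
  by move=> i _; rewrite Edc_actE lim.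
rewrite -mulr_suml -(big_morph (@cR R) (@cR_additive R) (@cR0 R)) hM0 ?leq_maxl //.
by rewrite cR1 mul1r.
Qed.

End Windows.

Lemma ex_frame : exists (K : nat) (ff gg : 'I_K -> SRZ R),
  [/\ forall i, S (ff i), forall i, S (gg i) &
  forall f, S f -> \sum_i Edc_act theta c d (ff i) (chi theta c d (gg i) f) = f].
Proof.
have [sg [sgl sgr sgS]] := ex_step R.
have mun := slope_lt0; have zc := zRc_le.
have muV : mu^-1 < 0 by rewrite invr_lt0.
(* With h = 1/(K |mu|), the separation condition 6h <= 1/|c| reads K >= 6 |c| / |mu|; both mu and c
   are negative. *)
pose B : R := 6 * mu^-1 * zR R c.
have B0 : 0 <= B by rewrite /B; nra.
pose K := (Num.bound B).+1.
have K0 : (0 : R) < K%:R by rewrite ltr0Sn.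
have BK : B <= K%:R.
  apply: (le_trans (ltW (archi_boundP B0))); by rewrite ler_nat.
pose h := - mu^-1 / K%:R.
have h0 : 0 < h by rewrite divr_gt0 // oppr_gt0.
have hK : K%:R * h = - mu^-1 by rewrite /h mulrC divfK // lt0r_neq0.
have hc : 6 * h <= - (zR R c)^-1.
  rewrite /h mulrA ler_pdivrMr //.
  have zc0 : 0 < - zR R c by lra.
  have -> : - (zR R c)^-1 = (- zR R c)^-1 by rewrite invrN.
  by rewrite [leRHS]mulrC ler_pdivlMr //; apply: le_trans BK; rewrite /B le_eqVlt; apply/orP; left; apply/eqP; ring.
exists K, (fun i => synth sg h i), (fun i => anal sg h i); split.
- by move=> i; apply: Edc_synth.
- by move=> i; apply: Edc_anal.
- by move=> f hf; apply: window_frame.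
Qed.

End Frame.

(** * Solving the dbar-equation *)

Section SmoothClass.
Variables (R : realType) (theta : R) (c d : int).
Hypothesis c0 : c != 0.

Let mu : R := zR R c / (zR R c * theta + zR R d).
Local Notation S := (@Edc_P R c).
Local Notation act := (Edc_act theta c d).

Lemma rapidM (w a : coeffs R) (K : R) (j : nat) : 0 <= K ->
  (forall p q, cabs (w p q) <= K * (1 + `|zR R p| + `|zR R q|) ^+ j) ->
  rapid a -> rapid (fun p q => w p q * a p q).
Proof.
move=> K0 hw ha k; have [M hM] := ha (j + k)%N; exists (K * M) => p q.
apply: le_trans (ler_wpM2l K0 (hM p q)).
rewrite cabsM exprD -mulrA.
set F := cabs (a p q); set V := _ ^+ k.
have -> : K * (F * ((1 + `|zR R p| + `|zR R q|) ^+ j * V)) = K * (1 + `|zR R p| + `|zR R q|) ^+ j * (F * V) by ring.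
by apply: ler_wpM2r => //; rewrite mulr_ge0 ?cabs_ge0 // exprn_ge0 // !addr_ge0.
Qed.

Lemma rapid_delta tau (a : coeffs R) : rapid a -> rapid (delta tau a).
Proof.
apply: (rapidM (K := cabs (twopii R) * (1 + cabs tau)) (j := 1)).
  by rewrite mulr_ge0 ?cabs_ge0 // addr_ge0 // cabs_ge0.
move=> p q; rewrite expr1 cabsM -mulrA ler_wpM2l ?cabs_ge0 //.
apply: (le_trans (cabsD _ _)); rewrite cabsM !zC_cR !cabs_cR.
have := cabs_ge0 tau; have := normr_ge0 (zR R p); have := normr_ge0 (zR R q).
by nra.
Qed.

Definition del2 (a : coeffs R) : coeffs R := fun p q => twopii R * zC R q * a p q.

Lemma rapid_del2 a : rapid a -> rapid (del2 a).
Proof.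
apply: (rapidM (K := cabs (twopii R)) (j := 1)); first exact: cabs_ge0.
move=> p q; rewrite expr1 cabsM ler_wpM2l ?cabs_ge0 // zC_cR cabs_cR.
by have := normr_ge0 (zR R p); lra.
Qed.

(* Used to prove smoothness: if each generator decays rapidly and has its derivative in the
   class, then the whole class consists of Schwartz functions ([cls_Edc]). *)
Inductive cls (W : set (SRZ R)) : SRZ R -> Prop :=
| cls_gen f : W f -> cls W f
| cls_S f : S f -> cls W f
| cls_D f g : cls W f -> cls W g -> cls W (f + g)
| cls_Z (z : CC R) f : cls W f -> cls W (fun x al => z * f x al)
| cls_X f : cls W f -> cls W (mulX f)
| cls_act f a : cls W f -> rapid a -> cls W (act f a).

Definition rapS (f : SRZ R) := forall al, rapdec (fun x => f x al).

Lemma rapS_unif f k : c_periodic c f -> rapS f ->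
  exists M, forall x al, cabs (f x al) * (1 + x ^+ 2) ^+ k <= M.
Proof.
move=> pf rf.
have [M hM] := @periodic_bound R c c0 (fun M h => forall x, cabs (h x) * (1 + x ^+ 2) ^+ k <= M) f pf
   (fun M N h MN hM x => le_trans (hM x) MN) (fun al => rf al k).
by exists M => x al; apply: hM.
Qed.

Lemma rapS_bnd f : c_periodic c f -> rapS f -> exists M, bnd M f.
Proof.
move=> pf rf; have [M hM] := rapS_unif 0 pf rf; exists M => x al.
by have := hM x al; rewrite expr0 mulr1.
Qed.

Lemma act_periodic f a : c_periodic c f -> c_periodic c (act f a).
Proof.
move=> pf x al; rewrite !Edc_actE; apply: eq_sumZ2 => p q.
by rewrite (wtau_periodic theta d c0).
Qed.

(** Peetre's inequality again: translating by p/mu costs a power of 1 + (p/mu)^2, which the rapid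
    decay of a absorbs. *)
Lemma act_rapS f a : c_periodic c f -> rapS f -> rapid a -> rapS (act f a).
Proof.
move=> pf rf ra al k; have [M hM] := rapS_unif k pf rf.
have M0 : 0 <= M.
  by apply: le_trans (hM 0 0); rewrite mulr_ge0 ?cabs_ge0 // exprn_ge0 // ltW // w_gt0.
pose w (p q : int) : CC R := cR ((2 * (1 + (zR R p / mu) ^+ 2)) ^+ k).
have rw : rapid (fun p q => w p q * a p q).
  apply: (rapidM (K := (2 * (1 + mu^-1 ^+ 2)) ^+ k) (j := (2 * k)%N)) => //.
    by rewrite exprn_ge0 // mulr_ge0 // ltW // w_gt0.
  move=> p q; rewrite cabs_cR ger0_norm; last by rewrite exprn_ge0 // mulr_ge0 // ltW // w_gt0.
  rewrite exprM -exprMn; apply: lerXn2r; rewrite ?nnegrE.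
  - by rewrite mulr_ge0 // ltW // w_gt0.
  - by rewrite !mulr_ge0 ?sqr_ge0 // ltW // w_gt0.
  rewrite -mulrA ler_wpM2l // exprMn.
  have := sqr_ge0 mu^-1; rewrite -(real_normK (num_real (zR R p))).
  have := normr_ge0 (zR R p); have := normr_ge0 (zR R q).
  move: (`|zR R p|) (`|zR R q|) (mu^-1 ^+ 2) => u v m v0 u0 m0.
  have h1 : 1 + u ^+ 2 <= (1 + u + v) ^+ 2 by nra.
  have h2 : 1 + u ^+ 2 * m <= (1 + m) * (1 + u ^+ 2) by have := sqr_ge0 u; nra.
  by apply: (le_trans h2); rewrite ler_wpM2l // addr_ge0.
have [A A0 hA] := rapid_dom rw.
exists (9 * (A * M)) => x; rewrite -ler_pdivlMr ?exprn_gt0 ?w_gt0 // Edc_actE -mulrA.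
apply: sumZ2_le => p q.
have W0 : 0 < (1 + x ^+ 2) ^+ k by rewrite exprn_gt0 // w_gt0.
rewrite cabsM /wtau cabsM cabs_ee mul1r -/mu mulrAC ler_pdivlMr //.
have := hA p q; rewrite cabsM /w cabs_cR; set s := zR R p / mu.
have s0 : 0 <= (2 * (1 + s ^+ 2)) ^+ k by rewrite exprn_ge0 // mulr_ge0 // ltW // w_gt0.
rewrite (ger0_norm s0) => h1.
have h2 := hM (x - s) (al - p).
have h3 : (1 + x ^+ 2) ^+ k <= (2 * (1 + s ^+ 2)) ^+ k * (1 + (x - s) ^+ 2) ^+ k.
  rewrite -exprMn; apply: lerXn2r; rewrite ?nnegrE ?(ltW (w_gt0 _)) //.
    by rewrite !mulr_ge0 // ltW // w_gt0.
  rewrite -subr_ge0 (_ : _ - _ = 1 + (x - s * 2) ^+ 2 + 2 * (s * (x - s)) ^+ 2); last by ring.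
  by rewrite !addr_ge0 ?sqr_ge0 // mulr_ge0 ?sqr_ge0.
have a0 := cabs_ge0 (a p q); have f0 := cabs_ge0 (f (x - s) (al - p)).
apply: (@le_trans _ _ (cabs (a p q) * cabs (f (x - s) (al - p)) * ((2 * (1 + s ^+ 2)) ^+ k * (1 + (x - s) ^+ 2) ^+ k))).
  by rewrite ler_wpM2l // mulr_ge0.
have -> : cabs (a p q) * cabs (f (x - s) (al - p)) * ((2 * (1 + s ^+ 2)) ^+ k * (1 + (x - s) ^+ 2) ^+ k) =
  ((2 * (1 + s ^+ 2)) ^+ k * cabs (a p q)) * (cabs (f (x - s) (al - p)) * (1 + (x - s) ^+ 2) ^+ k) by ring.
rewrite [leRHS]mulrAC; apply: ler_pM => //; first by rewrite mulr_ge0.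
by rewrite mulr_ge0 // exprn_ge0 // ltW // w_gt0.
Qed.

(** Differentiating U1^p U2^q applied to f gives an extra term with factor 2 pi i q. It is absorbed
    into the coefficients as [del2 a], so the derivative is again a combination of actions and the
    class [cls] is stable. *)
Lemma cder_act f g a : c_periodic c f -> rapS f -> c_periodic c g -> rapS g -> rapid a ->
  (forall x al, cder (fun t => f t al) x (g x al)) ->
  forall x al, cder (fun t => act f a t al) x ((act g a + act f (del2 a)) x al).
Proof.
move=> pf rf pg rg ra hfg x al.
have [K hK] := rapS_bnd pf rf; have [K' hK'] := rapS_bnd pg rg.
have [A A0 hA] := rapid_dom ra; have [A' A'0 hA'] := rapid_dom (rapid_del2 ra).
pose C := 12 * (A * K') + 12 * (A' * K).
apply: (@cder_unif_lim _ (fun N x => sqs N (fun p q => a p q * wtau theta c d p q f x al))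
   (fun N x => sqs N (fun p q => a p q * wtau theta c d p q g x al) +
      sqs N (fun p q => del2 a p q * wtau theta c d p q f x al)) (fun t => act f a t al)
   (fun x => (act g a + act f (del2 a)) x al) (fun n => C / n.+1%:R)).
- move=> N y; rewrite -sqsD.
  apply: cder_sum => i _; apply: cder_sum => j _.
  set p := i%:Z - N%:Z; set q := j%:Z - N%:Z.
  have := cderZ (a p q) (cder_wtau theta c d p q y al hfg).
  congr cder; rewrite /del2; ring.
- by move=> y; rewrite Edc_actE; have := sumZ2_cvg (dom_act theta c d hA hK y al); apply.
- move=> N y; rewrite -[(_ + _) y al]/(act g a y al + act f (del2 a) y al) !Edc_actE.
  rewrite cabsB opprD addrACA; apply: (le_trans (cabsD _ _)); rewrite /C mulrDl.
  by apply: lerD; apply: sumZ2_tail; apply: dom_act.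
- exact: to0_harmonic.
Qed.

Lemma mulX_rapS f : rapS f -> rapS (mulX f).
Proof.
move=> rf al; apply: (@rapdecM _ (fun x => f x al) (@cR R) 1 1) => //.
by move=> x; rewrite cabs_cR mul1r expr1 norm_le_w.
Qed.

Section Generated.
Variable W : set (SRZ R).
Hypothesis HW : forall f, W f -> [/\ c_periodic c f, rapS f &
  exists2 g, cls W g & forall x al, cder (fun t => f t al) x (g x al)].

Lemma cls_rapS f : cls W f -> c_periodic c f /\ rapS f.
Proof.
elim=> {f} [f /HW[]//|f [pf sf]|f g _ [pf rf] _ [pg rg]|z f _ [pf rf]|f _ [pf rf]|f a _ [pf rf] ra].
- by split => // al; apply: schwartz_rapdec.
- split; last by move=> al; apply: rapdecD.
  by move=> x al; rewrite -[LHS]/(f x (al + c) + g x (al + c)) pf pg.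
- split; first by move=> x al; rewrite pf.
  move=> al; apply: (@rapdecM _ (fun x => f x al) (fun=> z) (cabs z) 0) => [x||//].
    by rewrite expr0 mulr1.
  exact: cabs_ge0.
- split; first by move=> x al; rewrite /mulX pf.
  exact: mulX_rapS.
- by split; [exact: act_periodic|exact: act_rapS].
Qed.

Lemma cls_cder f : cls W f -> exists2 g, cls W g & forall x al, cder (fun t => f t al) x (g x al).
Proof.
elim=> {f} [f /HW[]//|f sf|f f' _ [g cg hg] _ [g' cg' hg']|z f _ [g cg hg]|f cf [g cg hg]|f a cf [g cg hg] ra].
- exists (derX f); first by apply: cls_S; apply: Edc_derX.
  by move=> x al; apply: cder_derX sf.
- exists (g + g'); first exact: cls_D.
  by move=> x al; exact: (cderD (hg x al) (hg' x al)).
- exists (fun x al => z * g x al); first exact: cls_Z.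
  by move=> x al; apply: cderZ.
- exists (f + mulX g); first by apply: cls_D => //; apply: cls_X.
  move=> x al; have := cderM (cder_id x) (hg x al); rewrite mul1r; exact.
- exists (act g a + act f (del2 a)).
    by apply: cls_D; apply: cls_act => //; apply: rapid_del2.
  have [pf rf] := cls_rapS cf; have [pg rg] := cls_rapS cg.
  exact: cder_act.
Qed.

Lemma cls_Edc f : cls W f -> S f.
Proof.
move=> cf; split; first by case: (cls_rapS cf).
move=> al; apply: (schwartz_ind (C := [set h | exists2 g, cls W g & h = fun x => g x al])); last by exists f.
move=> _ [g cg ->]; split; first by case: (cls_rapS cg).
by have [g' cg' hg'] := cls_cder cg; exists (fun x => g' x al) => //; exists g'.
Qed.

End Generated.

Lemma Edc_act_closed f a : S f -> rapid a -> S (act f a).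
Proof.
move=> hf ra; apply: (@cls_Edc set0) => //.
by apply: cls_act => //; apply: cls_S.
Qed.

End SmoothClass.

(** * The scalar first-order equation in weighted sup norms *)

Section Resolvent.
Variable R : realType.
Implicit Types (x y : R).

Variables (kappa zeta : CC R) (r : R).
Hypothesis r0 : 0 < r.
Hypothesis kappaE : cRe kappa = - r ^+ 2.

(** The maximum point of Re(kappa x^2/2 + zeta x). [gauss] is the homogeneous solution exp(kappa
    x^2/2 + zeta x), scaled by a positive constant to have modulus 1 there; [osc] is its argument
    divided by 2 pi. *)
Definition vertex : R := cRe zeta / r ^+ 2.

Definition osc x : R :=
  (cIm kappa * x ^+ 2 / 2 + cIm zeta * x) / (2 * pi).

Definition gauss x : CC R := cR (expR (- (r ^+ 2 * (x - vertex) ^+ 2 / 2))) * ee (osc x).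
Definition gaussV x : CC R := cR (expR (r ^+ 2 * (x - vertex) ^+ 2 / 2)) * ee (- osc x).

Lemma is_derive_quad (e b v : R) x : is_derive x 1 (fun t => e * (t - v) ^+ 2 + b * t) (2 * e * (x - v) + b).
Proof.
have h1 := is_derive_affine 1 (- v) x.
have h2 := is_deriveM' h1 h1.
have h3 := is_deriveD (is_deriveM' (is_derive_cst e x 1) h2) (is_derive_affine b 0 x).
have -> : (fun t => e * (t - v) ^+ 2 + b * t) = ((fun t => cst e t * ((1 * t + - v) * (1 * t + - v))) + (fun t => b * t + 0)).
  by apply/funext => t; rewrite !fctE /cst; ring.
by apply: (is_derive_eq h3); rewrite /cst; ring.
Qed.

Lemma cder_gauss x : cder gauss x ((kappa * cR x + zeta) * gauss x).
Proof.
have r2 : r ^+ 2 != 0 by rewrite expf_neq0 // lt0r_neq0.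
have h1 := is_derive_comp (is_derive_expR _) (is_derive_quad (- (r ^+ 2 / 2)) 0 vertex x).
have E1 : (fun t => expR (- (r ^+ 2 / 2) * (t - vertex) ^+ 2 + 0 * t)) =
   (fun t => expR (- (r ^+ 2 * (t - vertex) ^+ 2 / 2))).
  by apply/funext => t; congr expR; ring.
rewrite E1 in h1.
have h2 := is_derive_quad (cIm kappa / 2 / (2 * pi)) (cIm zeta / (2 * pi)) 0 x.
have h3 := cder_comp (cder_ee 1 0 _) h2.
have := cderM (cder_cR h1) h3.
have E2 t : 1 * (cIm kappa / 2 / (2 * pi) * (t - 0) ^+ 2 + cIm zeta / (2 * pi) * t) + 0 = osc t.
  by rewrite /osc subr0; ring.
have -> : (fun t => cR (expR (- (r ^+ 2 * (t - vertex) ^+ 2 / 2))) *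
    ee (1 * (cIm kappa / 2 / (2 * pi) * (t - 0) ^+ 2 + cIm zeta / (2 * pi) * t) + 0)) = gauss.
  by apply/funext => t; rewrite E2.
congr cder; rewrite E2 /gauss (_ : - (r ^+ 2 / 2) * (x - vertex) ^+ 2 + 0 * x = - (r ^+ 2 * (x - vertex) ^+ 2 / 2)); last by ring.
set X := expR _; set Y := ee (osc x).
have -> : kappa * cR x + zeta = cR (2 * - (r ^+ 2 / 2) * (x - vertex) + 0) +
   cR (2 * (cIm kappa / 2 / (2 * pi)) * (x - 0) + cIm zeta / (2 * pi)) * (twopii R * cR 1).
  have p0 : (pi : R) != 0 by rewrite lt0r_neq0 // pi_gt0.
  have rn := lt0r_neq0 r0.
  apply: CC_eq; rewrite !cE /vertex ?kappaE /twopii /=; move: (pi : R) p0 => P P0; by field; rewrite ?rn ?P0.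
rewrite cRM; ring.
Qed.

Lemma gaussVK x : gauss x * gaussV x = 1.
Proof.
rewrite /gauss /gaussV mulrACA -cRM -expRD addNr expR0 cR1 mul1r mulrC.
exact: eeN.
Qed.

Lemma ccont_gaussV : ccont gaussV.
Proof.
have c1 : continuous (fun x => expR (r ^+ 2 / 2 * (x - vertex) ^+ 2 + 0 * x)).
  exact: (is_derive_continuous (fun x => is_derive_comp (is_derive_expR _) (is_derive_quad (r ^+ 2 / 2) 0 vertex x))).
have c2 : continuous (fun x => - (cIm kappa / 2 / (2 * pi)) * (x - 0) ^+ 2 + - (cIm zeta / (2 * pi)) * x).
  exact: (is_derive_continuous (fun x => is_derive_quad (- (cIm kappa / 2 / (2 * pi))) (- (cIm zeta / (2 * pi))) 0 x)).
have := ccontM (f := fun x => cR (expR (r ^+ 2 / 2 * (x - vertex) ^+ 2 + 0 * x)))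
   (conj c1 (@cst_continuous _ _ (0 : R))) (ccont_comp (ccont_eeZ 1) c2).
congr ccont; apply/funext => x; rewrite /gaussV /osc; congr (cR (expR _) * ee _); first by ring.
by rewrite subr0; ring.
Qed.

(* Since |gauss| decays and |gaussV| grows, integrating from the vertex keeps the solution
   bounded on both sides. *)
Definition resolv (u : R -> CC R) x : CC R :=
  gauss x * (prim (fun t => gaussV t * u t) x - prim (fun t => gaussV t * u t) vertex).

Lemma cder_resolv u x : ccont u -> cder (resolv u) x ((kappa * cR x + zeta) * resolv u x + u x).
Proof.
move=> cu; have cg := ccontM ccont_gaussV cu.
have h := cderB (cder_prim x cg) (cder_cst (prim (fun t => gaussV t * u t) vertex) x).
have := cderM (cder_gauss x) h.
congr cder; rewrite /resolv subr0 mulrA gaussVK mul1r; ring.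
Qed.

Section Weight.
Variables (eps : R) (k : nat).
Hypothesis eps_small : 8 * k%:R * eps ^+ 2 <= r ^+ 2.

Definition wt y : R := (1 + eps ^+ 2 * y ^+ 2)^-1.
Let T y : R := (1 + r ^+ 2 * y ^+ 2)^-1.

Lemma quad_gt0 (e y : R) : 0 < 1 + e ^+ 2 * y ^+ 2.
Proof. by rewrite ltr_wpDr // mulr_ge0 // sqr_ge0. Qed.

Lemma wt_gt0 y : 0 < wt y. Proof. by rewrite invr_gt0 quad_gt0. Qed.

Lemma is_derive_invquad (e v x : R) :
  is_derive x 1 (fun t => (1 + e ^+ 2 * (t - v) ^+ 2)^-1) (- 2 * e ^+ 2 * (x - v) * ((1 + e ^+ 2 * (x - v) ^+ 2)^-1) ^+ 2).
Proof.
have h := is_deriveD (is_derive_cst (1 : R) x 1) (is_derive_quad (e ^+ 2) 0 v x).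
have n0 : ((cst (1 : R) + (fun t => e ^+ 2 * (t - v) ^+ 2 + 0 * t)) : R -> R) x != 0.
  by rewrite -[X in X != 0]/(1 + (e ^+ 2 * (x - v) ^+ 2 + 0 * x)) mul0r addr0 lt0r_neq0 // quad_gt0.
have hV := is_deriveV n0 h.
have E : (fun t => (1 + e ^+ 2 * (t - v) ^+ 2)^-1) = (fun t => ((cst (1 : R) + (fun t => e ^+ 2 * (t - v) ^+ 2 + 0 * t)) t)^-1).
  by apply/funext => t; rewrite !fctE /cst mul0r addr0.
rewrite E; apply: (is_derive_eq hV).
rewrite !fctE /cst mul0r addr0 /GRing.scale /= exprVn; ring.
Qed.

Lemma is_derive_pow (f : R -> R) (df x : R) n : is_derive x 1 f df ->
  is_derive x 1 (fun t => f t ^+ n) (n%:R * f x ^+ n.-1 * df).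
Proof.
move=> h; elim: n => [|n IH].
  by rewrite mul0r mul0r; under eq_fun do rewrite expr0; apply: is_derive_cst.
under eq_fun do rewrite exprS.
apply: (is_derive_eq (is_deriveM' h IH)).
case: n {IH} => [|n]; first by rewrite expr0 !mul0r mulr0 addr0; ring.
by rewrite /= -(natr1 n.+1) exprS; ring.
Qed.

(* A supersolution: [Y' >= e^{r^2 y^2 / 2} wt^k] with y = x - vertex, so that Y dominates the
   integral defining [resolv u]. The vacuous summands match [is_derive_quad]. *)
Let Y x : R := expR (r ^+ 2 / 2 * (x - vertex) ^+ 2 + 0 * x) *
   ((4 * (x - vertex) + 0) * (T (x - vertex) * wt (x - vertex) ^+ k)).

Let dY x : R := expR (r ^+ 2 / 2 * (x - vertex) ^+ 2 + 0 * x) * (wt (x - vertex) ^+ k *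
   (4 * T (x - vertex) - 8 * r ^+ 2 * (x - vertex) ^+ 2 * T (x - vertex) ^+ 2
    + 4 * r ^+ 2 * (x - vertex) ^+ 2 * T (x - vertex)
    - 8 * k%:R * eps ^+ 2 * (x - vertex) ^+ 2 * T (x - vertex) * wt (x - vertex))).

Lemma is_derive_Y x : is_derive x 1 Y (dY x).
Proof.
have hE := is_derive_comp (is_derive_expR _) (is_derive_quad (r ^+ 2 / 2) 0 vertex x).
have hL := is_derive_affine 4 (- 4 * vertex) x.
have hT := is_derive_invquad r vertex x.
have hw := is_derive_pow k (is_derive_invquad eps vertex x).
have h := is_deriveM' hE (is_deriveM' hL (is_deriveM' hT hw)).
have EY : Y = (fun t => expR (r ^+ 2 / 2 * (t - vertex) ^+ 2 + 0 * t) *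
    ((4 * t + - 4 * vertex) * ((1 + r ^+ 2 * (t - vertex) ^+ 2)^-1 * (1 + eps ^+ 2 * (t - vertex) ^+ 2)^-1 ^+ k))).
  by apply/funext => t; rewrite /Y /T /wt; congr (_ * (_ * _)); ring.
rewrite EY; apply: (is_derive_eq h); rewrite /dY /T /wt.
set y := x - vertex; have -> : 4 * x + -4 * vertex = 4 * y by rewrite /y; ring.
set X := expR _; set t := (1 + r ^+ 2 * y ^+ 2)^-1; set w := (1 + eps ^+ 2 * y ^+ 2)^-1.
case: (k) => [|n]; first by rewrite expr0; field.
by rewrite /= (exprS w n); field.
Qed.

(** With s = r^2 y^2, the terms free of eps add up to T^2 (4 + 4 s^2) >= 2, because T (1 + s) = 1
    and 2 + 2 s^2 >= (1 + s)^2. Differentiating the weight costs at most 1, by the smallness of eps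
    and r^2 y^2 T <= 1. *)
Lemma dY_ge x : expR (r ^+ 2 / 2 * (x - vertex) ^+ 2 + 0 * x) * wt (x - vertex) ^+ k <= dY x.
Proof.
rewrite /dY ler_wpM2l ?expR_ge0 // -[leLHS]mulr1 ler_wpM2l ?exprn_ge0 ?(ltW (wt_gt0 _)) //.
set y := x - vertex.
have q0 := quad_gt0 r y; have q1 := quad_gt0 eps y.
have T0 : 0 < T y by rewrite invr_gt0.
have w1 : wt y <= 1 by rewrite /wt invf_le1 // lerDl mulr_ge0 // sqr_ge0.
have w0 := wt_gt0 y.
have TE : T y * (1 + r ^+ 2 * y ^+ 2) = 1 by rewrite mulVf // lt0r_neq0.
have h1 : 2 <= 4 * T y - 8 * r ^+ 2 * y ^+ 2 * T y ^+ 2 + 4 * r ^+ 2 * y ^+ 2 * T y.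
  have -> : 4 * T y - 8 * r ^+ 2 * y ^+ 2 * T y ^+ 2 + 4 * r ^+ 2 * y ^+ 2 * T y =
     T y ^+ 2 * (4 + 4 * (r ^+ 2 * y ^+ 2) ^+ 2) +
     (T y * (1 + r ^+ 2 * y ^+ 2) - 1) * (- 4 * T y - 4 * T y * (r ^+ 2 * y ^+ 2)) by ring.
  rewrite TE subrr mul0r addr0.
  have -> : 2 = T y ^+ 2 * (2 * (1 + r ^+ 2 * y ^+ 2) ^+ 2) :> R.
    by rewrite mulrCA -exprMn TE expr1n mulr1.
  rewrite ler_wpM2l ?sqr_ge0 //; move: (r ^+ 2 * y ^+ 2) => s.
  by have := sqr_ge0 (s - 1); lra.
have h2 : 8 * k%:R * eps ^+ 2 * y ^+ 2 * T y * wt y <= 1.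
  have z0 : 0 <= y ^+ 2 * T y by rewrite mulr_ge0 ?sqr_ge0 // ltW.
  have h3 : 8 * k%:R * eps ^+ 2 * y ^+ 2 * T y <= 1.
    have -> : 8 * k%:R * eps ^+ 2 * y ^+ 2 * T y = (8 * k%:R * eps ^+ 2) * (y ^+ 2 * T y) by ring.
    apply: (le_trans (ler_wpM2r z0 eps_small)).
    have -> : r ^+ 2 * (y ^+ 2 * T y) = 1 - T y by rewrite -[X in X - _]TE; ring.
    by rewrite gerBl ltW.
  have z1 : 0 <= 8 * k%:R * eps ^+ 2 * y ^+ 2 * T y.
    by rewrite -mulrA mulr_ge0 // mulr_ge0 ?sqr_ge0 // mulr_ge0.
  by rewrite -[leRHS]mulr1; apply: ler_pM => //; exact: ltW.
lra.
Qed.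

(** The gain 1/r: by 2 r |y| <= 1 + r^2 y^2 the factor 4 |y| T is at most 2/r. *)
Lemma Y_le x : `|Y x| <= expR (r ^+ 2 / 2 * (x - vertex) ^+ 2 + 0 * x) * (2 / r * wt (x - vertex) ^+ k).
Proof.
rewrite /Y normrM (ger0_norm (expR_ge0 _)) ler_wpM2l ?expR_ge0 // addr0 mulrA normrM.
rewrite (ger0_norm (exprn_ge0 _ (ltW (wt_gt0 _)))) ler_wpM2r ?exprn_ge0 ?(ltW (wt_gt0 _)) //.
set y := x - vertex; have q0 := quad_gt0 r y.
rewrite normrM /T normfV (gtr0_norm q0) ler_pdivrMr // normrM ger0_norm //.
rewrite -(real_normK (num_real y)) mulrAC ler_pdivlMr //.
have := sqr_ge0 (r * `|y| - 1); lra.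
Qed.

(** [Y] vanishes at the vertex, where the integration starts, so the comparison works on both sides.
    The Gaussian in front cancels the exponential of [Y], and 4/r is the 2 of [cder_le] times the
    2/r of [Y_le]. *)
Lemma resolv_le u (M : R) x : ccont u -> 0 <= M -> (forall t, cabs (u t) <= M * wt (t - vertex) ^+ k) ->
  cabs (resolv u x) <= 4 / r * M * wt (x - vertex) ^+ k.
Proof.
move=> cu M0 hu; have cg := ccontM ccont_gaussV cu.
have hMY (t : R) : is_derive t 1 (fun t : R => M * Y t) (M * dY t).
  apply: (is_derive_eq (is_deriveM' (is_derive_cst M t 1) (is_derive_Y t))).
  by rewrite mul0r add0r.
have gb t : cabs (gaussV t * u t) <= M * dY t.
  have := dY_ge t; rewrite cabsM /gaussV cabsM cabs_ee mulr1 cabs_cR (ger0_norm (expR_ge0 _)).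
  have -> : r ^+ 2 / 2 * (t - vertex) ^+ 2 + 0 * t = r ^+ 2 * (t - vertex) ^+ 2 / 2 by ring.
  move=> H; apply: (le_trans (ler_wpM2l (expR_ge0 _) (hu t))).
  by rewrite mulrCA ler_wpM2l.
have Yv : Y vertex = 0 by rewrite /Y subrr mulr0 addr0 mul0r mulr0.
have b : cabs (prim (fun t => gaussV t * u t) x - prim (fun t => gaussV t * u t) vertex) <= 2 * M * `|Y x|.
  have [vx|/ltW xv] := leP vertex x.
    have := cder_le (fun t => cder_prim t cg) hMY vx (fun t _ => gb t).
    rewrite Yv mulr0 subr0 mulrA => /le_trans; apply.
    by rewrite ler_wpM2l ?mulr_ge0 // ler_norm.
  have := cder_le (fun t => cder_prim t cg) hMY xv (fun t _ => gb t).
  rewrite cabsB Yv mulr0 sub0r -mulrN mulrA => /le_trans; apply.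
  by rewrite ler_wpM2l ?mulr_ge0 // -normrN ler_norm.
rewrite /resolv cabsM /gauss cabsM cabs_ee mulr1 cabs_cR (ger0_norm (expR_ge0 _)).
apply: (le_trans (ler_wpM2l (expR_ge0 _) b)).
have M2 : 0 <= 2 * M by rewrite mulr_ge0.
apply: (le_trans (ler_wpM2l (expR_ge0 _) (ler_wpM2l M2 (Y_le x)))).
have E : expR (- (r ^+ 2 * (x - vertex) ^+ 2 / 2)) * expR (r ^+ 2 / 2 * (x - vertex) ^+ 2 + 0 * x) = 1.
  by rewrite -expRD (_ : _ + _ = 0) ?expR0 //; ring.
move: E; set e1 := expR _; set e2 := expR _; set w := _ ^+ k => E.
have -> : e1 * (2 * M * (e2 * (2 / r * w))) = (e1 * e2) * (4 / r * M * w) by ring.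
by rewrite E mul1r.
Qed.

End Weight.
End Resolvent.

Section GeometricSeries.
Variable R : realType.

Definition gser (a : nat -> CC R) : CC R := limn (fun N => \sum_(j < N) a j).

Lemma gser_clim (a : nat -> CC R) (M : R) : (forall j, cabs (a j) <= M * 2^-1 ^+ j) ->
  clim (fun N => \sum_(j < N) a j) (gser a) /\
  forall N, cabs (gser a - \sum_(j < N) a j) <= 2 * M * 2^-1 ^+ N.
Proof.
move=> h; have M0 : 0 <= M by have := h 0%N; rewrite expr0 mulr1; apply: le_trans; exact: cabs_ge0.
have bd m n : (m <= n)%N -> cabs (\sum_(j < n) a j - \sum_(j < m) a j) <= 2 * M * 2^-1 ^+ m.
  move=> mn; apply: (@le_trans _ _ (2 * M * (2^-1 ^+ m - 2^-1 ^+ n))); last first.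
    by rewrite ler_wpM2l ?mulr_ge0 // gerBl exprn_ge0 // invr_ge0.
  rewrite -(subnKC mn); elim: (n - m)%N => [|p IH]; first by rewrite addn0 !subrr cabs0 mulr0.
  rewrite addnS big_ord_recr /= addrAC; apply: (le_trans (cabsD _ _)).
  apply: (le_trans (lerD IH (h _))); rewrite exprS le_eqVlt; apply/orP; left; apply/eqP; by field.
have t0 : to0 (fun N => 2 * M * 2^-1 ^+ N).
  apply: to0_le (to0_harmonic (2 * M)) => j; rewrite ler_wpM2l ?mulr_ge0 //.
  rewrite exprVn lef_pV2 ?posrE ?exprn_gt0 ?ltr0Sn //.
  by rewrite -natrX ler_nat ltn_expl.
have [l hl hl'] := clim_cauchy bd t0.
by have -> : gser a = l by exact: (clim_limn hl).
Qed.

End GeometricSeries.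

(** * Neumann series for the coupled system *)

Section Solver.
Variables (R : realType) (theta : R) (c d : int).
Hypothesis c0 : c != 0.

Let mu : R := zR R c / (zR R c * theta + zR R d).
Local Notation S := (@Edc_P R c).
Local Notation act := (Edc_act theta c d).

Variables (kappa zeta : CC R) (r : R).
Hypothesis r0 : 0 < r.
Hypothesis kappaE : cRe kappa = - r ^+ 2.

Let x0 := vertex zeta r.

(** Interpolation between e = 0 and e = 1: it lets a possibly huge bound for the full weight enter
    with the small coefficient e. *)
Lemma convex_pow (e s : R) K : 0 <= e <= 1 -> 0 <= s ->
  (1 + e * s) ^+ K <= (1 - e) + e * (1 + s) ^+ K.
Proof.
move=> /andP[e0 e1] s0; elim: K => [|K IH]; first by rewrite !expr0 mulr1 subrK.
rewrite exprS; have es : 0 <= 1 + e * s by rewrite addr_ge0 // mulr_ge0.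
apply: (le_trans (ler_wpM2l es IH)); rewrite -subr_ge0.
have -> : 1 - e + e * (1 + s) ^+ K.+1 - (1 + e * s) * (1 - e + e * (1 + s) ^+ K) =
   e * (1 - e) * s * ((1 + s) ^+ K - 1) by rewrite exprS; ring.
by rewrite !mulr_ge0 ?subr_ge0 // exprn_ege1 // lerDl.
Qed.

(** For a fixed translation s the loss tends to 1 as e tends to 0, unlike Peetre's inequality with
    its fixed factor 2. *)
Lemma wt_shift (e y s : R) : 0 <= e -> wt e (y - s) <= (1 + e * `|s|) ^+ 2 * wt e y.
Proof.
move=> e0; rewrite /wt ler_pdivlMr ?quad_gt0 // mulrC ler_pdivrMr ?quad_gt0 //.
have -> : 1 + e ^+ 2 * y ^+ 2 = 1 + (e * y) ^+ 2 by rewrite exprMn.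
have -> : 1 + e ^+ 2 * (y - s) ^+ 2 = 1 + (e * (y - s)) ^+ 2 by rewrite exprMn.
set a := e * (y - s); set b := e * `|s|.
have b0 : 0 <= b by rewrite mulr_ge0.
have h1 : (e * y) ^+ 2 <= (`|a| + b) ^+ 2.
  rewrite -(real_normK (num_real (e * y))); apply: lerXn2r; rewrite ?nnegrE ?addr_ge0 //.
  have -> : e * y = a + e * s by rewrite /a; ring.
  by apply: (le_trans (ler_normD _ _)); rewrite lerD2l normrM ger0_norm.
rewrite -(real_normK (num_real a)); have a0 := normr_ge0 a.
move: (`|a|) a0 h1 => t t0 h1.
have := mulr_ge0 t0 b0; have := sqr_ge0 (t - 1); have := mulr_ge0 (mulr_ge0 t0 t0) b0.
have := sqr_ge0 (t * b); nra.
Qed.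

(** The translation losses are charged to the coefficients, where [good_eps] controls them; the 9 is
    that of [sumZ2_le]. *)
Lemma act_wt (f : SRZ R) (a : coeffs R) (e A M : R) k : 0 <= e ->
  (forall x al, cabs (f x al) <= M * wt e (x - x0) ^+ k) ->
  (forall p q, cabs (a p q) * (1 + e * `|zR R p / mu|) ^+ (2 * k) <= A * (kap R p * kap R q)) ->
  forall x al, cabs (act f a x al) <= 9 * (A * M) * wt e (x - x0) ^+ k.
Proof.
move=> e0 hf ha x al; rewrite Edc_actE -mulrA.
have M0 : 0 <= M.
  have := le_trans (cabs_ge0 _) (hf 0 0); rewrite pmulr_lge0 // exprn_gt0 // wt_gt0 //.
apply: sumZ2_le => p q; rewrite cabsM /wtau cabsM cabs_ee mul1r -/mu.
set s := zR R p / mu.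
have w1 : wt e (x - s - x0) ^+ k <= (1 + e * `|s|) ^+ (2 * k) * wt e (x - x0) ^+ k.
  rewrite exprM -exprMn; apply: lerXn2r; rewrite ?nnegrE.
  - exact: ltW (wt_gt0 _ _).
  - by rewrite mulr_ge0 ?sqr_ge0 // ltW // wt_gt0.
  - by rewrite (_ : x - s - x0 = x - x0 - s); [exact: wt_shift|ring].
apply: (le_trans (ler_wpM2l (cabs_ge0 _) (hf (x - s) (al - p)))).
apply: (le_trans (ler_wpM2l (cabs_ge0 _) (ler_wpM2l M0 w1))).
have := ha p q; rewrite -/s => h.
have W0 : 0 <= M * wt e (x - x0) ^+ k by rewrite mulr_ge0 // exprn_ge0 // ltW // wt_gt0.
have := ler_wpM2r W0 h; set w := wt _ _ ^+ k; set v := _ ^+ (2 * k).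
set K := kap R p * kap R q; set C := cabs _ => H.
have -> : C * (M * (v * w)) = C * v * (M * w) by ring.
by apply: (le_trans H); rewrite le_eqVlt; apply/orP; left; apply/eqP; ring.
Qed.

Lemma rapdec_wt (f : R -> CC R) (e M : R) k : 0 <= e <= 1 ->
  (forall x, cabs (f x) * (1 + x ^+ 2) ^+ k <= M) ->
  forall x, cabs (f x) <= M * (2 * (1 + x0 ^+ 2)) ^+ k * wt e (x - x0) ^+ k.
Proof.
move=> /andP[e0 e1] h x.
have W0 : 0 < wt e (x - x0) ^+ k by rewrite exprn_gt0 // wt_gt0.
rewrite -ler_pdivrMr // -[in leLHS]exprVn /wt invrK.
have P0 : 0 <= (2 * (1 + x0 ^+ 2)) ^+ k by rewrite exprn_ge0 // mulr_ge0 // ltW // w_gt0.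
apply: le_trans (ler_wpM2r P0 (h x)); rewrite -[leRHS]mulrA ler_wpM2l ?cabs_ge0 // -[leRHS]exprMn.
apply: lerXn2r; rewrite ?nnegrE ?(ltW (quad_gt0 _ _)) //.
  by rewrite !mulr_ge0 // ltW // w_gt0.
have e2 : e ^+ 2 <= 1 by rewrite expr_le1.
have := ler_wpM2r (sqr_ge0 (x - x0)) e2; rewrite mul1r.
have := sqr_ge0 (x + x0); have := sqr_ge0 (x * x0); rewrite exprMn => a1 a2 a3.
have := sqr_ge0 x; have := sqr_ge0 x0; move: a1 a2 a3; rewrite sqrrD sqrrB.
by lra.
Qed.

Lemma wt_rapdec (f : R -> CC R) (e M : R) k : 0 < e -> 0 <= M ->
  (forall x, cabs (f x) <= M * wt e (x - x0) ^+ k) ->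
  forall x, cabs (f x) * (1 + x ^+ 2) ^+ k <= M * (1 + 2 * x0 ^+ 2 + 2 * e^-1 ^+ 2) ^+ k.
Proof.
move=> e0 M0 h x.
have w0 : 0 <= (1 + x ^+ 2) ^+ k by rewrite exprn_ge0 // ltW // w_gt0.
apply: (le_trans (ler_wpM2r w0 (h x))); rewrite -mulrA ler_wpM2l // -exprMn.
apply: lerXn2r; rewrite ?nnegrE.
- by rewrite mulr_ge0 ?(ltW (wt_gt0 _ _)) // ltW // w_gt0.
- by rewrite !addr_ge0 // mulr_ge0 // sqr_ge0.
rewrite /wt mulrC ler_pdivrMr ?quad_gt0 // -subr_ge0.
have en := lt0r_neq0 e0.
have -> : (1 + 2 * x0 ^+ 2 + 2 * e^-1 ^+ 2) * (1 + e ^+ 2 * (x - x0) ^+ 2) - (1 + x ^+ 2) =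
  (x - 2 * x0) ^+ 2 + 2 * e^-1 ^+ 2 + (1 + 2 * x0 ^+ 2) * (e * (x - x0)) ^+ 2 by field.
rewrite !addr_ge0 ?sqr_ge0 // mulr_ge0 ?sqr_ge0 //.
by rewrite addr_ge0 // mulr_ge0 // sqr_ge0.
Qed.

Variables (n : nat) (b : 'I_n -> 'I_n -> coeffs R) (MB : R) (h : 'I_n -> SRZ R).
Hypothesis hb : forall l k, rapid (b l k).
Hypothesis MB0 : 0 < MB.
Hypothesis hMB : forall l k p q, cabs (b l k p q) <= MB * (kap R p * kap R q).
Hypothesis rbig : 144 * n%:R * MB <= r.
Hypothesis hS : forall l, S (h l).

Definition rS (u : SRZ R) : SRZ R := fun x al => resolv kappa zeta r (fun t => u t al) x.

(* Neumann series: w = sum_j rS (useq j) solves the equation. *)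
Fixpoint useq (j : nat) : 'I_n -> SRZ R :=
  if j is j'.+1 then fun l x al => - \sum_k act (rS (useq j' k)) (b l k) x al else h.

(** The third condition is what the resolvent needs for exponent k; the fourth says that the
    translations in b at most double its bound. The number e depends on k, whereas r and [MB] do
    not. *)
Definition good_eps (k : nat) (e : R) := [/\ 0 < e, e <= 1, 8 * k%:R * e ^+ 2 <= r ^+ 2 &
  forall l k' p q, cabs (b l k' p q) * (1 + e * `|zR R p / mu|) ^+ (2 * k) <= 2 * MB * (kap R p * kap R q)].

Lemma ex_eps k : exists e, good_eps k e.
Proof.
have [A A0 hA] : exists2 A, 0 <= A &
    forall l k' p q, cabs (b l k' p q) * (1 + `|zR R p / mu|) ^+ (2 * k) <= A * (kap R p * kap R q).
  have H l k' : exists A, 0 <= A /\ forall p q, cabs (b l k' p q) * (1 + `|zR R p / mu|) ^+ (2 * k) <= A * (kap R p * kap R q).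
    have rw : rapid (fun p q => cR ((1 + `|zR R p / mu|) ^+ (2 * k)) * b l k' p q).
      have hw p q : cabs (cR ((1 + `|zR R p / mu|) ^+ (2 * k))) <=
          (1 + `|mu^-1|) ^+ (2 * k) * (1 + `|zR R p| + `|zR R q|) ^+ (2 * k).
        rewrite cabs_cR ger0_norm ?exprn_ge0 ?addr_ge0 // -exprMn.
        apply: lerXn2r; rewrite ?nnegrE; [by rewrite addr_ge0|by rewrite mulr_ge0 ?addr_ge0|].
        rewrite normrM; have := normr_ge0 (zR R p); have := normr_ge0 (zR R q).
        have := normr_ge0 mu^-1; move: (`|_|) (`|zR R p|) (`|zR R q|) => u v w u0 w0 v0.
        by have := mulr_ge0 u0 w0; lra.
      by apply: rapidM hw (hb l k'); rewrite exprn_ge0 // addr_ge0.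
    have [A A0 hA] := rapid_dom rw; exists A; split => // p q.
    have := hA p q; rewrite cabsM cabs_cR ger0_norm ?exprn_ge0 ?addr_ge0 //.
    by rewrite mulrC.
  have [F hF] := choice (fun lk : 'I_n * 'I_n => H lk.1 lk.2).
  exists (\sum_i F i); first by apply: sumr_ge0 => i _; case: (hF i).
  move=> l k' p q; have [_ /(_ p q)] := hF (l, k'); move=> /le_trans; apply.
  rewrite ler_wpM2r ?mulr_ge0 ?kap_ge0 // (bigD1 (l, k')) //= lerDl.
  by apply: sumr_ge0 => i _; case: (hF i).
(* The second bound gives 8 k e^2 <= 9 (k+1)^2 e^2 <= r^2. The third makes e A <= [MB], so that
   interpolating between the plain bound [MB] and the weighted bound A stays below 2 [MB]. *)
pose e := Num.min (Num.min 1 (r / (3 * k.+1%:R))) (MB / (A + 1)).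
have e1 : e <= 1 by rewrite /e !ge_min lexx.
have e2 : e <= r / (3 * k.+1%:R) by rewrite /e !ge_min lexx orbT.
have e3 : e <= MB / (A + 1) by rewrite /e ge_min lexx orbT.
have k0 : (0 : R) < 3 * k.+1%:R by rewrite mulr_gt0 ?ltr0Sn.
have A1 : 0 < A + 1 by rewrite ltr_wpDl.
have e0 : 0 < e by rewrite /e !lt_min ltr01 !divr_gt0.
exists e; split => //.
  have e4 : e * (3 * k.+1%:R) <= r by rewrite -ler_pdivlMr.
  apply: (@le_trans _ _ ((e * (3 * k.+1%:R)) ^+ 2)); last first.
    by apply: lerXn2r; rewrite ?nnegrE ?(ltW r0) // mulr_ge0 ?(ltW e0) // ltW.
  rewrite !exprMn [leRHS]mulrC ler_wpM2r ?sqr_ge0 // -natr1.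
  have : (0 : R) <= k%:R by []; nra.
move=> l k' p q; set s := `|zR R p / mu|.
have e01 : 0 <= e <= 1 by rewrite (ltW e0) e1.
apply: (le_trans (ler_wpM2l (cabs_ge0 _) (convex_pow (2 * k) e01 (normr_ge0 (zR R p / mu))))).
have h1 := hMB l k' p q; have h2 := hA l k' p q; rewrite -/s in h2 *.
have K0 : 0 <= kap R p * kap R q by rewrite mulr_ge0 ?kap_ge0.
have eA : e * A <= MB.
  apply: (@le_trans _ _ (e * (A + 1))); first by rewrite ler_wpM2l ?(ltW e0) // lerDl.
  by rewrite -ler_pdivlMr.
have h3 := ler_wpM2l (ltW e0) h2; have h4 := ler_wpM2r K0 eA.
have h5 : (1 - e) * cabs (b l k' p q) <= cabs (b l k' p q).
  by rewrite -[leRHS]mul1r ler_wpM2r ?cabs_ge0 // gerBl ltW.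
rewrite mulrDr mulrCA.
move: h1 h3 h4 h5; set K := kap R p * kap R q; set C := cabs _; set v := _ ^+ (2 * k).
by rewrite [C * (1 - e)]mulrC -mulrA; lra.
Qed.

(** Quantified over all weights at once: the ratio 1/2 is common to every k, and only the starting
    constant M varies. *)
Definition ubound (u : 'I_n -> SRZ R) (j : nat) := forall k e, good_eps k e ->
  forall M, 0 <= M -> (forall l x al, cabs (h l x al) <= M * wt e (x - x0) ^+ k) ->
  forall l x al, cabs (u l x al) <= M * 2^-1 ^+ j * wt e (x - x0) ^+ k.

Lemma h_wt k e : 0 <= e <= 1 -> exists2 M, 0 <= M & forall l x al, cabs (h l x al) <= M * wt e (x - x0) ^+ k.
Proof.
move=> e01.
have H l : exists M, 0 <= M /\ forall x al, cabs (h l x al) <= M * wt e (x - x0) ^+ k.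
  have [ph sh] := hS l.
  have [M hM] := rapS_unif c0 k ph (fun al => schwartz_rapdec (sh al)).
  have hb' x al := @rapdec_wt (fun x => h l x al) e M k e01 (fun x => hM x al) x.
  exists (M * (2 * (1 + x0 ^+ 2)) ^+ k); split => //.
  rewrite mulr_ge0 //; last by rewrite exprn_ge0 // mulr_ge0 // ltW // w_gt0.
  by apply: le_trans (hM 0 0); rewrite mulr_ge0 ?cabs_ge0 // exprn_ge0 // ltW // w_gt0.
have [F hF] := choice H.
exists (\sum_i F i); first by apply: sumr_ge0 => i _; case: (hF i).
move=> l x al; have [_ /(_ x al)] := hF l; move=> /le_trans; apply.
rewrite ler_wpM2r ?exprn_ge0 ?(ltW (wt_gt0 _ _)) // (bigD1 l) //= lerDl.
by apply: sumr_ge0 => i _; case: (hF i).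
Qed.

Lemma rS_periodic u : c_periodic c u -> c_periodic c (rS u).
Proof. by move=> pu x al; rewrite /rS; congr resolv; apply/funext => t; rewrite pu. Qed.

Lemma rS_wt u k e M : good_eps k e -> contS u -> 0 <= M ->
  (forall x al, cabs (u x al) <= M * wt e (x - x0) ^+ k) ->
  forall x al, cabs (rS u x al) <= 4 / r * M * wt e (x - x0) ^+ k.
Proof.
move=> [_ _ he _] cu M0 hu x al.
exact: (resolv_le kappa r0 he x (cu al) M0 (fun t => hu t al)).
Qed.

Lemma rS_cder u : contS u -> forall x al,
  cder (fun t => rS u t al) x ((kappa * cR x + zeta) * rS u x al + u x al).
Proof. by move=> cu x al; apply: (cder_resolv zeta r0 kappaE x (cu al)). Qed.

Lemma cls_drift W f : cls theta c d W f -> cls theta c d W (fun x al => (kappa * cR x + zeta) * f x al).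
Proof.
move=> cf; have := cls_D (cls_Z kappa (cls_X cf)) (cls_Z zeta cf).
congr cls; apply/funext => x; apply/funext => al.
by rewrite -[LHS]/(kappa * mulX f x al + zeta * f x al) /mulX; ring.
Qed.

(** Decay comes from the weighted bounds, one e for each k. Smoothness is a bootstrap: the
    derivative of [rS u] is the drift times [rS u] plus u, which stays in the class generated by
    [rS u]. *)
Lemma rS_Edc u : S u ->
  (forall k e, good_eps k e -> exists2 M, 0 <= M & forall x al, cabs (u x al) <= M * wt e (x - x0) ^+ k) ->
  S (rS u).
Proof.
move=> hu hM; have cu := Edc_cont c0 hu.
apply: (@cls_Edc _ theta c d c0 [set rS u]); last by apply: cls_gen.
move=> _ ->; split; first by apply: rS_periodic; case: hu.
- move=> al k; have [e he] := ex_eps k; have [M M0 hM'] := hM _ _ he.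
  have hv := rS_wt he cu M0 hM'.
  have [e0 _ _ _] := he.
  have M1 : 0 <= 4 / r * M by rewrite mulr_ge0 // divr_ge0 // ltW.
  exists (4 / r * M * (1 + 2 * x0 ^+ 2 + 2 * e^-1 ^+ 2) ^+ k).
  exact: (wt_rapdec e0 M1 (fun x => hv x al)).
- exists (fun x al => (kappa * cR x + zeta) * rS u x al + u x al).
    apply: (cls_D (f := fun x al => (kappa * cR x + zeta) * rS u x al)); last exact: cls_S.
    by apply: cls_drift; apply: cls_gen.
  exact: rS_cder.
Qed.

(** One round multiplies the bound by n * 9 * 2 MB * 4/r = 72 n MB / r, which [rbig] makes at most
    1/2. *)
Lemma useq_bound j : (forall l, S (useq j l)) /\ ubound (useq j) j.
Proof.
elim: j => [|j [IH1 IH2]].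
  by split => // k e _ M M0 hM l x al; rewrite expr0 mulr1.
have vb k e (he : good_eps k e) : exists2 M, 0 <= M & forall l x al, cabs (useq j l x al) <= M * wt e (x - x0) ^+ k.
  have [e0 e1 _ _] := he; have e01 : 0 <= e <= 1 by rewrite (ltW e0).
  have [M M0 hM] := h_wt k e01; exists (M * 2^-1 ^+ j).
    by rewrite mulr_ge0 // exprn_ge0 // invr_ge0.
  exact: IH2 he _ M0 hM.
have Sv l : S (rS (useq j l)).
  apply: rS_Edc => // k e he; have [M M0 hM] := vb k e he.
  by exists M => // x al; apply: hM.
split.
  move=> l; have E : useq j.+1 l = (fun x al => -1 * (\sum_k act (rS (useq j k)) (b l k)) x al).
    by apply/funext => x; apply/funext => al; rewrite mulN1r SRZ_sumE.
  rewrite E; apply: Edc_Z; apply: Edc_sum => k _.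
  by apply: Edc_act_closed.
move=> k e he M M0 hM l x al /=; rewrite cabsN.
apply: (le_trans (cabs_sum _ _ _)).
have hu := IH2 _ _ he _ M0 hM.
have Mj : 0 <= M * 2^-1 ^+ j by rewrite mulr_ge0 // exprn_ge0 // invr_ge0.
have hv l' := rS_wt he (Edc_cont c0 (IH1 l')) Mj (hu l').
have [e0 _ _ ha] := he.
set w := wt e (x - x0) ^+ k.
have w0 : 0 <= w by rewrite exprn_ge0 // ltW // wt_gt0.
apply: (@le_trans _ _ (\sum_(i < n) 9 * (2 * MB * (4 / r * (M * 2^-1 ^+ j))) * w)).
  by apply: ler_sum => i _; apply: (act_wt (ltW e0) (hv i) (ha l i)).
rewrite sumr_const card_ord -[leLHS]mulr_natl exprS.
have -> : n%:R * (9 * (2 * MB * (4 / r * (M * 2^-1 ^+ j))) * w) =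
  (144 * n%:R * MB / r) * (M * (2^-1 * 2^-1 ^+ j) * w).
  by field; exact: lt0r_neq0.
rewrite -[leRHS]mul1r ler_wpM2r //; last by rewrite ler_pdivrMr // mul1r.
by rewrite mulr_ge0 // mulr_ge0 // mulr_ge0 ?invr_ge0 // exprn_ge0 // invr_ge0.
Qed.

Definition vseq j l := rS (useq j l).

(** Returns to the weights 1 + x^2. The conversion constant depends on e, hence on k, but the
    geometric ratio is untouched. *)
Lemma useq_geom k : exists2 M, 0 <= M & forall j l x al,
  cabs (useq j l x al) * (1 + x ^+ 2) ^+ k <= M * 2^-1 ^+ j /\
  cabs (vseq j l x al) * (1 + x ^+ 2) ^+ k <= M * 2^-1 ^+ j.
Proof.
have [e he] := ex_eps k; have [e0 e1 _ _] := he.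
have e01 : 0 <= e <= 1 by rewrite (ltW e0).
have [M M0 hM] := h_wt k e01.
pose D := (1 + 2 * x0 ^+ 2 + 2 * e^-1 ^+ 2) ^+ k.
have D0 : 0 <= D by rewrite exprn_ge0 // !addr_ge0 // mulr_ge0 // sqr_ge0.
have r4 : 0 <= 4 / r by rewrite divr_ge0 // ltW.
exists ((1 + 4 / r) * M * D); first by rewrite !mulr_ge0 // addr_ge0.
move=> j l x al.
have g0 : 0 <= (2^-1 : R) ^+ j by rewrite exprn_ge0 // invr_ge0.
have Mj : 0 <= M * 2^-1 ^+ j by rewrite mulr_ge0.
have [Su hu] := useq_bound j; have {}hu := hu _ _ he _ M0 hM.
have hv := rS_wt he (Edc_cont c0 (Su l)) Mj (hu l).
have Mj' : 0 <= 4 / r * (M * 2^-1 ^+ j) by rewrite mulr_ge0.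
have h1 := wt_rapdec e0 Mj (fun x => hu l x al) x.
have h2 := wt_rapdec e0 Mj' (fun x => hv x al) x.
rewrite -/D in h1 h2; have MDj : 0 <= M * D * 2^-1 ^+ j by rewrite !mulr_ge0.
have E : (1 + 4 / r) * M * D * 2^-1 ^+ j = M * D * 2^-1 ^+ j + 4 / r * (M * D * 2^-1 ^+ j) by ring.
have P : 0 <= 4 / r * (M * D * 2^-1 ^+ j) by rewrite mulr_ge0.
rewrite E; split.
- by apply: (le_trans h1); rewrite mulrAC lerDl.
- apply: (le_trans h2); rewrite (_ : _ * D = 4 / r * (M * D * 2^-1 ^+ j)); last by ring.
  by rewrite lerDr.
Qed.

Definition wsol l : SRZ R := fun x al => gser (fun j => vseq j l x al).
Definition usol l : SRZ R := fun x al => gser (fun j => useq j l x al).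

Lemma geom0 k : exists2 M, 0 <= M & forall l x al,
  (forall j, cabs (useq j l x al) <= M / (1 + x ^+ 2) ^+ k * 2^-1 ^+ j) /\
  (forall j, cabs (vseq j l x al) <= M / (1 + x ^+ 2) ^+ k * 2^-1 ^+ j).
Proof.
have [M M0 hM] := useq_geom k; exists M => // l x al.
have W0 : 0 < (1 + x ^+ 2) ^+ k by rewrite exprn_gt0 // w_gt0.
by split=> j; have [h1 h2] := hM j l x al; rewrite mulrAC ler_pdivlMr.
Qed.

Lemma to0_half (M : R) : 0 <= M -> to0 (fun N => M * 2^-1 ^+ N).
Proof.
move=> M0; apply: to0_le (to0_harmonic M) => j; rewrite ler_wpM2l //.
by rewrite exprVn lef_pV2 ?posrE ?exprn_gt0 ?ltr0Sn // -natrX ler_nat ltn_expl.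
Qed.

(** The drift grows linearly in x; one power of 1 + x^2 in the geometric bounds compensates it and
    makes the series of derivatives converge uniformly. *)
Lemma cder_wsol l x al :
  cder (fun t => wsol l t al) x ((kappa * cR x + zeta) * wsol l x al + usol l x al).
Proof.
have [M M0 hM] := geom0 1.
pose C := (cabs kappa + cabs zeta + 1) * (2 * M).
have C0 : 0 <= C by rewrite mulr_ge0 ?mulr_ge0 // !addr_ge0 // cabs_ge0.
apply: (@cder_unif_lim _ (fun N x => \sum_(j < N) vseq j l x al)
   (fun N x => \sum_(j < N) ((kappa * cR x + zeta) * vseq j l x al + useq j l x al))
   (fun t => wsol l t al) (fun x => (kappa * cR x + zeta) * wsol l x al + usol l x al)
   (fun N => C * 2^-1 ^+ N)); last exact: to0_half.
- move=> N y; apply: cder_sum => j _.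
  by apply: rS_cder; apply: (Edc_cont c0); case: (useq_bound j).
- by move=> y; have [_ h2] := hM l y al; case: (gser_clim h2).
move=> N y; have [h1 h2] := hM l y al.
have [_ /(_ N) b1] := gser_clim h1; have [_ /(_ N) b2] := gser_clim h2.
rewrite big_split /= -mulr_sumr cabsB opprD addrACA -mulrBr.
apply: (le_trans (cabsD _ _)); rewrite cabsM.
have kb : cabs (kappa * cR y + zeta) <= (cabs kappa + cabs zeta) * (1 + y ^+ 2).
  apply: (le_trans (cabsD _ _)); rewrite cabsM cabs_cR mulrDl lerD //.
    by rewrite ler_wpM2l ?cabs_ge0 // norm_le_w.
  by rewrite ler_peMr ?cabs_ge0 // w_ge1.
have W0 := w_gt0 y; rewrite expr1 in b1 b2.
apply: (le_trans (lerD (ler_pM (cabs_ge0 _) (cabs_ge0 _) kb b2) b1)).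
set g := 2^-1 ^+ N; have g0 : 0 <= g by rewrite exprn_ge0 // invr_ge0.
have -> : (cabs kappa + cabs zeta) * (1 + y ^+ 2) * (2 * (M / (1 + y ^+ 2)) * g) =
   (cabs kappa + cabs zeta) * (2 * M) * g.
  by field; exact: lt0r_neq0.
have -> : C * g = (cabs kappa + cabs zeta) * (2 * M) * g + 2 * M * g by rewrite /C; ring.
rewrite lerD2l ler_wpM2r //.
rewrite ler_wpM2l // ler_pdivrMr // ler_peMr // w_ge1 //.
Qed.

Lemma wsol_periodic l : c_periodic c (wsol l).
Proof.
move=> x al; rewrite /wsol; congr gser; apply/funext => j.
by apply: rS_periodic; have [/(_ l)[]] := useq_bound j.
Qed.

Lemma wsol_rapS l : rapS (wsol l).
Proof.
move=> al k; have [M M0 hM] := geom0 k; exists (2 * M) => x.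
have [_ h2] := hM l x al; have [_ /(_ 0%N)] := gser_clim h2.
rewrite big_ord0 subr0 expr0 mulr1 mulrA ler_pdivlMr ?exprn_gt0 ?w_gt0 //.
Qed.

(** A shift of index in the series, since each term after h is minus the action of b on the previous
    resolvent. The action passes to the limit because the partial sums of [wsol] converge
    uniformly. *)
Lemma usolE l x al : usol l x al = h l x al - \sum_k act (wsol k) (b l k) x al.
Proof.
have [M M0 hM] := geom0 0.
have W1 y : 1 = (1 + y ^+ 2) ^+ 0 :> R by rewrite expr0.
have hM' l' y be : (forall j, cabs (useq j l' y be) <= M * 2^-1 ^+ j) /\ (forall j, cabs (vseq j l' y be) <= M * 2^-1 ^+ j).
  by have := hM l' y be; rewrite expr0 divr1.
have [hu _] := hM' l x al; have [L1 _] := gser_clim hu.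
have Lu : clim (fun N => \sum_(j < N.+1) useq j l x al) (usol l x al).
  by move=> e e0; have [N hN] := L1 e e0; exists N => m Nm; apply: hN; apply: leqW.
apply: (clim_uniq Lu).
pose vN (N : nat) k : SRZ R := fun y be => \sum_(j < N) vseq j k y be.
have bv N k : bnd (2 * M) (vN N k).
  move=> y be; have [_ hv] := hM' k y be; apply: (le_trans (cabs_sum _ _ _)).
  apply: (@le_trans _ _ (\sum_(j < N) M * 2^-1 ^+ j)); first by apply: ler_sum => j _.
  have : \sum_(j < N) M * 2^-1 ^+ j = 2 * M * (1 - 2^-1 ^+ N).
    elim: N => [|N IH]; first by rewrite big_ord0 expr0 subrr mulr0.
    by rewrite big_ord_recr /= IH exprS; field.
  move=> ->; rewrite -[leRHS]mulr1 ler_wpM2l ?mulr_ge0 // gerBl exprn_ge0 // invr_ge0 //.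
have [AA AA0 hA] : exists2 A, 0 <= A & forall k p q, cabs (b l k p q) <= A * (kap R p * kap R q).
  by exists MB => //; exact: ltW.
have actsum N k y be : act (vN N k) (b l k) y be = \sum_(j < N) act (vseq j k) (b l k) y be.
  elim: N => [|N IH].
    rewrite big_ord0 Edc_actE (@eq_sumZ2 _ _ (fun _ _ => 0)); last first.
      by move=> p q; rewrite /wtau /vN big_ord0 !mulr0.
    exact: (@sumZ2_single _ (fun _ _ => 0)).
  rewrite big_ord_recr /= -IH !Edc_actE.
  have bN : bnd M (vseq N k).
    move=> y' be'; have [_ hv] := hM' k y' be'; apply: (le_trans (hv N)).
    by rewrite -[leRHS]mulr1 ler_wpM2l // exprn_ile1 ?invr_ge0 // invf_le1 ?ler1n.
  rewrite -(sumZ2D (dom_act theta c d (hA k) (bv N k) y be) (dom_act theta c d (hA k) bN y be)).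
  by apply: eq_sumZ2 => p q; rewrite /wtau /vN big_ord_recr /= !mulrDr.
have E N : \sum_(j < N.+1) useq j l x al = h l x al - \sum_k act (vN N k) (b l k) x al.
  rewrite big_ord_recl /=; congr (_ + _); rewrite sumrN; congr (- _).
  rewrite exchange_big /=; apply: eq_bigr => k _; by rewrite actsum.
under eq_fun do rewrite E; apply: climB; first exact: clim_cst.
apply: clim_sum => k.
pose t N := 9 * (MB * (2 * M)) * 2^-1 ^+ N.
have bd N : cabs (act (vN N k) (b l k) x al - act (wsol k) (b l k) x al) <= t N.
  have tail y be : cabs (vN N k y be - wsol k y be) <= 2 * M * 2^-1 ^+ N.
    by have [_ hv] := hM' k y be; have [_ /(_ N)] := gser_clim hv; rewrite cabsB.
  have tw : bnd (2 * M) (wsol k).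
    move=> y be; have [_ hv] := hM' k y be; have [_ /(_ 0%N)] := gser_clim hv.
    by rewrite big_ord0 subr0 expr0 mulr1.
  have D1 := dom_act theta c d (hMB l k) (bv N k) x al.
  have D2 := dom_act theta c d (hMB l k) tw x al.
  rewrite !Edc_actE -mulN1r -(sumZ2Z _ D2) -(sumZ2D D1 (domZ (- 1) D2)).
  rewrite /t -mulrA; apply: sumZ2_le => p q; rewrite mulN1r -mulrBr cabsM.
  rewrite /wtau -mulrBr cabsM cabs_ee mul1r.
  apply: (@le_trans _ _ (MB * (kap R p * kap R q) * (2 * M * 2^-1 ^+ N))).
    by apply: ler_pM; rewrite ?cabs_ge0 //; exact: hMB.
  by rewrite le_eqVlt; apply/orP; left; apply/eqP; ring.
apply: (to0_le bd); apply: to0_half; rewrite !mulr_ge0 // ltW //.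
Qed.

(** All components generate the class together, because the derivative of one involves the others
    through b. *)
Lemma wsol_Edc l : S (wsol l).
Proof.
apply: (@cls_Edc _ theta c d c0 [set f | exists l, f = wsol l]); last by apply: cls_gen; exists l.
move=> _ [m ->]; split; [exact: wsol_periodic|exact: wsol_rapS|].
have E : usol m = h m + \sum_k (fun x al => -1 * act (wsol k) (b m k) x al).
  apply/funext => x; apply/funext => al; rewrite usolE.
  rewrite -[RHS]/(h m x al + (\sum_k (fun x al => -1 * act (wsol k) (b m k) x al)) x al).
  by rewrite SRZ_sumE -mulr_sumr mulN1r.
exists (fun x al => (kappa * cR x + zeta) * wsol m x al + usol m x al); last by move=> x al; apply: cder_wsol.
apply: (cls_D (f := fun x al => (kappa * cR x + zeta) * wsol m x al)).
  by apply: cls_drift; apply: cls_gen; exists m.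
rewrite E; apply: cls_D; first by apply: cls_S; apply: hS.
apply: big_ind; [by apply: cls_S; apply: Edc_0|by move=> f g; apply: cls_D|].
by move=> k _; apply: cls_Z; apply: cls_act => //; apply: cls_gen; exists k.
Qed.

Lemma solve_dbar : exists w : 'I_n -> SRZ R, (forall l, S (w l)) /\ forall l x al,
  derX (w l) x al - (kappa * cR x + zeta) * w l x al + \sum_k act (w k) (b l k) x al = h l x al.
Proof.
exists wsol; split; first exact: wsol_Edc.
move=> l x al; have E := cder_uniq (cder_derX x al (wsol_Edc l)) (cder_wsol l x al).
rewrite E usolE; ring.
Qed.

End Solver.

Local Notation mP X := (@mcP _ X).
Local Notation mact X := (@mcact _ X).
Local Notation mnab X := (@mcnab _ X).

(** * Splitting the extension *)

Section Modules.
Variables (R : realType) (theta : R) (tau : CC R).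

Section OneModule.
Variable X : MC R.
Hypothesis hX : is_rmod theta X.
Local Notation P := (@mcP R X).
Local Notation ac := (@mcact R X).

Lemma mc0 : P 0. Proof. by case: hX. Qed.
Lemma mcD x y : P x -> P y -> P (x + y). Proof. by case: hX => _ [h _]; apply: h. Qed.
Lemma mcN x : P x -> P (- x). Proof. by case: hX => _ [_ [h _]]; apply: h. Qed.
Lemma mcB x y : P x -> P y -> P (x - y). Proof. by move=> hx hy; apply: mcD => //; apply: mcN. Qed.
Lemma mc_act x a : P x -> rapid a -> P (ac x a).
Proof. by case: hX => _ [_ [_ [h _]]]; apply: h. Qed.
Lemma mc_actDl x y a : P x -> P y -> rapid a -> ac (x + y) a = ac x a + ac y a.
Proof. by case: hX => _ [_ [_ [_ [h _]]]]; apply: h. Qed.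
Lemma mc_actDr x a b : P x -> rapid a -> rapid b -> ac x (aadd a b) = ac x a + ac x b.
Proof. by case: hX => _ [_ [_ [_ [_ [h _]]]]]; apply: h. Qed.
Lemma mc_actM x a b : P x -> rapid a -> rapid b -> ac (ac x a) b = ac x (amul theta a b).
Proof. by case: hX => _ [_ [_ [_ [_ [_ [_ h]]]]]]; apply: h. Qed.

Lemma mc_sum (I : Type) (r : seq I) (F : I -> mcV X) : (forall i, P (F i)) -> P (\sum_(i <- r) F i).
Proof. by move=> h; apply: big_ind => //; [exact: mc0|exact: mcD]. Qed.

Lemma mc_act0 a : rapid a -> ac 0 a = 0.
Proof.
move=> ra; have := mc_actDl mc0 mc0 ra; rewrite addr0 => /eqP.
by rewrite -subr_eq0 opprD addrA subrr sub0r oppr_eq0 => /eqP.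
Qed.

Lemma mc_actN x a : P x -> rapid a -> ac (- x) a = - ac x a.
Proof.
move=> hx ra; apply/eqP; rewrite -addr_eq0 -mc_actDl //; last exact: mcN.
by rewrite addNr mc_act0.
Qed.

Lemma mc_act_sum (I : Type) (r : seq I) (F : I -> mcV X) a : (forall i, P (F i)) -> rapid a ->
  ac (\sum_(i <- r) F i) a = \sum_(i <- r) ac (F i) a.
Proof.
move=> h ra; elim: r => [|i r IH]; first by rewrite !big_nil mc_act0.
by rewrite !big_cons mc_actDl ?IH //; apply: mc_sum.
Qed.

End OneModule.

Lemma mc_nab (X : MC R) x : is_conn tau X -> mP X x -> mP X (mnab X x).
Proof. by case=> h _; apply: h. Qed.
Lemma mc_nabD (X : MC R) x y : is_conn tau X -> mP X x -> mP X y -> mnab X (x + y) = mnab X x + mnab X y.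
Proof. by case=> _ [h _]; apply: h. Qed.
Lemma mc_nabM (X : MC R) x (a : coeffs R) : is_conn tau X -> mP X x -> rapid a ->
  mnab X (mact X x a) = mact X (mnab X x) a + mact X x (delta tau a).
Proof. by case=> _ [_ h]; apply: h. Qed.

(** Modules are subsets of an ambient group and maps are additive on the subset only, so even f 0 =
    0 has to be derived there. *)
Definition additive_on (U V : zmodType) (P : set U) (f : U -> V) :=
  forall x y, P x -> P y -> f (x + y) = f x + f y.

Section AdditiveOn.
Variables (U V : zmodType) (P : set U) (f : U -> V).
Hypotheses (P0 : P 0) (PD : forall x y, P x -> P y -> P (x + y)) (PN : forall x, P x -> P (- x)).
Hypothesis hf : additive_on P f.

Lemma addon0 : f 0 = 0.
Proof.
have := hf P0 P0; rewrite addr0 => /eqP.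
by rewrite -subr_eq0 opprD addrA subrr sub0r oppr_eq0 => /eqP.
Qed.

Lemma addonN x : P x -> f (- x) = - f x.
Proof. by move=> hx; apply/eqP; rewrite -addr_eq0 -hf ?addNr ?addon0 //; apply: PN. Qed.

Lemma addonB x y : P x -> P y -> f (x - y) = f x - f y.
Proof. by move=> hx hy; rewrite hf ?addonN //; apply: PN. Qed.

Lemma addon_sum (I : Type) (r : seq I) (F : I -> U) : (forall i, P (F i)) ->
  f (\sum_(i <- r) F i) = \sum_(i <- r) f (F i).
Proof.
move=> h; elim: r => [|i r IH]; first by rewrite !big_nil addon0.
by rewrite !big_cons hf ?IH //; apply: big_ind.
Qed.

End AdditiveOn.

Lemma rapidD (a b : coeffs R) : rapid a -> rapid b -> rapid (aadd a b).
Proof.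
move=> ha hb k; have [M hM] := ha k; have [N hN] := hb k; exists (M + N) => m n.
apply: le_trans (lerD (hM m n) (hN m n)); rewrite -mulrDl ler_wpM2r ?cabsD //.
Qed.

Lemma rapid0 : rapid (0 : coeffs R).
Proof. by move=> k; exists 0 => m n; rewrite cabs0 mul0r. Qed.

Lemma rapid1 : rapid (@aone R).
Proof.
move=> k; exists 1 => m n; rewrite /aone; case: ifP => [/andP[/eqP -> /eqP ->]|_].
  by rewrite cabs1 /zR normr0 !addr0 expr1n mulr1.
by rewrite cabs0 mul0r.
Qed.

Lemma rapid_sum (I : Type) (r : seq I) (F : I -> coeffs R) : (forall i, rapid (F i)) ->
  rapid (\sum_(i <- r) F i).
Proof. by move=> h; apply: big_ind => //; [exact: rapid0|exact: rapidD]. Qed.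

Lemma amul1 (a : coeffs R) : amul theta (@aone R) a = a.
Proof.
apply/funext => m; apply/funext => n; rewrite /amul sumZ2_single.
  by rewrite /aone eqxx /zR mulr0 mul0r ee0 mulr1 mul1r !subr0.
move=> k l; rewrite -negb_and => /negbTE kl.
by rewrite /aone kl !mul0r.
Qed.

Lemma amul0 (a : coeffs R) : amul theta 0 a = 0.
Proof.
apply/funext => m; apply/funext => n; rewrite /amul sumZ2_single.
  by rewrite /= !mul0r.
by move=> k l _; rewrite /= !mul0r.
Qed.

End Modules.

(** * The connection of a projective module in free coordinates *)

Section FreeCoordinates.
Variables (R : realType) (theta : R) (tau : CC R) (E : MC R).
Hypothesis mE : is_rmod theta E.
Hypothesis nE : is_conn tau E.
Variables (n : nat) (i : mcV E -> 'I_n -> coeffs R) (p : ('I_n -> coeffs R) -> mcV E).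
Hypothesis iR : forall e k, mP E e -> rapid (i e k).
Hypothesis iD : forall e e', mP E e -> mP E e' -> i (e + e') = fun k => aadd (i e k) (i e' k).
Hypothesis pP : forall v, (forall k, rapid (v k)) -> mP E (p v).
Hypothesis pD : forall v w, (forall k, rapid (v k)) -> (forall k, rapid (w k)) ->
  p (fun k => aadd (v k) (w k)) = p v + p w.
Hypothesis pA : forall v a, (forall k, rapid (v k)) -> rapid a ->
  p (fun k => amul theta (v k) a) = mact E (p v) a.
Hypothesis ipK : forall e, mP E e -> p (i e) = e.

Let rapids : set ('I_n -> coeffs R) := [set v | forall k, rapid (v k)].

Lemma p_additive : additive_on rapids p.
Proof. by move=> v w; exact: pD. Qed.

Lemma rapids0 : rapids 0. Proof. by move=> k; apply: rapid0. Qed.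
Lemma rapidsD v w : rapids v -> rapids w -> rapids (v + w).
Proof. by move=> hv hw k; apply: rapidD. Qed.

Lemma p_sum (r : seq 'I_n) (F : 'I_n -> 'I_n -> coeffs R) : (forall k l, rapid (F k l)) ->
  p (fun l => \sum_(k <- r) F k l) = \sum_(k <- r) p (F k).
Proof.
move=> h; rewrite -(addon_sum rapids0 rapidsD p_additive); last by move=> k l; exact: h.
congr p; apply/funext => l.
by elim/big_rec2: _ => // k y1 y2 _ ->.
Qed.

Lemma i_sum (I : Type) (r : seq I) (F : I -> mcV E) l : (forall k, mP E (F k)) ->
  i (\sum_(k <- r) F k) l = \sum_(k <- r) i (F k) l.
Proof.
move=> h; apply: (@addon_sum _ _ (mP E) (fun e => i e l)) => //.
- exact: (mc0 mE).
- exact: (mcD mE).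
- by move=> x y hx hy; rewrite iD.
Qed.

Definition stdvec (k : 'I_n) : 'I_n -> coeffs R := fun l => if l == k then @aone R else 0.

Lemma rapid_stdvec k l : rapid (stdvec k l).
Proof. by rewrite /stdvec; case: ifP => _; [exact: rapid1|exact: rapid0]. Qed.

Lemma p_coord (v : 'I_n -> coeffs R) : (forall k, rapid (v k)) ->
  p v = \sum_k mact E (p (stdvec k)) (v k).
Proof.
move=> hv.
have F k : p (fun l => amul theta (stdvec k l) (v k)) = mact E (p (stdvec k)) (v k).
  by apply: pA => // l; apply: rapid_stdvec.
have G k l : amul theta (stdvec k l) (v k) = if l == k then v k else 0.
  by rewrite /stdvec; case: ifP => _; rewrite ?amul1 ?amul0.
rewrite -(eq_bigr _ (fun k _ => F k)) -p_sum; last first.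
  by move=> k l; rewrite G; case: ifP => _ //; exact: rapid0.
congr p; apply/funext => l; rewrite (bigD1 l) //= G eqxx big1 ?addr0 //.
by move=> k kl; rewrite G eq_sym (negbTE kl).
Qed.

(* The connection matrix of E: [nab_p] reads p (delta v + B v). *)
Definition connmx (l k : 'I_n) : coeffs R := i (mnab E (p (stdvec k))) l.

Lemma rapid_connmx l k : rapid (connmx l k).
Proof. by apply: iR; apply: (mc_nab nE); apply: pP => m; apply: rapid_stdvec. Qed.

(** Rapid decay of the products is left to the caller: for the vectors that occur, [chi_left]
    exhibits the products themselves as pairings, whose decay is [chi_rapid]. *)
Lemma nab_p (v : 'I_n -> coeffs R) : (forall k, rapid (v k)) ->
  (forall l k, rapid (amul theta (connmx l k) (v k))) ->
  mnab E (p v) = p (fun l => aadd (delta tau (v l)) (\sum_k amul theta (connmx l k) (v k))).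
Proof.
move=> hv hB.
have hst k : mP E (p (stdvec k)) by apply: pP => l; apply: rapid_stdvec.
have hd k : rapid (delta tau (v k)) by apply: rapid_delta.
rewrite pD //; last by move=> l; apply: rapid_sum.
rewrite p_sum // (p_coord hd) (p_coord hv).
have nabS := @addon_sum _ _ (mP E) (mnab E) (mc0 mE) (fun x y => mcD mE (x := x) (y := y))
   (fun x y hx hy => mc_nabD nE hx hy).
rewrite nabS; last by move=> k; apply: (mc_act mE).
rewrite -big_split /=; apply: eq_bigr => k _.
rewrite (mc_nabM nE) // addrC; congr (_ + _).
rewrite -[in LHS](ipK (mc_nab nE (hst k))) -pA //.
by move=> l; apply: rapid_connmx.
Qed.

End FreeCoordinates.

(** * Correcting an A_theta-linear section to a holomorphic one *)

Section Splitting.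
Variables (R : realType) (theta : R) (tau : CC R) (c d : int) (z : CC R).
Hypothesis cn : c < 0.
Hypothesis nu0 : 0 < zR R c * theta + zR R d.

Local Notation S := (@Edc_P R c).
Local Notation act := (Edc_act theta c d).
Local Notation nab0 := (Edc_nab theta tau c d z).
Local Notation chi := (chi theta c d).
Let E0 := Edc_bundle theta tau c d z.
Let c0 : c != 0 := c_neq0 cn.

Variables (X E : MC R) (j : mcV E -> mcV X) (q : mcV X -> SRZ R).
Hypotheses (mX : is_rmod theta X) (nX : is_conn tau X).
Hypotheses (mE : is_rmod theta E) (nE : is_conn tau E).
Hypothesis hj : is_mor j.
Hypothesis hq : @is_mor R X E0 q.
Hypothesis j_inj : forall e e', mP E e -> mP E e' -> j e = j e' -> e = e'.
Hypothesis q_surj : forall y, S y -> exists2 x, mP X x & q x = y.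
Hypothesis q_exact : forall x, mP X x -> (q x = 0 <-> exists2 e, mP E e & j e = x).

Lemma jP e : mP E e -> mP X (j e). Proof. by case: hj => h _; apply: h. Qed.
Lemma jD e e' : mP E e -> mP E e' -> j (e + e') = j e + j e'. Proof. by case: hj => _ [h _]; apply: h. Qed.
Lemma jA e a : mP E e -> rapid a -> j (mact E e a) = mact X (j e) a.
Proof. by case: hj => _ [_ [h _]]; apply: h. Qed.
Lemma jN e : mP E e -> j (mnab E e) = mnab X (j e). Proof. by case: hj => _ [_ [_ h]]; apply: h. Qed.
Lemma qP x : mP X x -> S (q x). Proof. by case: hq => h _; apply: h. Qed.
Lemma qD x y : mP X x -> mP X y -> q (x + y) = q x + q y. Proof. by case: hq => _ [h _]; apply: h. Qed.
Lemma qA x a : mP X x -> rapid a -> q (mact X x a) = act (q x) a.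
Proof. by case: hq => _ [_ [h _]]; apply: h. Qed.
Lemma qN x : mP X x -> q (mnab X x) = nab0 (q x). Proof. by case: hq => _ [_ [_ h]]; apply: h. Qed.

Lemma q_sum (I : Type) (r : seq I) (F : I -> mcV X) : (forall k, mP X (F k)) ->
  q (\sum_(k <- r) F k) = \sum_(k <- r) q (F k).
Proof. exact: (addon_sum (mc0 mX) (fun x y => mcD mX (x := x) (y := y)) qD). Qed.

Lemma qB x y : mP X x -> mP X y -> q (x - y) = q x - q y.
Proof. exact: (addonB (mc0 mX) (fun x => mcN mX (x := x)) qD). Qed.

(* The Leibniz rule and stability under the connection need no proof on E_{d,c}: they descend
   along the surjective morphism q. *)
Lemma nab0_S f : S f -> S (nab0 f).
Proof. by move=> /q_surj[x hx <-]; rewrite -qN //; apply: qP; apply: (mc_nab nX). Qed.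

Lemma nab0D f g : S f -> S g -> nab0 (f + g) = nab0 f + nab0 g.
Proof.
move=> /q_surj[x hx <-] /q_surj[y hy <-].
by rewrite -qD // -!qN ?(mc_nabD nX) ?qD //; [exact: (mc_nab nX)|exact: (mc_nab nX)|exact: (mcD mX)].
Qed.

Lemma act_S f a : S f -> rapid a -> S (act f a).
Proof. exact: (Edc_act_closed theta d c0). Qed.

Lemma nab0M f a : S f -> rapid a -> nab0 (act f a) = act (nab0 f) a + act f (delta tau a).
Proof.
move=> /q_surj[x hx <-] ra; have rd := rapid_delta tau ra.
rewrite -qA // -!qN // ?(mc_nabM nX) //; last exact: (mc_act mX).
by rewrite qD ?qA //; [exact: (mc_nab nX)|apply: (mc_act mX) => //; exact: (mc_nab nX)|exact: (mc_act mX)].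
Qed.

Variables (K : nat) (ff gg : 'I_K -> SRZ R).
Hypotheses (ffS : forall k, S (ff k)) (ggS : forall k, S (gg k)).
Hypothesis frame : forall f, S f -> \sum_k act (ff k) (chi (gg k) f) = f.
Variable xx : 'I_K -> mcV X.
Hypothesis xxP : forall k, mP X (xx k).
Hypothesis qxx : forall k, q (xx k) = ff k.

Lemma chiR g f : S g -> S f -> rapid (chi g f).
Proof. exact: (chi_rapid c0 nu0). Qed.

Lemma chi_addr g f f' : S g -> S f -> S f' -> chi g (f + f') = aadd (chi g f) (chi g f').
Proof. by move=> *; apply/funext => m; apply/funext => n; apply: chiDr. Qed.

Lemma chi_sumr (I : Type) (r : seq I) (G : I -> SRZ R) f : (forall k, S (G k)) -> S f ->
  chi (\sum_(k <- r) G k) f = \sum_(k <- r) chi (G k) f.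
Proof.
move=> hG hf; apply: (@addon_sum _ _ S (fun g => chi g f)) => //.
- exact: Edc_0.
- by move=> g g'; apply: Edc_D.
- by move=> g g' hg hg'; apply/funext => m; apply/funext => n; apply: chiDl.
Qed.

(* A module section of q, compatible with the right action but not with the connections;
   [defect] measures the failure. *)
Definition lift0 (f : SRZ R) : mcV X := \sum_k mact X (xx k) (chi (gg k) f).

Lemma lift0_P f : S f -> mP X (lift0 f).
Proof. by move=> hf; apply: (mc_sum mX) => k; apply: (mc_act mX) => //; apply: chiR. Qed.

Lemma lift0_q f : S f -> q (lift0 f) = f.
Proof.
move=> hf; rewrite q_sum; last by move=> k; apply: (mc_act mX) => //; apply: chiR.
by rewrite -[RHS]frame //; apply: eq_bigr => k _; rewrite qA ?qxx //; apply: chiR.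
Qed.

Lemma lift0_D f g : S f -> S g -> lift0 (f + g) = lift0 f + lift0 g.
Proof.
move=> hf hg; rewrite /lift0 -big_split /=; apply: eq_bigr => k _.
by rewrite chi_addr // (mc_actDr mX) //; apply: chiR.
Qed.

Lemma lift0_A f a : S f -> rapid a -> lift0 (act f a) = mact X (lift0 f) a.
Proof.
move=> hf ra; rewrite /lift0 (mc_act_sum mX) //; last by move=> k; apply: (mc_act mX) => //; apply: chiR.
apply: eq_bigr => k _; rewrite (mc_actM mX) //; last exact: chiR.
by rewrite (chi_act c0 nu0) //; apply: act_S.
Qed.

Definition defect f : mcV X := mnab X (lift0 f) - lift0 (nab0 f).

Lemma defect_P f : S f -> mP X (defect f).
Proof.
move=> hf; apply: (mcB mX); last by apply: lift0_P; apply: nab0_S.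
by apply: (mc_nab nX); apply: lift0_P.
Qed.

Lemma defect_q f : S f -> q (defect f) = 0.
Proof.
move=> hf; have h1 := lift0_P hf; have h2 := nab0_S hf.
by rewrite qB ?qN ?lift0_q ?subrr //; [exact: (mc_nab nX)|exact: lift0_P].
Qed.

Lemma ex_obstr : exists obstr : SRZ R -> mcV E, forall f, S f -> mP E (obstr f) /\ j (obstr f) = defect f.
Proof.
have H f : exists e, S f -> mP E e /\ j e = defect f.
  have [hf|nf] := pselect (S f); last by exists 0.
  have [h _] := q_exact (defect_P hf); have [e he je] := h (defect_q hf).
  by exists e.
by have [F hF] := choice H; exists F.
Qed.

Variable obstr : SRZ R -> mcV E.
Hypothesis obstrP : forall f, S f -> mP E (obstr f) /\ j (obstr f) = defect f.

Lemma obstr_D f g : S f -> S g -> obstr (f + g) = obstr f + obstr g.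
Proof.
move=> hf hg; have [f1 f2] := obstrP hf; have [g1 g2] := obstrP hg.
have [h1 h2] := obstrP (Edc_D hf hg).
apply: j_inj => //; first exact: (mcD mE).
rewrite (jD f1 g1) h2 f2 g2 /defect (nab0D hf hg) (lift0_D hf hg) (lift0_D (nab0_S hf) (nab0_S hg)).
by rewrite (mc_nabD nX (lift0_P hf) (lift0_P hg)) opprD addrACA.
Qed.

(** Both terms of the defect obey the Leibniz rule, and their contributions lift0 f . delta a
    cancel. *)
Lemma obstr_A f a : S f -> rapid a -> obstr (act f a) = mact E (obstr f) a.
Proof.
move=> hf ra; have [f1 f2] := obstrP hf; have [h1 h2] := obstrP (act_S hf ra).
have rd := rapid_delta tau ra; have hn := nab0_S hf; have hl := lift0_P hf.
apply: j_inj => //; first exact: (mc_act mE).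
rewrite (jA f1 ra) h2 f2 /defect (nab0M hf ra) (lift0_D (act_S hn ra) (act_S hf rd)).
rewrite (lift0_A hf ra) (lift0_A hn ra) (lift0_A hf rd).
have hnl : mP X (mnab X (lift0 f)) by exact: (mc_nab nX).
have hln : mP X (lift0 (nab0 f)) by exact: lift0_P.
rewrite (mc_nabM nX hl ra) (mc_actDl mX hnl (mcN mX hln) ra) (mc_actN mX hln ra).
by rewrite opprD addrACA subrr addr0.
Qed.

Lemma obstr_frame f : S f -> obstr f = \sum_k mact E (obstr (ff k)) (chi (gg k) f).
Proof.
move=> hf; rewrite -{1}(frame hf).
rewrite (@addon_sum _ _ S obstr) //.
- by apply: eq_bigr => k _; rewrite obstr_A //; apply: chiR.
- exact: Edc_0.
- by move=> ? ?; apply: Edc_D.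
- by move=> ? ?; apply: obstr_D.
- by move=> k; apply: act_S => //; apply: chiR.
Qed.

Variables (n : nat) (i : mcV E -> 'I_n -> coeffs R) (p : ('I_n -> coeffs R) -> mcV E).
Hypothesis iR : forall e k, mP E e -> rapid (i e k).
Hypothesis iD : forall e e', mP E e -> mP E e' -> i (e + e') = fun k => aadd (i e k) (i e' k).
Hypothesis iA : forall e a, mP E e -> rapid a -> i (mact E e a) = fun k => amul theta (i e k) a.
Hypothesis pP : forall v, (forall k, rapid (v k)) -> mP E (p v).
Hypothesis pD : forall v w, (forall k, rapid (v k)) -> (forall k, rapid (w k)) ->
  p (fun k => aadd (v k) (w k)) = p v + p w.
Hypothesis pA : forall v a, (forall k, rapid (v k)) -> rapid a ->
  p (fun k => amul theta (v k) a) = mact E (p v) a.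
Hypothesis ipK : forall e, mP E e -> p (i e) = e.

Local Notation B := (connmx i p).

(** Linearity over the frame gives obstr f as the sum of obstr (ff_k) . <gg_k, f>. In coordinates
    the first factor multiplies the pairing on the left, and [chi_left] moves it into the window
    gg_k. *)
Definition kernel_of l : SRZ R := \sum_k act (gg k) (lcoef theta (i (obstr (ff k)) l)).

Lemma kernel_S l : S (kernel_of l).
Proof.
apply: Edc_sum => k _; apply: act_S => //; apply: rapid_lcoef; apply: iR.
by case: (obstrP (ffS k)).
Qed.

Lemma obstr_kernel f l : S f -> i (obstr f) l = chi (kernel_of l) f.
Proof.
move=> hf; have ob k := (obstrP (ffS k)).1.
have rc k : rapid (chi (gg k) f) by apply: chiR.
have rl k : rapid (i (obstr (ff k)) l) by apply: iR.
rewrite obstr_frame // (i_sum mE iD); last by move=> k; apply: (mc_act mE).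
have Sk k : S (act (gg k) (lcoef theta (i (obstr (ff k)) l))) by apply: act_S => //; apply: rapid_lcoef.
rewrite /kernel_of chi_sumr //; apply: eq_bigr => k _.
by rewrite iA // (chi_left c0 nu0).
Qed.

Variable w : 'I_n -> SRZ R.
Hypothesis wS : forall l, S (w l).
Hypothesis wE : forall l x al,
  derX (w l) x al - twopii R * (tau * cR (slope theta c d * x) + z) * w l x al +
  \sum_k act (w k) (lcoef theta (B l k)) x al = kernel_of l x al.

Definition corr f : mcV E := p (fun l => chi (w l) f).

Lemma corr_P f : S f -> mP E (corr f).
Proof. by move=> hf; apply: pP => l; apply: chiR. Qed.

Lemma corr_D f g : S f -> S g -> corr (f + g) = corr f + corr g.
Proof.
move=> hf hg; rewrite /corr -pD; [|by move=> l; apply: chiR|by move=> l; apply: chiR].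
by congr p; apply/funext => l; apply: chi_addr.
Qed.

Lemma corr_A f a : S f -> rapid a -> corr (act f a) = mact E (corr f) a.
Proof.
move=> hf ra; rewrite /corr -pA //; last by move=> l; apply: chiR.
by congr p; apply/funext => l; rewrite (chi_act c0 nu0) //; apply: act_S.
Qed.

(** Applied to the vector of pairings <w_l, f>, the connection delta + B becomes pairings with the
    left-hand side of [wE], by [chi_delta] and [chi_left], plus the pairings with nab f. The
    equation replaces the former by the kernel of [obstr]. *)
Lemma corr_nab f : S f -> mnab E (corr f) = corr (nab0 f) + obstr f.
Proof.
move=> hf; have hn := nab0_S hf; have [ob _] := obstrP hf.
have rB l k : rapid (B l k) by exact: (rapid_connmx nE iR pP).
have Sb l k : S (act (w k) (lcoef theta (B l k))) by apply: act_S => //; apply: rapid_lcoef.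
have left l k : amul theta (B l k) (chi (w k) f) = chi (act (w k) (lcoef theta (B l k))) f.
  by apply: (chi_left c0 nu0).
rewrite /corr (nab_p mE nE iR pP pD pA ipK); first last.
- by move=> l k; rewrite left; apply: chiR.
- by move=> k; apply: chiR.
rewrite -[in RHS](ipK ob) -pD; [|by move=> l; apply: chiR|by move=> l; apply: iR].
congr p; apply/funext => l; rewrite obstr_kernel //.
rewrite (eq_bigr _ (fun k _ => left l k)) -chi_sumr //.
set D0 : SRZ R := fun x al => derX (w l) x al - twopii R * (tau * cR (slope theta c d * x) + z) * w l x al.
(* The equation itself displays [D0] as a difference of Schwartz functions. *)
have SD : S D0.
  have E1 : D0 = kernel_of l + (fun x al => -1 * (\sum_k act (w k) (lcoef theta (B l k))) x al).
    apply/funext => x; apply/funext => al.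
    rewrite -[RHS]/(kernel_of l x al + -1 * (\sum_k act (w k) (lcoef theta (B l k))) x al) -wE.
    by rewrite SRZ_sumE /D0 mulN1r addrK.
  rewrite E1; apply: Edc_D; first exact: kernel_S.
  by apply: Edc_Z; apply: Edc_sum => k _.
have Ek : kernel_of l = D0 + \sum_k act (w k) (lcoef theta (B l k)).
  apply/funext => x; apply/funext => al; rewrite -wE.
  rewrite -[RHS]/(D0 x al + (\sum_k act (w k) (lcoef theta (B l k))) x al).
  by rewrite SRZ_sumE.
apply/funext => m; apply/funext => m'; rewrite /aadd Ek chiDl //; last by apply: Edc_sum => k _.
rewrite addrA; congr (_ + _).
have := chi_delta c0 nu0 tau z (wS l) hf m m'; rewrite -/D0 => <-.
by rewrite addrC subrK.
Qed.

(** Both nab (lift0 f) and nab (j (corr f)) miss compatibility by the same [defect f], so the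
    difference commutes with the connections; subtracting an element of the image of j leaves q
    unchanged. *)
Lemma split_mor : exists s : SRZ R -> mcV X, @is_mor R E0 X s /\ (forall y, S y -> q (s y) = y).
Proof.
exists (fun f => lift0 f - j (corr f)).
have jc f : S f -> mP X (j (corr f)) by move=> hf; apply: jP; apply: corr_P.
have P1 f : S f -> mP X (lift0 f - j (corr f)).
  by move=> hf; apply: (mcB mX); [exact: lift0_P|exact: jc].
split; last first.
  move=> f hf; rewrite qB ?lift0_q //; [|exact: lift0_P|exact: jc].
  by have [_ h] := q_exact (jc f hf); rewrite h ?subr0 //; exists (corr f) => //; apply: corr_P.
split; first exact: P1.
split.
  move=> f g hf hg; rewrite lift0_D // corr_D // jD; [|exact: corr_P|exact: corr_P].
  by rewrite opprD addrACA.
split.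
  move=> f a hf ra; rewrite /= lift0_A // corr_A // jA //; last exact: corr_P.
  rewrite (mc_actDl mX) //; [|exact: lift0_P|by apply: (mcN mX); apply: jc].
  by rewrite (mc_actN mX) //; apply: jc.
move=> f hf; rewrite /=; have hn := nab0_S hf.
have [ob1 ob2] := obstrP hf.
have nabX := @addonB _ _ (mP X) (mnab X) (mc0 mX) (fun x => mcN mX (x := x)) (fun x y hx hy => mc_nabD nX hx hy).
rewrite nabX; [|exact: lift0_P|exact: jc].
rewrite -jN; last exact: corr_P.
rewrite corr_nab // jD //; last exact: corr_P.
rewrite ob2 /defect opprD opprB; move: (mnab X _) (j _) (lift0 _) => A C b.
by rewrite (addrC (- C)) addrA (addrC A) subrK.
Qed.

End Splitting.

Lemma rapid_mx_dom (R : realType) (n : nat) (b : 'I_n -> 'I_n -> coeffs R) :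
  (forall l k, rapid (b l k)) ->
  exists2 M : R, 0 < M & forall l k p q, cabs (b l k p q) <= M * (kap R p * kap R q).
Proof.
move=> hb.
have H (lk : 'I_n * 'I_n) : exists A : R, 0 <= A /\
    forall p q, cabs (b lk.1 lk.2 p q) <= A * (kap R p * kap R q).
  by have [A A0 hA] := rapid_dom (hb lk.1 lk.2); exists A.
have [A hA] := choice H.
have A0 lk : 0 <= A lk by case: (hA lk).
exists (1 + \sum_lk A lk); first by apply: ltr_wpDr => //; apply: sumr_ge0.
move=> l k p q; apply: le_trans ((hA (l, k)).2 p q) _.
apply: ler_wpM2r; first by apply: mulr_ge0; apply: kap_ge0.
by rewrite (bigD1 (l, k)) //= addrCA lerDl addr_ge0 // sumr_ge0.
Qed.

Theorem theorem2p9 (R : realType) (theta : R) (tau : CC R) :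
  irrational theta -> cIm tau != 0 -> cIm tau < 0 ->
  forall E : MC R, is_holbundle theta tau E ->
  exists C0 : R,
    forall (c d : int) (z : CC R),
      coprimez c d -> 0 < zR R c * theta + zR R d ->
      slope theta c d < C0 ->
      Ext1_vanishes theta tau (std_bundle theta tau c d z) E.
Proof.
move=> _ _ tau0 E [mE [nE [n [i [p [iR [iD [iA [pP [pD [pA ipK]]]]]]]]]]].
pose b l k := lcoef theta (connmx i p l k).
have hb l k : rapid (b l k) by apply: rapid_lcoef; apply: (rapid_connmx nE iR pP).
have [M M0 hM] := rapid_mx_dom hb.
pose D : R := 2 * pi * cIm tau.
have D0 : D < 0 by rewrite /D pmulr_rlt0 // mulr_gt0 // pi_gt0.
pose T : R := 144 * n%:R * M.
have T0 : 0 <= T by rewrite /T !mulr_ge0 // ltW.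
(* As D < 0, slope < T^2/D means D * slope > T^2, that is r > T for r^2 = D * slope. The matrix size
   n and the bound M come from E alone. *)
exists ((T ^+ 2) / D) => c d z cop nu0 hs.
have sT : T ^+ 2 <= D * slope theta c d.
  by rewrite mulrC -ler_ndivlMr //; apply: ltW.
(* The chosen constant is at most 0, so only negative slopes occur; then c < 0 and the free bundle
   A_theta, of slope 0, is excluded. *)
have s0 : slope theta c d < 0.
  apply: lt_le_trans hs _; apply: mulr_ge0_le0; first exact: sqr_ge0.
  by rewrite invr_le0 ltW.
have cn : c < 0.
  have : zR R c < 0.
    by move: s0; rewrite /slope pmulr_llt0 // invr_gt0.
  by rewrite /zR ltrz0.
have c0 : c != 0 by rewrite lt_eqF.
rewrite /std_bundle (negbTE c0) => X [mX [nX _]] j q hj hq j_inj q_surj exX.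
have [K [ff [gg [ffS ggS frame]]]] := ex_frame cn cop nu0.
have Hx k : exists x, mcP x /\ q x = ff k by have [x hx qx] := q_surj _ (ffS k); exists x.
have [xx hxx] := choice Hx.
have xxP k := (hxx k).1; have qxx k := (hxx k).2.
have [obstr obstrP] := ex_obstr cn nu0 mX nX hq q_surj exX ggS frame xxP qxx.
have Ds0 : 0 < D * slope theta c d by rewrite nmulr_rgt0.
pose r := Num.sqrt (D * slope theta c d).
have r0 : 0 < r by rewrite sqrtr_gt0.
have r2 : r ^+ 2 = D * slope theta c d by rewrite sqr_sqrtr // ltW.
have rbig : T <= r by rewrite -(ler_pXn2r (n := 2)) ?nnegrE ?r2 // ltW.
have kappaE : cRe (twopii R * tau * cR (slope theta c d)) = - r ^+ 2.
  by rewrite r2 /D; clear; case: tau => a e; rewrite /cRe /cIm /=; ring.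
have kS := kernel_S cn ffS ggS obstrP iR.
(* The parameter z enters through zeta = 2 pi i z only, on which the size condition on r does not
   depend; hence the constant is uniform in z. *)
have [w [wS wE]] := solve_dbar theta d c0 (twopii R * z) r0 kappaE hb M0 hM rbig kS.
apply: (split_mor cn nu0 mX nX mE nE hj hq j_inj q_surj exX ffS ggS frame xxP qxx obstrP
  iR iD iA pP pD pA ipK wS) => l x al.
rewrite -wE; congr (_ - _ + _); rewrite cRM; ring.
Qed.
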